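(* Let $\Gamma$ be a countable discrete amenable and residually finite group and let $f\in\mathbb{Z}\Gamma$. Then the action of $\Gamma$ on $X_f$ is expansive if and only if $f$ is a unit in $L^1(\Gamma)$. In this case $$h_f=\log\det\nolimits_{\mathcal{N}\Gamma} f .$$
   Context: $L^1(\Gamma)$ is the convolution algebra of absolutely summable functions $h=(h_\gamma)_{\gamma\in\Gamma}$, $h_\gamma\in\mathbb{R}$, with product $(h\cdot h')_\gamma=\sum_{\gamma'}h_{\gamma'}h'_{\gamma'^{-1}\gamma}$; the integral group ring $\mathbb{Z}\Gamma$ is a subring of it (finitely supported integer-valued functions). Units are two-sided. With $\mathbb{T}=\mathbb{R}/\mathbb{Z}$ and $f=\sum_\gamma f_\gamma\gamma\in\mathbb{Z}\Gamma$, $X_f=\{x\in\mathbb{T}^\Gamma:\sum_{\gamma'}f_{\gamma'}x_{\gamma\gamma'}=0 \text{ in }\mathbb{T}\text{ for all }\gamma\in\Gamma\}$, a closed subgroup of the compact group $\mathbb{T}^\Gamma$ (it is the Pontryagin dual of $\mathbb{Z}\Gamma/\mathbb{Z}\Gamma f$). $\Gamma$ acts on $X_f$ by continuous automorphisms $(\gamma\cdot x)_{\gamma'}=x_{\gamma^{-1}\gamma'}$. The action is expansive if there is an open neighbourhood $\mathcal{U}$ of $0$ in $X_f$ with $\bigcap_{\gamma\in\Gamma}\gamma\cdot\mathcal{U}=\{0\}$. $h_f$ is the topological entropy of this action: for a Følner sequence $(F_n)$ of nonempty finite subsets of $\Gamma$ ($|\gamma F_n\triangle F_n|/|F_n|\to0$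 for all $\gamma\in\Gamma$), $h_f=\sup_{\mathcal V}\lim_n\frac1{|F_n|}\log N(\bigvee_{\gamma\in F_n}\gamma^{-1}\mathcal V)$, the supremum over open covers $\mathcal V$ of $X_f$, $N$ denoting minimal cardinality of a subcover; this does not depend on $(F_n)$ (and coincides with the measure-theoretic entropy for Haar measure). $L^2(\Gamma,\mathbb{C})$ is the complex Hilbert space of square-summable functions on $\Gamma$; $\mathcal{N}\Gamma$ is the von Neumann algebra of bounded operators on $L^2(\Gamma,\mathbb{C})$ commuting with all left shifts $(\lambda^\gamma v)_{\gamma'}=v_{\gamma^{-1}\gamma'}$; its trace is $\operatorname{tr}_{\mathcal{N}\Gamma}(A)=\langle A e(1),e(1)\rangle$, where $e(1)$ is the indicator function of the identity. An element $f\in L^1(\Gamma)$ is identified with the operator $\rho_f\in\mathcal{N}\Gamma$, $\rho_f(v)=v\cdot f^*$, where $(f^* )_\gamma=f_{\gamma^{-1}}$. For an invertible $A\in\mathcal{N}\Gamma$ the Fuglede–Kadison determinant is $\det_{\mathcal{N}\Gamma}A=\exp\left(\frac12\operatorname{tr}_{\mathcal{N}\Gamma}(\log AA^* )\right)$. *)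

(* Defs.v *)
From HB Require Import structures.
From mathcomp Require Import all_boot all_order all_fingroup all_algebra finmap ring lra.
From mathcomp Require Import generic_quotient ring_quotient complex.
From mathcomp Require Import all_classical all_reals all_analysis.
Import numFieldNormedType.Exports.

Set Implicit Arguments.
Unset Strict Implicit.
Unset Printing Implicit Defensive.

Import Order.TTheory GRing.Theory Num.Theory.
Local Open Scope classical_set_scope.
Local Open Scope ring_scope.
Local Open Scope complex_scope.

Definition folner (R : realType) (G : groupType) (F : nat -> {fset G}) :=
  (forall n, F n != fset0) /\
  forall g : G,
    (fun n => let gF := [fset (g * x)%g | x in F n]%fset in
       #|` ((gF `\` F n) `|` (F n `\` gF))%fset|%:R / #|` F n|%:R : R) @ \oo
    --> (0 : R).

Definition amenable (R : realType) (G : groupType) :=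
  exists F : nat -> {fset G}, folner R F.

Definition residually_finite (G : groupType) :=
  forall g : G, g <> 1%g ->
    exists (H : finGroupType) (phi : G -> H),
      {morph phi : x y / (x * y)%g} /\ phi g <> 1%g.

(* rsum and csum are only meaningful on absolutely summable families. *)
Definition rsum (R : realType) (G : choiceType) (a : G -> R) : R :=
  fine (esum setT (fun g => (a g)%:E)^\+%E) -
  fine (esum setT (fun g => (a g)%:E)^\-%E).

Definition csum (R : realType) (G : choiceType) (a : G -> R[i]) : R[i] :=
  rsum (fun g => complex.Re (a g)) +i* rsum (fun g => complex.Im (a g)).

Definition in_L1 (R : realType) (G : choiceType) (h : G -> R) : Prop :=
  summable setT (fun g => (h g)%:E).

Definition conv (R : realType) (G : groupType) (h k : G -> R) : G -> R :=
  fun g => rsum (fun g' => h g' * k (g'^-1 * g)%g).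

Definition cconv (R : realType) (G : groupType) (h k : G -> R[i]) : G -> R[i] :=
  fun g => csum (fun g' => h g' * k (g'^-1 * g)%g).

Definition delta1 (R : nzRingType) (G : groupType) : G -> R :=
  fun g => (g == 1%g)%:R.

Definition L1_unit (R : realType) (G : groupType) (h : G -> R) :=
  in_L1 h /\
  exists k : G -> R,
    [/\ in_L1 k, conv h k = delta1 R (G := G) & conv k h = delta1 R (G := G)].

Notation group_ring G := {fsfun G -> int with 0}.

Definition ZG_L1 (R : realType) (G : groupType) (f : group_ring G) : G -> R :=
  fun g => (f g)%:~R.

(* int_num_subdef is the predicate underlying Num.int. *)
Definition RmodZ (R : realType) : Type :=
  @Quotient.quot R (GRing.ZmodClosed.clone R (@Num.int_num_subdef R) _).
HB.instance Definition _ (R : realType) := EqQuotient.on (RmodZ R).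

Definition circle (R : realType) : Type := quotient_topology (RmodZ R).
HB.instance Definition _ (R : realType) := Topological.on (circle R).
HB.instance Definition _ (R : realType) :=
  GRing.Zmodule.copy (circle R) (RmodZ R).

Section action.
Variables (R : realType) (G : groupType).

Local Notation TG := {ptws G -> circle R}.

Definition act (g : G) (x : TG) : TG := fun g' => x (g^-1 * g')%g.

Definition Xf (f : group_ring G) : set TG :=
  [set x | forall g : G,
     \sum_(g' <- finsupp f) x (g * g')%g *~ f g' = 0 :> circle R].

Definition rel_open (f : group_ring G) (U : set TG) :=
  exists2 O : set TG, open O & U = Xf f `&` O.

Definition expansive (f : group_ring G) :=
  exists U : set TG,
    [/\ rel_open f U, U (fun=> 0) &
        \bigcap_(g in setT) (act g @` U) = [set (fun=> 0)]].

Definition open_cover (f : group_ring G) (V : set (set TG)) :=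
  (forall U, V U -> rel_open f U) /\ \bigcup_(U in V) U = Xf f.

Definition cover_join (F : {fset G}) (V : set (set TG)) : set (set TG) :=
  [set W | exists c : G -> set TG,
     (forall g, g \in F -> V (c g)) /\
     W = \bigcap_(g in [set` F]) (act g^-1%g @` c g)].

Definition has_subcover (f : group_ring G) (V : set (set TG)) (n : nat) :=
  exists C : set (set TG),
    [/\ C `<=` V, \bigcup_(U in C) U = Xf f & (C #= `I_n)%card].

(* The minimal cardinality of a subcover; it exists for open covers since Xf f
   is compact. *)
Definition subcover_number (f : group_ring G) (V : set (set TG)) : nat :=
  xget 0%N [set n | has_subcover f V n /\
                    forall m, has_subcover f V m -> (n <= m)%N].

(* By the Ornstein-Weiss lemma the limits exist when G is amenable and F is a
   Folner sequence. *)
Definition entropy (F : nat -> {fset G}) (f : group_ring G) : \bar R :=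
  ereal_sup
    [set (lim ((fun n =>
            ln (subcover_number f (cover_join (F n) V))%:R / #|` F n|%:R : R)
          @ \oo))%:E | V in open_cover f].

End action.

Definition normsq (R : realType) (z : R[i]) : R :=
  complex.Re z ^+ 2 + complex.Im z ^+ 2.

Definition square_summable (R : realType) (G : choiceType) :
    {pred (G -> R[i]^o)} :=
  fun u => summable setT (fun g => (normsq (u g))%:E).

Section l2_closed.
Variables (R : realType) (G : choiceType).

Lemma normsq_ge0 (z : R[i]) : 0 <= normsq z.
Proof. by rewrite addr_ge0 ?sqr_ge0. Qed.

Lemma square_summableE (u : G -> R[i]^o) :
  (u \in @square_summable R G) =
  (\esum_(g in setT) (normsq (u g))%:E < +oo)%E.
Proof.
rewrite -topredE /= /square_summable /summable; congr (_ < _)%E.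
by apply: eq_esum => g _; rewrite gee0_abs// lee_fin normsq_ge0.
Qed.

Lemma normsqM (a z : R[i]) : normsq (a * z) = normsq a * normsq z.
Proof. by case: a z => [a b] [c d]; rewrite /normsq /=; ring. Qed.

Lemma normsqD (y z : R[i]) : normsq (y + z) <= 2 * normsq y + 2 * normsq z.
Proof.
case: y z => [a b] [c d]; rewrite /normsq /= -subr_ge0.
rewrite [X in 0 <= X](_ : _ = (a - c) ^+ 2 + (b - d) ^+ 2); last by ring.
by rewrite addr_ge0 ?sqr_ge0.
Qed.

Lemma square_summable_submod : submod_closed (@square_summable R G).
Proof.
split=> [|a u v]; rewrite !square_summableE.
  rewrite esum1 ?ltry// => g _.
  by rewrite /normsq /= expr0n addr0.
move=> su sv.
have scale (c : R) (b : G -> \bar R) : 0 <= c -> (forall g, 0 <= b g)%E ->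
    (\esum_(g in [set: G]) b g < +oo)%E ->
    (\esum_(g in [set: G]) (c%:E * b g) < +oo)%E.
  move=> c0 b0 sb; apply: (@le_lt_trans _ _ (c%:E * \esum_(g in [set: G]) b g)%E).
    apply: ge_ereal_sup => _ [F [finF _] <-].
    rewrite -ge0_mule_fsumr// lee_wpmul2l ?lee_fin//.
    by apply: ereal_sup_ubound; exists F.
  have : \esum_(g in [set: G]) b g \is a fin_num.
    by rewrite ge0_fin_numE// esum_ge0.
  by move=> /fineK <-; rewrite -EFinM ltry.
have n0 (w : G -> R[i]) : (forall g, 0 <= (normsq (w g))%:E :> \bar R)%E.
  by move=> g; rewrite lee_fin normsq_ge0.
have {}su := scale (2 * normsq a) _ (mulr_ge0 (ler0n _ 2) (normsq_ge0 a)) (n0 u) su.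
have {}sv := scale 2 _ (ler0n _ 2) (n0 v) sv.
apply: (@le_lt_trans _ _ (\esum_(g in [set: G])
  ((2 * normsq a)%:E * (normsq (u g))%:E + 2%:E * (normsq (v g))%:E))%E).
  apply: le_esum => g _; rewrite -!EFinM -EFinD lee_fin.
  by apply: le_trans (normsqD _ _) _; rewrite normsqM mulrA.
rewrite esumD; last 2 first.
- by move=> g _; rewrite mule_ge0// lee_fin mulr_ge0// normsq_ge0.
- by move=> g _; rewrite mule_ge0// lee_fin.
by rewrite lte_add_pinfty ?su ?sv// ?mulr_ge0 ?normsq_ge0.
Qed.

HB.instance Definition _ :=
  GRing.isSubmodClosed.Build R[i] (G -> R[i]^o) (@square_summable R G)
    square_summable_submod.

End l2_closed.

Record l2 (R : realType) (G : choiceType) := L2 {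
  l2_val :> G -> R[i]^o;
  l2_valP : l2_val \in @square_summable R G }.

HB.instance Definition _ (R : realType) (G : choiceType) :=
  [isSub for @l2_val R G].
HB.instance Definition _ (R : realType) (G : choiceType) :=
  [Choice of l2 R G by <:].
HB.instance Definition _ (R : realType) (G : choiceType) :=
  [SubChoice_isSubLmodule of l2 R G by <:].
HB.instance Definition _ (R : realType) (G : choiceType) :=
  isPointed.Build (l2 R G) 0.

Section operators.
Variables (R : realType) (G : groupType).
Local Notation H := (l2 R G).
Implicit Types (u v : H) (A B L : H -> H).

Definition inner u v : R[i] := csum (fun g => u g * (v g)^*).

Definition l2norm u : R := Num.sqrt (complex.Re (inner u u)).

Fact lshift_subproof (g : G) u :
  (fun g' => u (g^-1 * g')%g) \in @square_summable R G.
Proof.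
have := l2_valP u; rewrite !square_summableE => su.
rewrite -(reindex_esum setT setT (fun g' => g^-1 * g')%g
  (fun g' => (normsq (u g'))%:E))//.
split=> // [x y _ _ /mulgI//|y _]; exists (g * y)%g => //.
by rewrite mulgA mulVg mul1g.
Qed.

Definition lshift (g : G) u : H := L2 (lshift_subproof g u).

Definition bounded_op A :=
  linear A /\ exists M : R, forall u, l2norm (A u) <= M * l2norm u.

Definition in_NG A :=
  bounded_op A /\ forall (g : G) u, A (lshift g u) = lshift g (A u).

Definition NG_invertible A :=
  in_NG A /\ exists B, [/\ in_NG B, cancel A B & cancel B A].

Fact e1_subproof : (delta1 R[i] (G := G) : G -> R[i]^o) \in @square_summable R G.
Proof.
rewrite square_summableE (@eq_esum _ _ _ _
  (fun g => if g \in [set 1%g] then (normsq (1 : R[i]))%:E else 0%E)).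
  rewrite -esum_mkcond esum_set1 ?ltry//.
  by rewrite lee_fin normsq_ge0.
move=> g _; rewrite in_set1 /delta1; case: eqP => _ //.
by rewrite /normsq /= expr0n addr0.
Qed.

Definition e1 : H := L2 e1_subproof.

Definition tr A : R[i] := inner (A e1) e1.

Definition adjoint A : H -> H :=
  get [set B | forall u v, inner (A u) v = inner u (B v)].

Definition spectrum A : set R[i] :=
  [set z | ~ NG_invertible (fun u => A u - z *: u)].

Definition op_poly (p : {poly R}) A : H -> H :=
  fun u => \sum_(i < size p) (p`_i)%:C *: iter i A u.

Definition op_cvg (An : nat -> H -> H) L :=
  forall e : R, 0 < e -> \forall n \near \oo,
    forall u, l2norm (An n u - L u) <= e * l2norm u.

(* Continuous functional calculus g(A) for self-adjoint A in NG (so that the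
   spectrum is real): the operator norm limit of p_n(A) for real polynomials
   p_n converging to g uniformly on the spectrum of A. *)
Definition fun_calculus (g : R -> R) A : H -> H :=
  get [set L | exists p : nat -> {poly R},
    (forall e : R, 0 < e -> \forall n \near \oo,
       forall x : R, spectrum A x%:C -> `|(p n).[x] - g x| <= e) /\
    op_cvg (fun n => op_poly (p n) A) L].

(* Meant for invertible A in NG: A \o adjoint A is then self-adjoint with
   spectrum in ]0, +oo[, and the trace of its logarithm is real. *)
Definition FK_det A : R :=
  expR (2^-1 * complex.Re (tr (fun_calculus (@ln R) (A \o adjoint A)))).

Definition star (h : G -> R) : G -> R := fun g => h g^-1%g.

(* rho_h v = v . h^*; for h in L^1 the convolution is always square-summable,
   so the default value 0 is not used. *)
Definition rho (h : G -> R) : H -> H :=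
  fun v => insubd (0 : H) (cconv v (fun g => (star h g)%:C) : G -> R[i]^o).

End operators.

(* Main.v *)
(* A point x of X_f is represented by real lifts y, for which y . f^* is
   integer-valued.

   Expansiveness. If f has an inverse w in L^1, a bounded y with y . f^* = 0
   vanishes, so no nonzero point stays in a small neighbourhood of 0.
   Conversely, expansiveness makes y |-> y . f^* injective on l^infty. By
   Hahn-Banach there is then m in L^1 with |1 - m f|_1 < 1, hence a left inverse
   of f by a Neumann series; it is two-sided because it is so in every finite
   quotient of G, and G is residually finite.

   Entropy. On a window Phi with small boundary, X_(f^* f) has at most
   det ((f^* f)_Phi) e^(o|Phi|) separated points, by counting classes of Z^Phi
   modulo (f^* f)_Phi Z^Phi, whereas X_f and X_(f^* ) have at least
   det ((f^* f)_Phi)^(1/2) e^(-o|Phi|) each, by choosing a large square minor of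
   f on R^Phi (Cauchy-Binet). Separated sets of X_f and X_(f^* ) multiply to one
   of X_(f^* f), so all these bounds are sharp and
   h_f = lim (2 |Phi|)^-1 log det ((f^* f)_Phi). Approximating log uniformly by
   polynomials on an interval containing the spectra identifies this limit with
   1/2 tr (log f f^* ) = log det_NG f. *)
Require Import Defs.
From HB Require Import structures.
From mathcomp Require Import all_boot all_order all_fingroup all_algebra finmap.
From mathcomp Require Import sesquilinear spectral.
From mathcomp Require Import ring lra zify complex.
From mathcomp Require Import all_classical all_reals all_analysis.
Import numFieldNormedType.Exports.

Set Implicit Arguments.
Unset Strict Implicit.
Unset Printing Implicit Defensive.

Import Order.TTheory GRing.Theory Num.Theory.
Local Open Scope classical_set_scope.
Local Open Scope ring_scope.

(** * Absolutely summable families *)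

(** The section of f itself on a window may be singular although f is invertible, so its determinant
    carries no information. The sections of f^* f are positive definite uniformly in the window:
    their spectra lie between C^-2, with C a bound for the l^1 norm of the inverse, and the square
    of the l^1 norm of f. The upper count needs this because it solves a linear system with the
    section, stably in l^2; the comparison with det_NG f needs it because log is a uniform limit of
    polynomials only away from 0. This is why X_f is bounded from above through X_(f^* f), by
    division, and never directly. All estimates hold for an arbitrary finite window enumerated by an
    injective [e]. In logarithmic form their errors are n eta + D [bd e K], where K and D are fixed
    before the window; Folner sets come in at the end, where they make [bd e K] small relative to
    n. *)

Section Sums.
Variables (R : realType) (G : choiceType).
Implicit Types (a b : G -> R) (A B : {fset G}).

Definition l1bound a (C : R) := forall A, \sum_(g <- A) `|a g| <= C.

(** Unconditional convergence over the finite subsets. Linearity and reindexing are direct for this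
    relation, whereas [rsum] is a difference of two [esum]; the passage is [rsum_has_sum], valid
    under an [l1bound]. *)
Definition has_sum a (l : R) := forall e : R, 0 < e ->
  exists A, forall B, (A `<=` B)%fset -> `|\sum_(g <- B) a g - l| <= e.

Lemma has_sum_uniq a l l' : has_sum a l -> has_sum a l' -> l = l'.
Proof.
move=> h h'; apply/eqP; rewrite -subr_eq0 -normr_eq0 eq_le normr_ge0 andbT.
apply/ler_addgt0Pl => e e0; rewrite addr0.
have e2 : 0 < e / 2 by rewrite divr_gt0.
have [A hA] := h _ e2; have [A' hA'] := h' _ e2.
have := hA (A `|` A')%fset (fsubsetUl _ _).
have := hA' (A `|` A')%fset (fsubsetUr _ _).
set s := \sum_(_ <- _) _; move=> H1 H2.
rewrite (splitr e) (_ : l - l' = (s - l') - (s - l)); last by ring.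
by apply: le_trans (ler_normB _ _) _; exact: lerD.
Qed.

Lemma eq_has_sum a b l : a =1 b -> has_sum a l -> has_sum b l.
Proof. by move=> /funext ->. Qed.

Lemma has_sumD a b l m : has_sum a l -> has_sum b m ->
  has_sum (fun g => a g + b g) (l + m).
Proof.
move=> h h' e e0; have e2 : 0 < e / 2 by rewrite divr_gt0.
have [A hA] := h _ e2; have [A' hA'] := h' _ e2.
exists (A `|` A')%fset => B; rewrite fsubUset => /andP[/hA H1 /hA' H2].
rewrite big_split /= (splitr e) opprD addrACA.
by apply: le_trans (ler_normD _ _) _; exact: lerD.
Qed.

Lemma has_sumZ c a l : has_sum a l -> has_sum (fun g => c * a g) (c * l).
Proof.
move=> h e e0; have c0 : 0 < `|c| + 1 by rewrite ltr_wpDl.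
have [A hA] := h (e / (`|c| + 1)) (divr_gt0 e0 c0); exists A => B /hA H.
rewrite -big_distrr /= -mulrBr normrM.
apply: le_trans (ler_wpM2l (normr_ge0 _) H) _.
by rewrite mulrA ler_pdivrMr// [leLHS]mulrC ler_wpM2l ?(ltW e0)// lerDl ler01.
Qed.

Lemma has_sum0 : has_sum (fun=> 0) 0.
Proof.
move=> e e0; exists fset0 => B _; rewrite big1// subrr normr0; exact: ltW.
Qed.

Lemma has_sum_lin (I : Type) (r : seq I) (c : I -> R) (f : I -> G -> R) l :
  (forall i, has_sum (f i) (l i)) ->
  has_sum (fun g => \sum_(i <- r) c i * f i g) (\sum_(i <- r) c i * l i).
Proof.
move=> h; elim: r => [|i r IH].
  by rewrite big_nil; apply: eq_has_sum has_sum0 => g; rewrite big_nil.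
rewrite big_cons; apply: eq_has_sum (has_sumD (has_sumZ (c i) (h i)) IH) => g.
by rewrite big_cons.
Qed.

Lemma has_sum_fin a A : (forall g, g \notin A -> a g = 0) ->
  has_sum a (\sum_(g <- A) a g).
Proof.
move=> h e e0; exists A => B AB.
rewrite (big_fset_incl _ AB) ?subrr ?normr0 ?(ltW e0)// => g _ gA; exact: h.
Qed.

Lemma has_sum1 a x : (forall g, g != x -> a g = 0) -> has_sum a (a x).
Proof.
move=> h; have := @has_sum_fin a [fset x]%fset; rewrite big_seq_fset1; apply.
by move=> g; rewrite inE; exact: h.
Qed.

Lemma has_sum_le a C l : (forall A, \sum_(g <- A) a g <= C) -> has_sum a l ->
  l <= C.
Proof.
move=> h hl; apply/ler_addgt0Pr => e e0; have [A hA] := hl e e0.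
have /ler_normlP[] := hA A (fsubset_refl _).
by have := h A; set s := \sum_(_ <- _) _; lra.
Qed.

Lemma has_sum_norm_le a C l : l1bound a C -> has_sum a l -> `|l| <= C.
Proof.
move=> h hl; apply/ler_normlP; split.
  rewrite -mulN1r; apply: (@has_sum_le (fun g => -1 * a g)); last exact: has_sumZ.
  move=> A; apply: le_trans (h A); apply: ler_sum => g _.
  by rewrite mulN1r -normrN ler_norm.
apply: has_sum_le hl => A; apply: le_trans (h A).
by apply: ler_sum => g _; exact: ler_norm.
Qed.

Lemma ler_sum_fset a A B : (forall g, 0 <= a g) -> (A `<=` B)%fset ->
  \sum_(g <- A) a g <= \sum_(g <- B) a g.
Proof.
move=> a0 AB; rewrite [leRHS](big_fsetID _ (mem A)) /=.
rewrite [X in _ <= X + _](_ : _ = \sum_(g <- A) a g).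
  by rewrite lerDl sumr_ge0.
apply: eq_fbigl => g; rewrite !inE /=.
by case gA: (g \in A); rewrite ?andbT ?andbF// (fsubsetP AB).
Qed.

Lemma sum_fsetU a A B : [disjoint A & B]%fset ->
  \sum_(g <- (A `|` B)%fset) a g = \sum_(g <- A) a g + \sum_(g <- B) a g.
Proof.
move=> dAB; rewrite (big_fsetID _ (mem A)) /=; congr (_ + _).
  by apply: eq_fbigl => g; rewrite !inE /=; case: (g \in A); rewrite ?andbT ?andbF.
apply: eq_fbigl => g; rewrite !inE /=; case gA: (g \in A) => //=.
  by apply/esym/negbTE/(fdisjointP dAB).
by rewrite andbT.
Qed.

Lemma has_sum_ge a l A : (forall g, 0 <= a g) -> has_sum a l ->
  \sum_(g <- A) a g <= l.
Proof.
move=> a0 hl; apply/ler_addgt0Pr => e e0; have [B hB] := hl e e0.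
have /ler_normlP[] := hB (A `|` B)%fset (fsubsetUr _ _).
have : \sum_(g <- A) a g <= \sum_(g <- (A `|` B)%fset) a g.
  exact: ler_sum_fset (fsubsetUl _ _).
set s := \sum_(_ <- _) _; set t := \sum_(_ <- _) _; lra.
Qed.

Lemma l1bound_ge0 a C : l1bound a C -> 0 <= C.
Proof. by move=> /(_ fset0); rewrite big_nil. Qed.

Lemma l1bound_le a g C : l1bound a C -> `|a g| <= C.
Proof. by move=> /(_ [fset g]%fset); rewrite big_seq_fset1. Qed.

(** A finite set that attains the supremum of the partial sums of |a| up to e leaves at most e for
    any set disjoint from it. *)
Lemma l1bound_tail a C (e : R) : l1bound a C -> 0 < e ->
  exists A, forall B, [disjoint A & B]%fset -> \sum_(g <- B) `|a g| <= e.
Proof.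
move=> h e0.
pose S : set R := [set x | exists A, x = \sum_(g <- A) `|a g|].
have hS : has_sup S.
  split; first by exists (\sum_(g <- fset0) `|a g|), fset0.
  by exists C => _ [A ->]; exact: h.
have [_ [A ->] hA] := sup_adherent e0 hS.
exists A => B dAB; have := sup_upper_bound hS.
move=> /(_ (\sum_(g <- (A `|` B)%fset) `|a g|)) /=.
rewrite sum_fsetU//.
have H : S (\sum_(i <- A) `|a i| + \sum_(i <- B) `|a i|).
  by exists (A `|` B)%fset; rewrite sum_fsetU.
move=> /(_ H); move: hA; set s := \sum_(_ <- _) _; set t := \sum_(_ <- _) _; lra.
Qed.

(** The parts (|a| + a)/2 and (|a| - a)/2 are nonnegative; the partial sums of each increase and are
    bounded by C, so they converge to their supremum. *)
Lemma l1_has_sum a C : l1bound a C -> exists l, has_sum a l.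
Proof.
move=> h.
have pos (b : G -> R) : (forall g, 0 <= b g) -> (forall g, b g <= `|a g|) ->
    exists l, has_sum b l.
  move=> b0 ba; pose S : set R := [set x | exists A, x = \sum_(g <- A) b g].
  have hS : has_sup S.
    split; first by exists (\sum_(g <- fset0) b g), fset0.
    exists C => _ [A ->]; apply: le_trans (h A).
    by apply: ler_sum => g _; exact: ba.
  exists (sup S) => e e0; have [_ [A ->] hA] := sup_adherent e0 hS.
  exists A => B AB; have := sup_upper_bound hS.
  move=> /(_ (\sum_(g <- B) b g)) /= H.
  have {}H := H (ex_intro _ B erefl).
  have : \sum_(g <- A) b g <= \sum_(g <- B) b g by exact: ler_sum_fset.
  move: hA H; set s := \sum_(_ <- _) _; set t := \sum_(_ <- _) _ => H1 H2 H3.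
  by apply/ler_normlP; split; lra.
have [l hl] := pos (fun g => (`|a g| + a g) / 2)
  (fun g => ltac:(have := lerNnormlW (lexx `|a g|); lra)) (fun g => ltac:(have := ler_norm (a g); lra)).
have [m hm] := pos (fun g => (`|a g| - a g) / 2)
  (fun g => ltac:(have := ler_norm (a g); lra)) (fun g => ltac:(have := lerNnormlW (lexx `|a g|); lra)).
exists (l + -1 * m); apply: eq_has_sum (has_sumD hl (has_sumZ (-1) hm)) => g.
by rewrite /=; field.
Qed.

Lemma l1boundD a b C D : l1bound a C -> l1bound b D ->
  l1bound (fun g => a g + b g) (C + D).
Proof.
move=> ha hb A; apply: le_trans (lerD (ha A) (hb A)).
by rewrite -big_split /=; apply: ler_sum => g _; exact: ler_normD.
Qed.

Lemma l1boundZ a c C : l1bound a C -> l1bound (fun g => c * a g) (`|c| * C).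
Proof.
move=> ha A; apply: le_trans (ler_wpM2l (normr_ge0 c) (ha A)).
by rewrite big_distrr /=; apply: ler_sum => g _; rewrite normrM.
Qed.

Lemma l1bound_dom a b C : (forall g, `|b g| <= `|a g|) -> l1bound a C ->
  l1bound b C.
Proof. by move=> h ha A; apply: le_trans (ha A); apply: ler_sum => g _. Qed.

Lemma fsets_fset (A : {fset G}) : fsets setT [set` A].
Proof. by split. Qed.

Lemma esum_nonneg a C : (forall g, 0 <= a g) -> l1bound a C ->
  has_sum a (fine (esum setT (fun g => (a g)%:E))) /\
  (esum setT (fun g => (a g)%:E) <= C%:E)%E.
Proof.
move=> a0 h; have [l hl] := l1_has_sum h.
have E : esum setT (fun g => (a g)%:E) = l%:E.
  apply/eqP; rewrite eq_le; apply/andP; split.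
    apply: ge_ereal_sup => _ [X [finX _] <-].
    rewrite fsbig_finite//= sumEFin lee_fin.
    exact: has_sum_ge.
  apply/lee_addgt0Pr => e e0; have [A hA] := hl e e0.
  have /ler_normlP[H _] := hA A (fsubset_refl _).
  apply: (@le_trans _ _ ((\sum_(g <- A) a g)%:E + e%:E)%E).
    by rewrite -EFinD lee_fin; move: H; set s := \sum_(_ <- _) _; lra.
  rewrite leeD2r//; apply: ereal_sup_ubound; exists [set` A]; first exact: fsets_fset.
  rewrite fsbig_finite//= sumEFin; congr EFin; apply: eq_fbigl => g.
  by rewrite in_fset_set// mem_setE.
rewrite E; split => //; rewrite lee_fin; apply: has_sum_le hl => A.
by apply: le_trans (h A); apply: ler_sum => g _; exact: ler_norm.
Qed.

Lemma in_L1P a : in_L1 a <-> exists C, l1bound a C.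
Proof.
split=> [|[C h]].
  rewrite /in_L1 summableE => h; exists (fine (\esum_(x in setT) `|(a x)%:E|%E)) => A.
  rewrite -lee_fin fineK// -sumEFin; apply: ereal_sup_ubound.
  exists [set` A]; first exact: fsets_fset.
  rewrite fsbig_finite//=; apply: eq_fbigl => g.
  by rewrite in_fset_set// mem_setE.
have h' : l1bound (fun g => `|a g|) C.
  by move=> A; under eq_bigr do rewrite normr_id.
have [_ H] := esum_nonneg (fun g => normr_ge0 (a g)) h'.
by apply: le_lt_trans H _; rewrite ltry.
Qed.

Lemma rsum_has_sum a C : l1bound a C -> has_sum a (rsum a).
Proof.
move=> h; rewrite /rsum.
have P g : ((fun g => (a g)%:E)^\+)%E g = (Num.max (a g) 0)%:E.
  by rewrite funeposE EFin_max.
have N g : ((fun g => (a g)%:E)^\-)%E g = (Num.max (- a g) 0)%:E.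
  by rewrite funenegE -EFinN EFin_max.
rewrite (eq_esum (fun g _ => P g)) (eq_esum (fun g _ => N g)).
have b1 : l1bound (fun g => Num.max (a g) 0) C.
  apply: l1bound_dom h => g; rewrite ger0_norm ?le_max ?lexx ?orbT//.
  by rewrite ge_max ler_norm normr_ge0.
have b2 : l1bound (fun g => Num.max (- a g) 0) C.
  apply: l1bound_dom h => g; rewrite ger0_norm ?le_max ?lexx ?orbT//.
  by rewrite ge_max -normrN ler_norm normr_ge0.
have mx0 (r : R) : 0 <= Num.max r 0 by rewrite le_max lexx orbT.
have [h1 _] := esum_nonneg (fun g => mx0 (a g)) b1.
have [h2 _] := esum_nonneg (fun g => mx0 (- a g)) b2.
rewrite -[X in _ - X]mul1r -mulNr.
apply: eq_has_sum (has_sumD h1 (has_sumZ (-1) h2)) => g /=.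
by case: (leP (a g) 0) => H; case: (leP (- a g) 0) => H'; lra.
Qed.

Lemma rsumE a C l : l1bound a C -> has_sum a l -> rsum a = l.
Proof. by move=> h; apply: has_sum_uniq; exact: rsum_has_sum h. Qed.

Lemma l1bound_fin a A : (forall g, g \notin A -> a g = 0) ->
  l1bound a (\sum_(g <- A) `|a g|).
Proof.
move=> h B; rewrite [leRHS](big_fset_incl _ (fsubsetUl A B)) /=.
  by apply: ler_sum_fset => //; exact: fsubsetUr.
by move=> g _ gA; rewrite h// normr0.
Qed.

Lemma has_sum_reindex (p q : G -> G) a l : cancel p q -> cancel q p ->
  has_sum a l -> has_sum (fun g => a (p g)) l.
Proof.
move=> pq qp h e e0; have [A hA] := h e e0.
exists [fset q g | g in A]%fset => B AB.
have := hA [fset p g | g in B]%fset; rewrite big_imfset /=; last first.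
  by move=> x y _ _ /(congr1 q); rewrite !pq.
apply; apply/fsubsetP => g gA; apply/imfsetP; exists (q g); last by rewrite qp.
by apply: (fsubsetP AB); apply/imfsetP; exists g.
Qed.

Lemma l1bound_reindex (p q : G -> G) a C : cancel p q ->
  l1bound a C -> l1bound (fun g => a (p g)) C.
Proof.
move=> pq h B; have := h [fset p g | g in B]%fset; rewrite big_imfset //=.
by move=> x y _ _ /(congr1 q); rewrite !pq.
Qed.

End Sums.

(** * Group ring elements as convolution operators *)

Section LocalOp.
Variables (K : nzRingType) (G : groupType).
Implicit Types (a b : seq (K * G)) (y z : G -> K) (g h : G).

(* A list [(c1, s1); ...; (cn, sn)] stands for the element
   c1 s1 + ... + cn sn of the group ring; [lop a y] is the convolution
   y . a^*, which is total: no summability is involved. *)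
Definition lop a y : G -> K := fun g => \sum_(s <- a) s.1 * y (g * s.2)%g.

Definition adj a := [seq (s.1, s.2^-1%g) | s <- a].
Definition amul a b := [seq (s.1 * t.1, (s.2 * t.2)%g) | s <- a, t <- b].

Definition dl h : G -> K := fun g => (g == h)%:R.

Lemma eq_lop a y z : y =1 z -> lop a y =1 lop a z.
Proof. by move=> /funext ->. Qed.

Lemma adjK a : adj (adj a) = a.
Proof.
by rewrite /adj -map_comp map_id_in// => -[c s] _ /=; rewrite invgK.
Qed.

Lemma lop_shift a y k g : lop a (fun x => y (k * x)%g) g = lop a y (k * g)%g.
Proof. by apply: eq_bigr => s _; rewrite mulgA. Qed.

Lemma lopD a y z g : lop a (fun x => y x + z x) g = lop a y g + lop a z g.
Proof. by rewrite -big_split; apply: eq_bigr => s _; rewrite mulrDr. Qed.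

Lemma lopB a y z g : lop a (fun x => y x - z x) g = lop a y g - lop a z g.
Proof. by rewrite -sumrB; apply: eq_bigr => s _; rewrite mulrBr. Qed.

Lemma lop0 a g : lop a (fun=> 0) g = 0.
Proof. by rewrite /lop big1// => s _; rewrite mulr0. Qed.

Lemma lop_comp a b y g : lop a (lop b y) g = lop (amul a b) y g.
Proof.
rewrite /lop /amul big_allpairs_dep /=; apply: eq_bigr => s _.
by rewrite big_distrr /=; apply: eq_bigr => t _; rewrite mulrA mulgA.
Qed.

(** The matrix of [lop (adj a)] is the transpose of that of [lop a], as g s = h exactly when h s^-1
    = g. *)
Lemma lop_dl_adj a g h : lop a (dl h) g = lop (adj a) (dl g) h.
Proof.
rewrite /lop /adj big_map; apply: eq_bigr => s _ /=; congr (_ * _%:R).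
by rewrite -(inj_eq (mulIg s.2^-1%g)) mulgK eq_sym.
Qed.

Lemma dl_shift k h g : dl h (k * g)%g = dl (k^-1 * h)%g g.
Proof. by rewrite /dl -(inj_eq (mulgI k^-1%g)) mulKg. Qed.

End LocalOp.

Lemma lop_map (K L : nzRingType) (G : groupType) (phi : {rmorphism K -> L})
    (a : seq (K * G)) (y : G -> K) g :
  phi (lop a y g) = lop [seq (phi s.1, s.2) | s <- a] (fun x => phi (y x)) g.
Proof.
rewrite /lop big_map rmorph_sum; apply: eq_bigr => s _ /=.
by rewrite rmorphM.
Qed.

Section CommOp.
Variables (K : comNzRingType) (G : groupType).
Implicit Types (a b : seq (K * G)) (y z : G -> K) (g h : G).

Lemma lopZ a c y g : lop a (fun x => c * y x) g = c * lop a y g.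
Proof. by rewrite /lop big_distrr; apply: eq_bigr => s _; rewrite /= mulrCA. Qed.

Lemma lop_lin (I : Type) (r : seq I) a (c : I -> K) (f : I -> G -> K) g :
  lop a (fun x => \sum_(i <- r) c i * f i x) g = \sum_(i <- r) c i * lop a (f i) g.
Proof.
rewrite /lop; under eq_bigr do rewrite big_distrr /=.
rewrite exchange_big; apply: eq_bigr => i _; rewrite big_distrr /=.
by apply: eq_bigr => s _; rewrite mulrCA.
Qed.

(* The trace property tr(ab) = tr(ba). *)
Lemma lop_tr a b : lop a (lop b (dl K 1%g)) 1%g = lop b (lop a (dl K 1%g)) 1%g.
Proof.
rewrite /lop; under eq_bigr do rewrite big_distrr /=.
rewrite exchange_big; apply: eq_bigr => t _; rewrite big_distrr /=.
apply: eq_bigr => s _; rewrite mulrCA; congr (_ * (_ * _%:R)).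
by rewrite !mul1g -(inj_eq (mulgI s.2^-1%g)) mulKg mulg1 -(inj_eq (mulIg s.2%g)) mulVg.
Qed.

Definition ext (d : nat) (e : 'I_d -> G) (v : 'I_d -> K) : G -> K :=
  fun g => \sum_(j < d) v j * dl K (e j) g.

Lemma extE d (e : 'I_d -> G) v i : injective e -> ext e v (e i) = v i.
Proof.
move=> ie; rewrite /ext (bigD1 i)//= /dl eqxx mulr1 big1 ?addr0// => j ji.
by rewrite (inj_eq ie) eq_sym (negbTE ji) mulr0.
Qed.

Lemma ext_out d (e : 'I_d -> G) v g : g \notin codom e -> ext e v g = 0.
Proof.
move=> ge; rewrite /ext big1// => j _; rewrite /dl; case: eqP => [gE|]; rewrite ?mulr0//.
by rewrite gE codom_f in ge.
Qed.

Lemma ext_res d (e : 'I_d -> G) y : injective e ->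
  (forall g, g \notin codom e -> y g = 0) -> ext e (fun i => y (e i)) =1 y.
Proof.
move=> ie h g; have [/codomP[i ->]|ge] := boolP (g \in codom e).
  by rewrite extE.
by rewrite ext_out// h.
Qed.

(** The finite section of [lop a]: functions supported on the image of [e], extended by zero through
    [ext], are sent to their values on the image of [e']. *)
Definition mat a (m n : nat) (e' : 'I_m -> G) (e : 'I_n -> G) : 'M[K]_(m, n) :=
  \matrix_(i, j) lop a (dl K (e j)) (e' i).

Lemma mat_mul a m n (e' : 'I_m -> G) (e : 'I_n -> G) (v : 'cV[K]_n) i :
  (mat a e' e *m v) i 0 = lop a (ext e (fun j => v j 0)) (e' i).
Proof.
rewrite mxE /ext lop_lin; apply: eq_bigr => j _; rewrite mxE mulrC //.
Qed.

Lemma trmx_mat a m n (e' : 'I_m -> G) (e : 'I_n -> G) :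
  (mat a e' e)^T = mat (adj a) e e'.
Proof. by apply/matrixP => i j; rewrite !mxE lop_dl_adj. Qed.

End CommOp.

(** * Inverses in l^1 and convolution of bounded functions *)

Section RealOp.
Variables (R : realType) (G : groupType).
Implicit Types (a b : seq (R * G)) (y z w : G -> R) (g h : G).

Definition nrm a : R := \sum_(s <- a) `|s.1|.

Lemma nrm_ge0 a : 0 <= nrm a.
Proof. by apply: sumr_ge0. Qed.

Lemma nrm_adj a : nrm (adj a) = nrm a.
Proof. by rewrite /nrm big_map. Qed.

Lemma lop_le a y (M : R) g : (forall x, `|y x| <= M) -> `|lop a y g| <= nrm a * M.
Proof.
move=> h; apply: le_trans (ler_norm_sum _ _ _) _; rewrite /nrm big_distrl /=.
by apply: ler_sum => s _; rewrite normrM ler_wpM2l.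
Qed.

Lemma lop_le_at a y (M : R) g : (forall s, s \in a -> `|y (g * s.2)%g| <= M) ->
  `|lop a y g| <= nrm a * M.
Proof.
move=> h; apply: le_trans (ler_norm_sum _ _ _) _; rewrite /nrm big_distrl /=.
by rewrite !big_seq; apply: ler_sum => s sa; rewrite normrM ler_wpM2l// h.
Qed.

(** [w] is the inverse of f^* in l^1: the first equation is w . f^* = 1, the second is the star of
    f^* . w = 1. Written in this way the notion is symmetric under [adj], see [l1inv_adj]. *)
Definition l1inv a w C :=
  [/\ l1bound w C, lop a w =1 dl R 1%g &
      lop (adj a) (fun g => w g^-1%g) =1 dl R 1%g].

Lemma l1inv_adj a w C : l1inv a w C -> l1inv (adj a) (fun g => w g^-1%g) C.
Proof.
case=> h1 h2 h3; split=> //.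
  by apply: (l1bound_reindex (q := fun g => g^-1%g)) h1 => g; rewrite invgK.
move=> g; rewrite adjK -h2; apply: eq_lop => x; by rewrite invgK.
Qed.

(** The convolution y . w, which makes sense for w in l^1 and y merely bounded. It inverts [lop a]
    on bounded functions, from both sides. *)
Definition Wop w y : G -> R := fun g => rsum (fun h => y h * w (h^-1 * g)%g).

Lemma l1_invl w C g : l1bound w C -> l1bound (fun h => w (h^-1 * g)%g) C.
Proof.
apply: (l1bound_reindex (q := fun h => g * h^-1)%g) => h.
by rewrite invMg invgK mulKVg.
Qed.

Lemma Wop_l1 w C y M g : l1bound w C -> (forall h, `|y h| <= M) ->
  l1bound (fun h => y h * w (h^-1 * g)%g) (M * C).
Proof.
move=> hw hy; have M0 : 0 <= M by apply: le_trans (hy 1%g).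
have := l1boundZ M (l1_invl g hw); rewrite ger0_norm//.
by apply: l1bound_dom => h; rewrite !normrM (ger0_norm M0) ler_wpM2r.
Qed.

Lemma Wop_le w C y M g : l1bound w C -> (forall h, `|y h| <= M) ->
  `|Wop w y g| <= M * C.
Proof.
move=> hw hy; have b := Wop_l1 g hw hy.
exact: has_sum_norm_le b (rsum_has_sum b).
Qed.

Lemma lop_Wop a w C y M : l1inv a w C -> (forall h, `|y h| <= M) ->
  lop a (Wop w y) =1 y.
Proof.
move=> [hw aw _] hy g.
have H : has_sum (fun h => \sum_(s <- a) s.1 * (y h * w (h^-1 * (g * s.2))%g))
    (lop a (Wop w y) g).
  apply: (has_sum_lin a (fun s => s.1) (l := fun s => Wop w y (g * s.2)%g)) => s.
  exact: rsum_has_sum (Wop_l1 _ hw hy).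
apply: has_sum_uniq H _.
have E h : \sum_(s <- a) s.1 * (y h * w (h^-1 * (g * s.2))%g) = y h * dl R h g.
  transitivity (y h * lop a w (h^-1 * g)%g).
    by rewrite big_distrr /=; apply: eq_bigr => s _; rewrite mulrCA mulgA.
  by rewrite aw dl_shift invgK mulg1.
have := @has_sum1 R G (fun h => y h * dl R h g) g; rewrite /dl eqxx mulr1.
move=> H; apply: (eq_has_sum (a := fun h => y h * (g == h)%:R)); last first.
  by apply: H => h hg; rewrite eq_sym (negbTE hg) mulr0.
by move=> h; rewrite E.
Qed.

(** After the substitution k = h s in each of the finitely many sums, the sum over the support of f
    becomes the second equation of [l1inv] at g^-1 k. *)
Lemma Wop_lop a w C y M : l1inv a w C -> (forall h, `|y h| <= M) ->
  Wop w (lop a y) =1 y.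
Proof.
move=> [hw _ aw] hy g.
have H1 : has_sum (fun h => lop a y h * w (h^-1 * g)%g) (Wop w (lop a y) g).
  by apply: rsum_has_sum (Wop_l1 _ hw _) => h; exact: lop_le hy.
have b s : l1bound (fun h => y (h * s)%g * w (h^-1 * g)%g) (M * C).
  by apply: (@Wop_l1 w C (fun h => y (h * s)%g)).
pose L s := rsum (fun h => y (h * s)%g * w (h^-1 * g)%g).
have E1 : Wop w (lop a y) g = \sum_(s <- a) s.1 * L s.2.
  apply: has_sum_uniq H1 _.
  apply: eq_has_sum (has_sum_lin a (fun s => s.1) (l := fun s => L s.2) _); last first.
    by move=> s; exact: rsum_has_sum (b s.2).
  by move=> h; rewrite /= /lop big_distrl /=; apply: eq_bigr => s _; rewrite mulrA.
have H2 : has_sum (fun k => \sum_(s <- a) s.1 * (y k * w (s.2 * k^-1 * g)%g))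
    (\sum_(s <- a) s.1 * L s.2).
  apply: (has_sum_lin a (fun s => s.1) (l := fun s => L s.2)) => s.
  have pq : cancel (fun h => h * s.2^-1)%g (fun h => h * s.2)%g by move=> h; exact: mulgKV.
  have qp : cancel (fun h => h * s.2)%g (fun h => h * s.2^-1)%g by move=> h; exact: mulgK.
  apply: eq_has_sum (has_sum_reindex pq qp (rsum_has_sum (b s.2))) => k /=.
  by rewrite mulgKV invMg invgK.
rewrite E1; apply: has_sum_uniq H2 _.
have E k : \sum_(s <- a) s.1 * (y k * w (s.2 * k^-1 * g)%g) = y k * dl R g k.
  transitivity (y k * lop (adj a) (fun h => w h^-1%g) (g^-1 * k)%g).
    rewrite /lop big_map big_distrr /=; apply: eq_bigr => s _.
    by rewrite mulrCA !invMg !invgK mulgA.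
  by rewrite aw dl_shift invgK mulg1.
have := @has_sum1 R G (fun k => y k * dl R g k) g; rewrite /dl eqxx mulr1.
move=> H; apply: (eq_has_sum (a := fun k => y k * (k == g)%:R)); last first.
  by apply: H => h hg; rewrite (negbTE hg) mulr0.
by move=> h; rewrite E.
Qed.

Lemma lop_inj0 a w C y M : l1inv a w C -> (forall h, `|y h| <= M) ->
  lop a y =1 (fun=> 0) -> y =1 (fun=> 0).
Proof.
move=> ha hy y0 g; rewrite -(Wop_lop ha hy) (_ : lop a y = fun=> 0); last exact/funext.
rewrite /Wop; apply: (rsumE (C := 0)).
  by move=> A; rewrite big1// => h _; rewrite mul0r normr0.
by apply: eq_has_sum (@has_sum0 R G) => h; rewrite mul0r.
Qed.

(** Cauchy-Schwarz with weights, by induction: the cross term obeys 2 S t <= P t^2 + Q because (2 S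
    t)^2 <= 4 t^2 P Q <= (P t^2 + Q)^2. *)
Lemma sum_sqr_le (I : Type) (r : seq I) (p x : I -> R) : (forall i, 0 <= p i) ->
  (\sum_(i <- r) p i * x i) ^+ 2 <= (\sum_(i <- r) p i) * \sum_(i <- r) p i * x i ^+ 2.
Proof.
move=> p0.
have Q0 (s : seq I) : 0 <= \sum_(i <- s) p i * x i ^+ 2.
  by apply: sumr_ge0 => i _; rewrite mulr_ge0 ?sqr_ge0.
have P0 (s : seq I) : 0 <= \sum_(i <- s) p i by apply: sumr_ge0.
elim: r => [|i r IH]; first by rewrite !big_nil mul0r expr0n.
rewrite !big_cons; move: IH (P0 r) (Q0 r) (p0 i).
set S := \sum_(_ <- _) _; set P := \sum_(_ <- _) _; set Q := \sum_(_ <- _) _.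
set q := p i; set t := x i => IH P1 Q1 q0.
have H : 2 * S * t <= P * t ^+ 2 + Q.
  have H0 : 0 <= P * t ^+ 2 + Q by rewrite addr_ge0// mulr_ge0// sqr_ge0.
  apply: le_trans (ler_norm _) _; rewrite -[leRHS]ger0_norm// -ler_sqr ?nnegrE//.
  rewrite !real_normK ?num_real//.
  have -> : (2 * S * t) ^+ 2 = 4 * t ^+ 2 * S ^+ 2 by ring.
  apply: (@le_trans _ _ (4 * t ^+ 2 * (P * Q))).
    by rewrite ler_wpM2l// mulr_ge0 ?sqr_ge0.
  by have := sqr_ge0 (P * t ^+ 2 - Q); nra.
have := mulr_ge0 q0 (ltac:(by rewrite subr_ge0; exact: H) : 0 <= P * t ^+ 2 + Q - 2 * S * t).
move: IH; nra.
Qed.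

Lemma Wop_fin w C y (A : {fset G}) g : l1bound w C ->
  (forall h, h \notin A -> y h = 0) ->
  Wop w y g = \sum_(h <- A) y h * w (h^-1 * g)%g.
Proof.
move=> hw hy; have h0 h : h \notin A -> y h * w (h^-1 * g)%g = 0.
  by move=> /hy ->; rewrite mul0r.
exact: rsumE (l1bound_fin h0) (has_sum_fin h0).
Qed.

Lemma fin_bound y (A : {fset G}) : (forall h, h \notin A -> y h = 0) ->
  forall h, `|y h| <= \sum_(g <- A) `|y g|.
Proof. by move=> h0 h; have := l1bound_fin h0; exact: l1bound_le. Qed.

(* Schur's test: convolution by w is bounded by |w|_1 on l^2. *)
Lemma l2_lower a w C y (A B : {fset G}) : l1inv a w C ->
  (forall h, h \notin A -> y h = 0) -> (forall h, h \notin B -> lop a y h = 0) ->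
  \sum_(g <- A) y g ^+ 2 <= C ^+ 2 * \sum_(h <- B) lop a y h ^+ 2.
Proof.
move=> ha hA hB; have [hw _ _] := ha; have C0 := l1bound_ge0 hw.
set z := lop a y in hB *.
(* With z = y . f^* one has y = z . w. Cauchy-Schwarz with the weights |w| gives one factor C here;
   summing over g gives the other. *)
have step g : y g ^+ 2 <= C * \sum_(h <- B) `|w (h^-1 * g)%g| * z h ^+ 2.
  rewrite -(Wop_lop ha (fin_bound hA)) (Wop_fin _ hw hB).
  rewrite -real_normK ?num_real//.
  apply: (@le_trans _ _ ((\sum_(h <- B) `|w (h^-1 * g)%g| * `|z h|) ^+ 2)).
    rewrite ler_sqr ?nnegrE// ?sumr_ge0//.
    apply: le_trans (ler_norm_sum _ _ _) _.
    by apply: ler_sum => h _; rewrite normrM mulrC.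
  apply: le_trans (sum_sqr_le _ _ _) _ => //.
  under [X in _ * X]eq_bigr do rewrite real_normK ?num_real//.
  rewrite ler_wpM2r//; last exact: l1_invl hw _.
  by apply: sumr_ge0 => h _; rewrite mulr_ge0 ?sqr_ge0.
apply: le_trans (ler_sum _ (fun g _ => step g)) _.
rewrite -big_distrr /= exchange_big /= expr2 -mulrA ler_wpM2l//.
rewrite big_distrr /=; apply: ler_sum => h _.
rewrite -big_distrl /= ler_wpM2r ?sqr_ge0//.
have Hr : l1bound (fun g => w (h^-1 * g)%g) C.
  by apply: (l1bound_reindex (q := fun g => h * g)%g) hw => g; rewrite mulKVg.
exact: Hr.
Qed.

End RealOp.

(** * From injectivity on bounded functions to an inverse in l^1 *)

Section HahnBanach.
Variables (R : realType) (V : lmodType R).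
Implicit Types (p q : V -> R) (x y : V).

Definition sublinear p := (forall x y, p (x + y) <= p x + p y) /\
  forall t x, 0 <= t -> p (t *: x) <= t * p x.

Lemma sublinear0 p : sublinear p -> p 0 = 0.
Proof.
move=> [pD pZ]; apply/eqP; rewrite eq_le; apply/andP; split.
  by have := pZ 0 0 (lexx 0); rewrite scale0r mul0r.
by have := pD 0 0; rewrite addr0; lra.
Qed.

Lemma sublinear_ge p x : sublinear p -> - p (- x) <= p x.
Proof.
move=> sp; have := (sp.1 x (- x)); rewrite subrr (sublinear0 sp); lra.
Qed.

(* The largest sublinear functional below [p] that is additive along [y]. *)
Lemma sublinear_shift p y : sublinear p -> exists q,
  [/\ sublinear q, forall x, q x <= p x & q (- y) <= - p y].
Proof.
move=> sp; have [pD pZ] := sp.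
pose S x : set R := [set z | exists2 t, 0 <= t & z = p (x + t *: y) - t * p y].
have Slb x : lbound (S x) (- p (- x)).
  move=> _ [t t0 ->].
  have := pD (x + t *: y) (- x); rewrite addrAC subrr add0r.
  have := sublinear_ge (t *: y) sp; have := pZ t (- y) t0; rewrite scalerN.
  have := pZ t y t0 => H1 H2 H3 H4.
  have : p (t *: y) = t * p y.
    apply/eqP; rewrite eq_le H1 /=.
    have [->|tn0] := eqVneq t 0; first by rewrite scale0r mul0r (sublinear0 sp).
    have tp : 0 < t by rewrite lt_neqAle eq_sym tn0.
    have := pZ t^-1 (t *: y) (ltac:(by rewrite invr_ge0)).
    by rewrite scalerA mulVf// scale1r mulrC ler_pdivlMr// mulrC.
  lra.
have Sne x : S x (p x) by exists 0; rewrite ?lexx// scale0r addr0 mul0r subr0.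
have hS x : has_inf (S x).
  by split; [exists (p x)|exists (- p (- x)); exact: Slb].
have Sinf x z : S x z -> inf (S x) <= z by apply: ge_inf; case: (hS x).
exists (fun x => inf (S x)); split.
- split=> [x x'|t x t0].
    rewrite -lerBlDr; apply: lb_le_inf => [|_ [t t0 ->]]; first by exists (p x).
    rewrite lerBlDr -lerBlDl; apply: lb_le_inf => [|_ [t' t'0 ->]]; first by exists (p x').
    rewrite lerBlDl; apply: le_trans (Sinf _ _ _) _.
      by exists (t + t'); [exact: addr_ge0|].
    have := pD (x + t *: y) (x' + t' *: y); rewrite addrACA -scalerDl mulrDl; lra.
  have [->|tn0] := eqVneq t 0.
    by rewrite scale0r mul0r; apply: Sinf; exists 0; rewrite // scale0r addr0 mul0r subr0 (sublinear0 sp).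
  have tp : 0 < t by rewrite lt_neqAle eq_sym tn0.
  rewrite mulrC -ler_pdivrMr//; apply: lb_le_inf => [|_ [s s0 ->]]; first by exists (p x).
  rewrite ler_pdivrMr//; apply: le_trans (Sinf _ _ _) _.
    by exists (t * s); [exact: mulr_ge0|].
  have := pZ t (x + s *: y) t0; rewrite scalerDr scalerA; nra.
- by move=> x; apply: Sinf; exact: Sne.
- apply: Sinf; exists 1; first exact: ler01.
  by rewrite scale1r addNr (sublinear0 sp) mul1r sub0r.
Qed.

(** Zorn's lemma for the reversed pointwise order. The pointwise infimum of a chain is finite, being
    at least -p(-x), and it is again sublinear because two members of the chain are comparable. *)
Lemma sublinear_minimal p : sublinear p -> exists q,
  [/\ sublinear q, forall x, q x <= p x &
      forall r, sublinear r -> (forall x, r x <= q x) -> r =1 q].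
Proof.
move=> sp; pose T := {q : V -> R | sublinear q /\ forall x, q x <= p x}.
pose le (q r : T) := `[< forall x, sval r x <= sval q x >].
have p0 : T by exists p.
pose mk r (h : sublinear r /\ forall x, r x <= p x) : T :=
  exist (fun q => sublinear q /\ forall x, q x <= p x) r h.
have [||||q hq] := @Zorn T le.
- by move=> q; apply/asboolP.
- by move=> r s t /asboolP h /asboolP h'; apply/asboolP => x; apply: le_trans (h' x) (h x).
- move=> [s hs] [t ht] /asboolP h /asboolP h'; apply: eq_exist => /=.
  by apply/funext => x; apply/eqP; rewrite eq_le h h'.
- move=> A tA.
  have [[q0 Aq0]|nA] := pselect (exists q : T, A q); last first.
    by exists p0 => s As; case: nA; exists s.
  pose S x : set R := [set z | exists2 q : T, A q & z = sval q x].
  have Slb x : lbound (S x) (- p (- x)).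
    move=> _ [q Aq ->]; case: (svalP q) => sq qp.
    apply: le_trans (sublinear_ge x sq); by rewrite lerN2.
  have Sne x : S x !=set0 by exists (sval q0 x), q0.
  have hS x : has_inf (S x) by split=> //; exists (- p (- x)); exact: Slb.
  have Sinf x z : S x z -> inf (S x) <= z by apply: ge_inf; case: (hS x).
  have sr : sublinear (fun x => inf (S x)).
    split=> [x x'|t x t0].
      rewrite -lerBlDr; apply: lb_le_inf => // _ [q Aq ->].
      rewrite lerBlDr -lerBlDl; apply: lb_le_inf => // _ [q' Aq' ->].
      rewrite lerBlDl; have [/asboolP h|/asboolP h] := tA _ _ Aq Aq'.
        apply: (@le_trans _ _ (sval q' (x + x'))); first by apply: Sinf; exists q'.
        case: (svalP q') => -[H _] _; apply: le_trans (H _ _) _.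
        by rewrite lerD2r.
      apply: (@le_trans _ _ (sval q (x + x'))); first by apply: Sinf; exists q.
      case: (svalP q) => -[H _] _; apply: le_trans (H _ _) _.
      by rewrite lerD2l.
    have [tE|tn0] := eqVneq t 0.
      rewrite tE scale0r mul0r; apply: (@le_trans _ _ (sval q0 0)); first by apply: Sinf; exists q0.
      by rewrite sublinear0//; case: (svalP q0).
    have tp : 0 < t by rewrite lt_neqAle eq_sym tn0.
    rewrite mulrC -ler_pdivrMr//; apply: lb_le_inf => // _ [q Aq ->].
    rewrite ler_pdivrMr//; apply: (@le_trans _ _ (sval q (t *: x))); first by apply: Sinf; exists q.
    by case: (svalP q) => -[_ H] _; rewrite mulrC H.
  have rp x : inf (S x) <= p x.
    apply: (@le_trans _ _ (sval q0 x)); first by apply: Sinf; exists q0.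
    by case: (svalP q0).
  exists (mk _ (conj sr rp)) => q Aq; apply/asboolP => x /=.
  by apply: Sinf; exists q.
case: (svalP q) => sq qp; exists (sval q); split => // r sr rq.
have rp x : r x <= p x by apply: le_trans (rq x) (qp x).
have := hq (mk r (conj sr rp)); rewrite /le => H.
by have /(congr1 sval)/= <- : mk r (conj sr rp) = q by apply: H; apply/asboolP.
Qed.

(** A minimal sublinear q is linear: its shift along y is a sublinear minorant, hence equal to q,
    and this gives q(-y) <= -q(y). Shifting p along x0 beforehand forces q x0 = p x0. *)
Theorem hahn_banach p (x0 : V) : sublinear p -> exists q,
  [/\ forall x y, q (x + y) = q x + q y, forall t x, q (t *: x) = t * q x,
      forall x, q x <= p x & q x0 = p x0].
Proof.
move=> sp; have [p' [sp' p'p p'x0]] := sublinear_shift x0 sp.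
have [q [sq qp' qmin]] := sublinear_minimal sp'.
have qN y : q (- y) = - q y.
  have [r [sr rq ry]] := sublinear_shift y sq.
  have E := qmin _ sr rq; rewrite E in ry.
  by have := sublinear_ge y sq; lra.
have qD x y : q (x + y) = q x + q y.
  apply/eqP; rewrite eq_le (sq.1 x y) /=.
  by have := sq.1 (- x) (- y); rewrite -opprD !qN; lra.
have qZ0 t x : 0 <= t -> q (t *: x) = t * q x.
  move=> t0; apply/eqP; rewrite eq_le (sq.2 t x t0) /=.
  by have := sq.2 t (- x) t0; rewrite scalerN !qN; lra.
exists q; split=> //.
- move=> t x; have [t0|t0] := leP 0 t; first exact: qZ0.
  have := qZ0 (- t) x; rewrite scaleNr qN mulNr => H; apply: oppr_inj; apply: H.
  by rewrite oppr_ge0 ltW.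
- by move=> x; apply: le_trans (qp' x) (p'p x).
- apply/eqP; rewrite eq_le; apply/andP; split.
    exact: le_trans (qp' x0) (p'p x0).
  have := qp' (- x0); rewrite qN; lra.
Qed.

End HahnBanach.

Section FinSupp.
Variables (R : realType) (G : choiceType).

Definition finitely_supported : {pred (G -> R^o)} :=
  fun v => `[< exists A : {fset G}, forall g, g \notin A -> v g = 0 >].

Lemma finitely_supportedP (v : G -> R) :
  reflect (exists A : {fset G}, forall g, g \notin A -> v g = 0)
    ((v : G -> R^o) \in finitely_supported).
Proof. by rewrite -topredE /=; apply: asboolP. Qed.

Lemma finitely_supported_submod : submod_closed finitely_supported.
Proof.
split=> [|a u v /finitely_supportedP[A hA] /finitely_supportedP[B hB]].
  by apply/finitely_supportedP; exists fset0.
apply/finitely_supportedP; exists (A `|` B)%fset => g.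
rewrite inE negb_or => /andP[gA gB].
transitivity (a * (u g : R) + (v g : R)) => //.
by rewrite hA// hB// mulr0 addr0.
Qed.

HB.instance Definition _ :=
  GRing.isSubmodClosed.Build R (G -> R^o) finitely_supported
    finitely_supported_submod.

Record fsupp := FSupp {
  fsupp_val :> G -> R^o;
  fsupp_valP : fsupp_val \in finitely_supported }.

HB.instance Definition _ := [isSub for fsupp_val].
HB.instance Definition _ := [Choice of fsupp by <:].
HB.instance Definition _ := [SubChoice_isSubLmodule of fsupp by <:].

Lemma fsupp_dl_subproof (x : G) :
  ((fun g => (g == x)%:R : R) : G -> R^o) \in finitely_supported.
Proof.
apply/finitely_supportedP; exists [fset x]%fset => g; rewrite inE.
by move=> /negbTE ->.
Qed.

Definition fsupp_dl (x : G) : fsupp := FSupp (fsupp_dl_subproof x).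

End FinSupp.

(** * A left inverse in l^1 *)

Section LeftInverse.
Variables (R : realType) (G : groupType) (a : seq (R * G)).

Definition inj_linfty := forall (y : G -> R) (M : R),
  (forall g, `|y g| <= M) -> lop a y =1 (fun=> 0) -> y =1 (fun=> 0).

(* Hahn-Banach: a functional on the finitely supported functions that
   vanishes on the ideal generated by the adjoint and does not vanish on the
   Dirac mass is a bounded function in the kernel of [lop a]. *)
Lemma approx_inverse : inj_linfty -> exists (m : G -> R) (M q : R),
  [/\ l1bound m M, q < 1 & l1bound (fun g => dl R 1%g g - lop (adj a) m g) q].
Proof.
move=> inj; apply: contrapT => no.
pose V := fsupp R G.
(* The infimum of [S x] is the quotient seminorm of x, that is, its l^1 distance to the ideal of all
   [lop (adj a) m] with m finitely supported. *)
pose S (x : V) : set R := [set C | exists m : V,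
  l1bound (fun g => x g - lop (adj a) m g) C].
have Vl1 (m : V) : exists M, l1bound m M.
  have /finitely_supportedP[A hA] := fsupp_valP m.
  by exists (\sum_(g <- A) `|m g|); exact: l1bound_fin.
have S0 (x : V) C : l1bound x C -> S x C.
  move=> h; exists 0; apply: l1bound_dom h => g.
  by rewrite [X in _ - X]lop0 subr0.
have Slb x : lbound (S x) 0 by move=> C [m /l1bound_ge0].
have Sne x : S x !=set0 by have [M h] := Vl1 x; exists M; exact: S0.
have hS x : has_inf (S x) by split=> //; exists 0; exact: Slb.
have Sinf x z : S x z -> inf (S x) <= z by apply: ge_inf; case: (hS x).
have sub : sublinear (fun x => inf (S x)).
  split=> [x x'|t x t0].
    rewrite -lerBlDr; apply: lb_le_inf => // C [m hm].
    rewrite lerBlDr -lerBlDl; apply: lb_le_inf => // D [n hn].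
    rewrite lerBlDl; apply: Sinf; exists (m + n).
    apply: l1bound_dom (l1boundD hm hn) => g.
    by rewrite [X in _ - X]lopD opprD addrACA.
  have [->|tn0] := eqVneq t 0.
    rewrite scale0r mul0r; apply: Sinf; apply: S0 => A.
    by rewrite big1// => g _; rewrite normr0.
  have tp : 0 < t by rewrite lt_neqAle eq_sym tn0.
  rewrite mulrC -ler_pdivrMr//; apply: lb_le_inf => // C [m hm].
  rewrite ler_pdivrMr// mulrC; apply: Sinf; exists (t *: m).
  have H := l1boundZ t hm; rewrite (ger0_norm t0) in H.
  apply: l1bound_dom H => g.
  by rewrite [X in _ - X]lopZ mulrBr.
have [phi [phiD phiZ phip phi1]] := hahn_banach (fsupp_dl R (1%g : G)) sub.
pose y g := phi (fsupp_dl R g).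
have phiN x : phi (- x) = - phi x by rewrite -scaleN1r phiZ mulN1r.
have phi0 : phi 0 = 0 by have := phiD 0 0; rewrite addr0; lra.
have dl1 g : l1bound (fsupp_dl R (g : G)) 1.
  move=> A; have /l1bound_fin H : forall x, x \notin [fset g]%fset -> dl R g x = 0.
    by move=> x; rewrite inE /dl => /negbTE ->.
  by have := H A; rewrite big_seq_fset1 /dl eqxx normr1.
have dlN1 g : l1bound (- fsupp_dl R (g : G)) 1.
  by apply: l1bound_dom (dl1 g) => x; rewrite [X in `|X|]/(- (_ : R)) normrN.
have yb g : `|y g| <= 1.
  apply/ler_normlP; split; rewrite ?/y -?phiN; apply: le_trans (phip _) _;
    by apply: Sinf; apply: S0.
have phi_sum (I : Type) (r : seq I) (c : I -> R) (f : I -> V) :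
    \sum_(i <- r) c i * phi (f i) = phi (\sum_(i <- r) c i *: f i).
  elim: r => [|i r IH]; first by rewrite !big_nil phi0.
  by rewrite !big_cons phiD phiZ IH.
(* [lop a y g] is the value of phi at the element z = [lop (adj a) (dl R g)] of the ideal. All
   multiples of z have seminorm at most 0, and the two signs force phi z = 0. *)
have y0 : lop a y =1 (fun=> 0).
  move=> g; rewrite /lop /y phi_sum; set z := \sum_(_ <- _) _.
  have zE x : z x = lop (adj a) (dl R g) x.
    rewrite -lop_dl_adj /z; elim: (a) => [|s r IH]; first by rewrite /lop !big_nil.
    rewrite /lop !big_cons -[in RHS]/(lop r _ _) -IH.
    by rewrite [LHS]/(s.1 * (x == (g * s.2)%g)%:R + _) /dl eq_sym.
  have H (c : R) : S (c *: z) 0.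
    exists (c *: fsupp_dl R g) => A; rewrite big1// => x _.
    have := lopZ (adj a) c (dl R g) x; rewrite -zE => E.
    by rewrite -[X in _ - X]/(lop (adj a) (fun x => c * dl R g x) x) E subrr normr0.
  have := phip z; have := phip (- z); rewrite phiN.
  have := Sinf _ _ (H 1); have := Sinf _ _ (H (-1)); rewrite scale1r scaleN1r; lra.
have := inj y 1 yb y0 1%g; rewrite /y phi1 => Sd0.
apply: no; have := inf_adherent (ltr01) (hS (fsupp_dl R 1%g)).
rewrite Sd0 add0r => -[q [m hm] q1].
by have [M hM] := Vl1 m; exists m, M, q.
Qed.

(** The inequality |x . w|_1 <= |x|_1 |w|_1. Multiplication by the signs of the values makes the sum
    of absolute values linear, so that the finite outer sum can be moved inside. *)
Lemma Wop_l1bound (w x : G -> R) C X : l1bound w C -> l1bound x X ->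
  l1bound (Wop w x) (X * C).
Proof.
move=> hw hx A.
have xb h : `|x h| <= X by exact: l1bound_le.
pose c g := Num.sg (Wop w x g).
have -> : \sum_(g <- A) `|Wop w x g| = \sum_(g <- A) c g * Wop w x g.
  by apply: eq_bigr => g _; rewrite -normrEsg.
have H := @has_sum_lin R G G A c (fun g h => x h * w (h^-1 * g)%g) (Wop w x)
   (fun g => rsum_has_sum (Wop_l1 g hw xb)).
apply: le_trans (ler_norm _) _; apply: has_sum_norm_le H => B.
apply: (@le_trans _ _ (\sum_(h <- B) `|x h| * C)); last first.
  by rewrite -big_distrl /= ler_wpM2r// (l1bound_ge0 hw).
apply: ler_sum => h _; apply: le_trans (ler_norm_sum _ _ _) _.
apply: (@le_trans _ _ (\sum_(g <- A) `|x h| * `|w (h^-1 * g)%g|)).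
  apply: ler_sum => g _; rewrite !normrM ler_piMl ?mulr_ge0//.
  by rewrite /c normr_sg; case: (_ == _); rewrite ?ler01 ?lexx.
rewrite -big_distrr ler_wpM2l//=.
have Hr : l1bound (fun g => w (h^-1 * g)%g) C.
  by apply: (l1bound_reindex (q := fun g => h * g)%g) hw => g; rewrite mulKVg.
exact: Hr.
Qed.

Lemma lop_Wop_gen (b : seq (R * G)) (w x : G -> R) C X g : l1bound w C ->
  l1bound x X -> lop b (Wop w x) g = Wop (lop b w) x g.
Proof.
move=> hw hx; have xb h : `|x h| <= X by exact: l1bound_le.
have H : has_sum (fun h => \sum_(s <- b) s.1 * (x h * w (h^-1 * (g * s.2))%g))
    (lop b (Wop w x) g).
  apply: (has_sum_lin b (fun s => s.1) (l := fun s => Wop w x (g * s.2)%g)) => s.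
  exact: rsum_has_sum (Wop_l1 _ hw xb).
have E h : \sum_(s <- b) s.1 * (x h * w (h^-1 * (g * s.2))%g) = x h * lop b w (h^-1 * g)%g.
  by rewrite big_distrr /=; apply: eq_bigr => s _; rewrite mulrCA mulgA.
have bb : l1bound (lop b w) (nrm b * C).
  move=> A; apply: (@le_trans _ _ (\sum_(g <- A) \sum_(s <- b) `|s.1| * `|w (g * s.2)%g|)).
    by apply: ler_sum => k _; apply: le_trans (ler_norm_sum _ _ _) _;
      apply: ler_sum => s _; rewrite normrM.
  rewrite exchange_big /= /nrm big_distrl /=; apply: ler_sum => s _.
  rewrite -big_distrr /= ler_wpM2l//.
  have Hr : l1bound (fun g => w (g * s.2)%g) C.
    by apply: (l1bound_reindex (q := fun g => g * s.2^-1)%g) hw => k; rewrite mulgK.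
  exact: Hr.
apply/esym; apply: rsumE (Wop_l1 _ bb xb) _.
by apply: eq_has_sum H.
Qed.

Lemma geo_sum_le (q : R) (n : nat) : 0 <= q < 1 ->
  \sum_(k < n) q ^+ k <= (1 - q)^-1.
Proof.
move=> /andP[q0 q1]; have q10 : 0 < 1 - q by rewrite subr_gt0.
rewrite -[leRHS]mul1r ler_pdivlMr// mulrC.
have -> : (1 - q) * \sum_(k < n) q ^+ k = 1 - q ^+ n.
  by rewrite -opprB mulNr -subrX1 opprB.
by rewrite lerBlDr lerDl exprn_ge0.
Qed.

Lemma geo_lt (q e : R) : 0 <= q < 1 -> 0 < e -> exists n, q ^+ n < e.
Proof.
move=> /andP[q0 q1] e0.
have : (fun n => q ^+ n) @ \oo --> 0 by apply: cvg_expr; rewrite ger0_norm.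
move=> /cvgrPdist_lt /(_ e e0)[n _ /(_ n (leqnn n))].
by rewrite sub0r normrN ger0_norm ?exprn_ge0//; exists n.
Qed.

Lemma l1_geo (c : nat -> R) (M q : R) : 0 <= q < 1 -> 0 <= M ->
  (forall k, `|c k| <= M * q ^+ k) -> l1bound c (M * (1 - q)^-1).
Proof.
move=> q01 M0 h A; have /andP[q0 q1] := q01.
have [n hn] : exists n, forall k, k \in A -> (k < n)%N.
  exists (\max_(k <- A) k).+1 => k kA; rewrite ltnS; exact: leq_bigmax_seq.
have AB : (A `<=` [fset k in iota 0 n])%fset.
  by apply/fsubsetP => k /hn kn; rewrite inE /= mem_iota.
apply: le_trans (ler_sum_fset _ AB) _ => //.
apply: (@le_trans _ _ (\sum_(k < n) M * q ^+ k)); last first.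
  by rewrite -big_distrr /= ler_wpM2l// geo_sum_le.
rewrite -(big_mkord xpredT (fun k => M * q ^+ k)) /index_iota subn0.
rewrite (perm_big (iota 0 n)) /=; first by apply: ler_sum => k _.
by apply: uniq_perm; rewrite ?iota_uniq ?fset_uniq// => k; rewrite inE.
Qed.

Lemma has_sum_telescope (c : nat -> R) (M q : R) : 0 <= q < 1 -> 0 <= M ->
  (forall k, `|c k| <= M * q ^+ k) -> has_sum (fun k => c k - c k.+1) (c 0%N).
Proof.
move=> q01 M0 h; have /andP[q0 q1] := q01.
have hd k : `|c k - c k.+1| <= 2 * M * q ^+ k.
  apply: le_trans (ler_normB _ _) _; have := h k; have := h k.+1; rewrite exprS.
  have := mulr_ge0 M0 (exprn_ge0 k q0); have : M * (q * q ^+ k) <= M * q ^+ k.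
    by rewrite ler_wpM2l// ler_piMl ?exprn_ge0// ltW.
  lra.
have [l hl] := l1_has_sum (l1_geo q01 (mulr_ge0 (ler0n _ 2) M0) hd).
suff -> : c 0%N = l by [].
apply/eqP; rewrite -subr_eq0 -normr_eq0 eq_le normr_ge0 andbT.
apply/ler_addgt0Pl => e e0; rewrite addr0.
have e2 : 0 < e / 2 by rewrite divr_gt0.
have [A hA] := hl _ e2.
have [m hm] : exists n, forall k, k \in A -> (k < n)%N.
  exists (\max_(k <- A) k).+1 => k kA; rewrite ltnS; exact: leq_bigmax_seq.
have [n hn] : exists n, M * q ^+ n <= e / 2.
  have [n hn] := geo_lt q01 (divr_gt0 e2 (ltr_wpDl M0 ltr01)).
  exists n; move: hn; rewrite ltr_pdivlMr ?ltr_wpDl// => hn.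
  by have := exprn_ge0 n q0; nra.
have := hA [fset k in iota 0 (m + n)]%fset.
rewrite (perm_big (iota 0 (m + n))) /=; last first.
  by apply: uniq_perm; rewrite ?iota_uniq ?fset_uniq// => k; rewrite inE.
rewrite -[X in iota 0 X]subn0 -/(index_iota _ _).
under eq_bigr do rewrite -opprB.
rewrite sumrN telescope_sumr// opprB => /(_ _) H.
have {}H : `|c 0%N - c (m + n)%N - l| <= e / 2.
  apply: H; apply/fsubsetP => k /hm km; rewrite inE /= mem_iota /= add0n.
  by rewrite subn0 (leq_trans km)// leq_addr.
have H2 : `|c (m + n)%N| <= e / 2.
  apply: le_trans (h _) _; apply: le_trans hn; rewrite ler_wpM2l// exprD.
  by rewrite ler_piMl ?exprn_ge0// exprn_ile1// ltW.
rewrite (splitr e) (_ : c 0%N - l = (c 0%N - c (m + n)%N - l) + c (m + n)%N); last by ring.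
by apply: le_trans (ler_normD _ _) _; exact: lerD.
Qed.

(** With r = 1 - m f of l^1 norm at most q < 1, the series u = \sum_k r^k m satisfies u f = \sum_k
    (r^k - r^(k+1)), which telescopes to 1. *)
Lemma left_inverse : inj_linfty ->
  exists (u : G -> R) (C : R), l1bound u C /\ lop (adj a) u =1 dl R 1%g.
Proof.
move=> /approx_inverse[m [M [q [hm q1 hr]]]].
set r := (fun g => _) in hr.
have q01 : 0 <= q < 1 by rewrite (l1bound_ge0 hr).
have M0 := l1bound_ge0 hm.
pose rk k := iter k (Wop r) (dl R 1%g : G -> R).
have dl1 : l1bound (dl R 1%g : G -> R) 1.
  move=> A; have /l1bound_fin H : forall x : G, x \notin [fset 1%g]%fset -> dl R 1%g x = 0.
    by move=> x; rewrite inE /dl => /negbTE ->.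
  by have := H A; rewrite big_seq_fset1 /dl eqxx normr1.
have hrk k : l1bound (rk k) (q ^+ k).
  elim: k => [|k IH]; first by rewrite expr0.
  by rewrite exprSr; exact: Wop_l1bound.
pose c k := Wop m (rk k).
have hc k : l1bound (c k) (M * q ^+ k) by rewrite mulrC; exact: Wop_l1bound.
have Lc k g : lop (adj a) (c k) g = rk k g - rk k.+1 g.
  rewrite (lop_Wop_gen _ _ hm (hrk k)).
  have rb h : `|rk k h| <= q ^+ k by exact: l1bound_le.
  have H1 := rsum_has_sum (Wop_l1 g hr rb).
  have H2 : has_sum (fun h => rk k h * dl R 1%g (h^-1 * g)%g) (rk k g).
    have := @has_sum1 R G (fun h => rk k h * dl R 1%g (h^-1 * g)%g) g.
    rewrite /dl mulVg eqxx mulr1; apply => h hg.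
    rewrite -(inj_eq (mulgI h)) mulVKg mulg1 eq_sym (negbTE hg) mulr0//.
  have H := has_sumD H2 (has_sumZ (-1) H1).
  have -> : rk k g - rk k.+1 g = rk k g + -1 * Wop r (rk k) g by rewrite mulN1r.
  have H' : has_sum (fun h => rk k h * lop (adj a) m (h^-1 * g)%g) (rk k g + -1 * Wop r (rk k) g).
    by apply: eq_has_sum H => h; rewrite /r; ring.
  apply: has_sum_uniq H'; apply: rsum_has_sum.
  apply: (@Wop_l1 _ _ _ (nrm (adj a) * M)) rb => A.
  apply: (@le_trans _ _ (\sum_(g <- A) \sum_(s <- adj a) `|s.1| * `|m (g * s.2)%g|)).
    by apply: ler_sum => h _; apply: le_trans (ler_norm_sum _ _ _) _;
      apply: ler_sum => s _; rewrite normrM.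
  rewrite exchange_big /= /nrm big_distrl /=; apply: ler_sum => s _.
  rewrite -big_distrr /= ler_wpM2l//.
  have Hr : l1bound (fun g => m (g * s.2)%g) M.
    by apply: (l1bound_reindex (q := fun g => g * s.2^-1)%g) hm => h; rewrite mulgK.
  exact: Hr.
have cb g k : `|c k g| <= M * q ^+ k by exact: l1bound_le (hc k).
have cl1 g := l1_geo q01 M0 (cb g).
pose u g := rsum (fun k => c k g).
have hu g : has_sum (fun k => c k g) (u g) by exact: rsum_has_sum (cl1 g).
exists u, (M * (1 - q)^-1); split.
  move=> A.
  have -> : \sum_(g <- A) `|u g| = \sum_(g <- A) Num.sg (u g) * u g.
    by apply: eq_bigr => g _; rewrite -normrEsg.
  have H := has_sum_lin A (fun g => Num.sg (u g)) (l := u) hu.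
  apply: le_trans (ler_norm _) _; apply: has_sum_norm_le H.
  apply: l1_geo => // k; apply: le_trans (ler_norm_sum _ _ _) _.
  apply: le_trans (hc k A); apply: ler_sum => g _; rewrite normrM ler_piMl//.
  by rewrite normr_sg; case: (_ == _); rewrite ?ler01 ?lexx.
move=> g.
have H := has_sum_lin (adj a) (fun s => s.1) (l := fun s => u (g * s.2)%g) (fun s => hu (g * s.2)%g).
apply: has_sum_uniq H _.
apply: (eq_has_sum (a := fun k => rk k g - rk k.+1 g)) => [k|].
  by rewrite -Lc.
apply: (@has_sum_telescope (fun k => rk k g) 1 q) => // k.
by rewrite mul1r; exact: l1bound_le (hrk k).
Qed.

End LeftInverse.

(** * Two-sidedness through finite quotients *)

Section TwoSided.
Variables (R : realType) (G : groupType) (a : seq (R * G)).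
Hypothesis rf : residually_finite G.

(* The group algebra of a finite group is finite-dimensional, hence directly finite. *)
Lemma finite_quotient_inverse (H : finGroupType) (b : seq (R * H)) (u : H -> R) :
  (forall x, \sum_(s <- b) s.1 * u (x * s.2^-1)%g = (x == 1%g)%:R) ->
  forall x, \sum_(s <- b) s.1 * u (s.2^-1 * x)%g = (x == 1%g)%:R.
Proof.
move=> hu x.
pose ev (i : 'I_#|H|) := enum_val i.
(* [U] and [A] are the matrices of u and b in the regular representation. The hypothesis is U A = 1,
   and the conclusion is the row of the identity in A U = 1. *)
pose U : 'M[R]_#|H| := \matrix_(i, j) u ((ev i)^-1 * ev j)%g.
pose A : 'M[R]_#|H| := \matrix_(i, j) \sum_(s <- b) s.1 * (ev i * s.2 == ev j)%g%:R.
have sum_ev (F : H -> R) z : \sum_(j < #|H|) F (ev j) * (ev j == z)%:R = F z.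
  rewrite (bigD1 (enum_rank z)) //= /ev enum_rankK eqxx mulr1 big1 ?addr0// => j jz.
  by rewrite -(inj_eq enum_rank_inj) enum_valK (negbTE jz) mulr0.
have UA : U *m A = 1%:M.
  apply/matrixP => i k; rewrite !mxE.
  transitivity (\sum_(s <- b) s.1 * u ((ev i)^-1 * ev k * s.2^-1)%g).
    under eq_bigr do rewrite !mxE big_distrr /=.
    rewrite exchange_big; apply: eq_bigr => s _.
    have := sum_ev (fun z => s.1 * u ((ev i)^-1 * z)%g) (ev k * s.2^-1)%g.
    rewrite /= [X in _ = _ * u X]mulgA => <-; apply: eq_bigr => j _.
    rewrite mulrCA mulrA; congr (_ * _%:R).
    by rewrite -(inj_eq (mulIg s.2) (ev j)) mulgKV.
  rewrite hu -(inj_eq (mulgI (ev i))) mulgA mulgV mul1g mulg1.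
  by rewrite (inj_eq enum_val_inj) eq_sym.
have /matrixP := mulmx1C UA.
move=> /(_ (enum_rank 1%g) (enum_rank x)); rewrite !mxE.
rewrite (inj_eq enum_rank_inj) eq_sym => <-; apply/esym.
under eq_bigr do rewrite !mxE big_distrl /=.
rewrite exchange_big; apply: eq_bigr => s _.
have := sum_ev (fun z => s.1 * u (z^-1 * x)%g) s.2 => <-.
apply: eq_bigr => j _; rewrite /ev !enum_rankK mul1g mulrAC eq_sym //.
Qed.

(** Induction on A: homomorphisms that separate g from single elements are combined into one with
    values in a product group. *)
Lemma separating_quotient (g : G) (A : seq G) : g \notin A ->
  exists (H : finGroupType) (phi : G -> H),
    {morph phi : x y / (x * y)%g} /\ forall x, x \in A -> phi x <> phi g.
Proof.
elim: A => [|x A IH].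
  (* With nothing to separate any finite quotient will do; if G is trivial, a one-element group is
     supplied by hand. *)
  move=> _; have [[x hx]|no] := pselect (exists x : G, x <> 1%g).
    by have [H [phi [h _]]] := rf hx; exists H, phi.
  exists {perm 'I_1}, (fun _ => 1%g); split=> // x y; by rewrite mulg1.
rewrite inE negb_or => /andP[gx /IH[H [phi [hphi sphi]]]].
have [|H' [psi [hpsi spsi]]] := rf (g := (x^-1 * g)%g).
  by move=> /(congr1 (fun z => x * z)%g); rewrite mulVKg mulg1 => E; rewrite E eqxx in gx.
exists (H * H')%type, (fun z => (phi z, psi z)); split=> [y z|y].
  by rewrite hphi hpsi.
rewrite inE => /orP[/eqP ->|/sphi h] [E1 E2]; last exact: h.
apply: spsi; rewrite hpsi -E2 -hpsi mulVg.
by apply: (mulgI (psi 1%g)); rewrite -hpsi !mulg1.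
Qed.

(** If k g is nonzero, take a finite A outside of which k has mass at most |k g|/4, and a finite
    quotient that separates g from the rest of A. There the push-forward of k at the image of g is k
    g up to |k g|/4, so it cannot vanish. *)
Lemma residually_finite_eq0 (k : G -> R) C : l1bound k C ->
  (forall (H : finGroupType) (phi : G -> H), {morph phi : x y / (x * y)%g} ->
     forall x, has_sum (fun g => k g * (phi g == x)%:R) 0) ->
  forall g, k g = 0.
Proof.
move=> hk h g; apply/eqP; apply: contrapT => /negP kg.
have k0 : 0 < `|k g| / 4 by rewrite divr_gt0// normr_gt0.
have [A hA] := l1bound_tail hk k0.
have [|H [phi [hphi sphi]]] := @separating_quotient g (A `\ g)%fset.
  by rewrite !inE eqxx.
have [B hB] := h _ _ hphi (phi g) _ k0.
have := hB (B `|` (g |` A))%fset (fsubsetUl _ _); rewrite subr0.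
rewrite (big_fsetD1 g) /=; last by rewrite !inE eqxx orbT.
rewrite eqxx mulr1; set S := \sum_(_ <- _) _.
have : `|S| <= `|k g| / 4.
  apply: le_trans (hA (B `\` (g |` A))%fset _); last first.
    apply/fdisjointP => x xA; rewrite !inE xA orbT //.
  rewrite /S (big_fsetID _ (mem (g |` A)%fset)) /= big1_seq ?add0r; last first.
    move=> x; rewrite !inE => /andP[_] /andP[/andP[xg _] xA].
    rewrite (negbTE xg)/= in xA.
    have /sphi/eqP/negbTE -> : x \in (A `\ g)%fset by rewrite !inE xg.
    by rewrite mulr0.
  apply: le_trans (ler_norm_sum _ _ _) _.
  apply: (@le_trans _ _ (\sum_(i <- [fset x in ((B `|` (g |` A)) `\ g) | x \notin (g |` A)]%fset) `|k i|)).
    by apply: ler_sum => i _; rewrite normrM ler_piMr// normr_nat; case: (_ == _); rewrite ?ler01 ?lexx.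
  apply: ler_sum_fset => //; apply/fsubsetP => x; rewrite !inE.
  by case: (x == g) => //=; case: (x \in A) => //=; rewrite ?orbF ?andbT// andbF.
move=> H1 H2; have : `|k g| <= `|k g + S| + `|S|.
  by rewrite -{1}(addrK S (k g)); exact: ler_normB.
have : 0 < `|k g| by rewrite normr_gt0.
lra.
Qed.

(** The relation u f = 1 is pushed forward to every finite quotient, where it implies f u = 1. Hence
    the defect k = f u - 1, which is in l^1, has zero image in all of them. *)
Theorem l1_inverse : inj_linfty a -> exists w C, l1inv a w C.
Proof.
move=> /left_inverse[u [C [hu Lu]]].
pose w := fun g => u (g^-1)%g; exists w, C.
have hw : l1bound w C.
  by apply: (l1bound_reindex (q := fun g => g^-1%g)) hu => g; rewrite invgK.
split=> //; last by move=> g; rewrite -Lu; apply: eq_lop => x; rewrite /w invgK.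
pose k g := lop a w g^-1%g - dl R 1%g g^-1%g.
suff k0 g : k g = 0 by move=> g; have := k0 g^-1%g; rewrite /k invgK => /eqP; rewrite subr_eq0 => /eqP.
have dl1 : l1bound (dl R 1%g : G -> R) 1.
  move=> A; have /l1bound_fin H : forall x : G, x \notin [fset 1%g]%fset -> dl R 1%g x = 0.
    by move=> x; rewrite inE /dl => /negbTE ->.
  by have := H A; rewrite big_seq_fset1 /dl eqxx normr1.
have kE x : k x = \sum_(s <- a) s.1 * u (s.2^-1 * x)%g - dl R 1%g x.
  rewrite /k /lop /w; congr (_ - _).
    by apply: eq_bigr => s _; rewrite invMg invgK.
  by rewrite /dl -(inj_eq invg_inj) invgK invg1.
have hk : l1bound k (nrm a * C + 1).
  move=> A; apply: (@le_trans _ _ (\sum_(g <- A) (\sum_(s <- a) `|s.1| * `|u (s.2^-1 * g)%g| + `|dl R 1%g g|))).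
    apply: ler_sum => x _; rewrite kE; apply: le_trans (ler_normB _ _) _; rewrite lerD2r.
    by apply: le_trans (ler_norm_sum _ _ _) _; apply: ler_sum => s _; rewrite normrM.
  rewrite big_split /=; apply: lerD; last exact: dl1.
  rewrite exchange_big /= /nrm big_distrl /=; apply: ler_sum => s _.
  rewrite -big_distrr /= ler_wpM2l//.
  have Hr : l1bound (fun g => u (s.2^-1 * g)%g) C.
    by apply: (l1bound_reindex (q := fun g => s.2 * g)%g) hu => x; rewrite mulVKg.
  exact: Hr.
apply: residually_finite_eq0 hk _ g => H phi hphi x.
have phi1 : phi 1%g = 1%g by apply: (mulgI (phi 1%g)); rewrite -hphi !mulg1.
have phiV y : phi y^-1%g = (phi y)^-1%g.
  by apply: (mulgI (phi y)); rewrite -hphi !mulgV phi1.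
have ub (p : G -> bool) : l1bound (fun g => u g * (p g)%:R) C.
  apply: l1bound_dom hu => y; rewrite normrM ler_piMr// normr_nat.
  by case: (p y); rewrite ?ler01 ?lexx.
pose uH y := rsum (fun g => u g * (phi g == y)%:R).
have huH y : has_sum (fun g => u g * (phi g == y)%:R) (uH y).
  exact: rsum_has_sum (ub (fun g => phi g == y)).
have dlH y : has_sum (fun g => dl R 1%g g * (phi g == y)%:R) (y == 1%g)%:R.
  have := @has_sum1 R G (fun g => dl R 1%g g * (phi g == y)%:R) 1%g.
  rewrite /dl eqxx mul1r phi1 eq_sym; apply => z /negbTE ->; exact: mul0r.
have shiftr s y : has_sum (fun g => u (g * s^-1)%g * (phi g == y)%:R) (uH (y * (phi s)^-1)%g).
  have pq : cancel (fun h => h * s^-1)%g (fun h => h * s)%g by move=> h; exact: mulgKV.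
  have qp : cancel (fun h => h * s)%g (fun h => h * s^-1)%g by move=> h; exact: mulgK.
  apply: eq_has_sum (has_sum_reindex pq qp (huH _)) => z /=.
  by rewrite hphi phiV (inj_eq (mulIg _)).
have shiftl s y : has_sum (fun g => u (s^-1 * g)%g * (phi g == y)%:R) (uH ((phi s)^-1 * y)%g).
  have pq : cancel (fun h => s^-1 * h)%g (fun h => s * h)%g by move=> h; exact: mulVKg.
  have qp : cancel (fun h => s * h)%g (fun h => s^-1 * h)%g by move=> h; exact: mulKg.
  apply: eq_has_sum (has_sum_reindex pq qp (huH _)) => z /=.
  by rewrite hphi phiV (inj_eq (mulgI _)).
pose b := [seq (s.1, phi s.2) | s <- a].
have hb y : \sum_(s <- b) s.1 * uH (y * s.2^-1)%g = (y == 1%g)%:R.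
  rewrite big_map /=; apply: has_sum_uniq (dlH y).
  apply: eq_has_sum (has_sum_lin a (fun s => s.1)
    (l := fun s => uH (y * (phi s.2)^-1)%g) (fun s => shiftr s.2 y)) => z /=.
  rewrite -Lu /lop big_map big_distrl /=; apply: eq_bigr => s _.
  by rewrite mulrA.
have hb' := finite_quotient_inverse hb x; rewrite big_map /= in hb'.
have := has_sumD (has_sum_lin a (fun s => s.1)
    (l := fun s => uH ((phi s.2)^-1 * x)%g) (fun s => shiftl s.2 x)) (has_sumZ (-1) (dlH x)).
rewrite hb' mulN1r subrr; apply: eq_has_sum => z /=.
rewrite kE mulrBl mulN1r; congr (_ - _).
by rewrite big_distrl /=; apply: eq_bigr => s _; rewrite mulrA.
Qed.

End TwoSided.

(** * Large minors and classes of integer lattices *)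

Section CauchyBinet.
Variables (K : comNzRingType) (d N : nat).
Implicit Types (f : {ffun 'I_d -> 'I_N}).

Definition rows f (M : 'M[K]_(N, d)) : 'M[K]_d := \matrix_(i, j) M (f i) j.

Lemma det_mul_rows (A : 'M[K]_(d, N)) (B : 'M[K]_(N, d)) :
  \det (A *m B) = \sum_(f : {ffun 'I_d -> 'I_N}) (\prod_i A i (f i)) * \det (rows f B).
Proof.
pose AB (s : 'S_d) i j := A i j * B j (s i).
transitivity (\sum_(f : {ffun 'I_d -> 'I_N}) \sum_(s : 'S_d) (-1) ^+ s * \prod_i AB s i (f i)).
  rewrite exchange_big; apply: eq_bigr => /= s _; rewrite -big_distrr /=.
  congr (_ * _); rewrite -(bigA_distr_bigA (AB s)) /=.
  by apply: eq_bigr => x _; rewrite mxE.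
apply: eq_bigr => f _; rewrite /determinant big_distrr /=; apply: eq_bigr => s _.
rewrite big_split /= mulrCA; congr (_ * (_ * _)).
by apply: eq_bigr => i _; rewrite mxE.
Qed.

(** Cauchy-Binet summed over all maps 'I_d -> 'I_N instead of subsets, hence the factor d!.
    Precomposing f with each permutation s and summing over s turns the product of entries into a
    second determinant. *)
Lemma det_gram (M : 'M[K]_(N, d)) :
  (d`!)%:R * \det (M^T *m M) = \sum_f \det (rows f M) ^+ 2.
Proof.
have E (s : 'S_d) : \det (M^T *m M) =
    \sum_(f : {ffun 'I_d -> 'I_N}) (-1) ^+ s * (\prod_i M (f (s i)) i) * \det (rows f M).
  rewrite det_mul_rows.
  rewrite (reindex (fun f : {ffun 'I_d -> 'I_N} => [ffun i => f (s i)])) /=; last first.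
    exists (fun f : {ffun 'I_d -> 'I_N} => [ffun i => f (s^-1 i)%g]) => f _;
      by apply/ffunP => i; rewrite !ffunE ?permK ?permKV.
  apply: eq_bigr => f _.
  have -> : rows [ffun i => f (s i)] M = row_perm s (rows f M).
    by apply/matrixP => i j; rewrite !mxE ffunE.
  rewrite row_permE det_mulmx det_perm mulrCA mulrA; congr (_ * _ * _).
  by apply: eq_bigr => i _; rewrite mxE ffunE.
have -> : (d`!)%:R * \det (M^T *m M) = \sum_(s : 'S_d) \det (M^T *m M).
  by rewrite sumr_const card_Sn mulr_natl.
rewrite (eq_bigr _ (fun s _ => E s)) exchange_big /=; apply: eq_bigr => f _.
rewrite -big_distrl /= expr2; congr (_ * _).
rewrite -det_tr; apply: eq_bigr => s _; congr (_ * _).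
by apply: eq_bigr => i _; rewrite !mxE.
Qed.

Lemma det_rows_ninj f (M : 'M[K]_(N, d)) : ~~ injectiveb f -> \det (rows f M) = 0.
Proof.
move=> /injectivePn[i [j ij fij]]; apply: (determinant_alternate ij) => k.
by rewrite !mxE fij.
Qed.

End CauchyBinet.

(** Pigeonhole on [det_gram]: noninjective maps repeat a row and contribute 0, and there are only
    'C(N, d) d! injective ones. *)
Lemma large_minor (R : realDomainType) d N (M : 'M[R]_(N, d)) : (d <= N)%N ->
  exists f : {ffun 'I_d -> 'I_N}, injective f /\
    \det (M^T *m M) <= 'C(N, d)%:R * \det (rows f M) ^+ 2.
Proof.
move=> dN; apply: contrapT => no.
have H (f : {ffun 'I_d -> 'I_N}) : injectiveb f -> 'C(N, d)%:R * \det (rows f M) ^+ 2 < \det (M^T *m M).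
  move=> /injectiveP fi; rewrite ltNge; apply/negP => h.
  by apply: no; exists f.
pose f0 : {ffun 'I_d -> 'I_N} := [ffun i => widen_ord dN i].
have f0i : injectiveb f0.
  by apply/injectiveP => i j; rewrite !ffunE => /(congr1 val)/= /val_inj.
have : \sum_(f : {ffun 'I_d -> 'I_N} | injectiveb f) 'C(N, d)%:R * \det (rows f M) ^+ 2 <
   \sum_(f : {ffun 'I_d -> 'I_N} | injectiveb f) \det (M^T *m M).
  apply: ltr_sum => [|f]; last exact: H.
  by apply/hasP; exists f0; rewrite ?mem_index_enum.
rewrite -big_distrr /= sumr_const.
have -> : \sum_(f : {ffun 'I_d -> 'I_N} | injectiveb f) \det (rows f M) ^+ 2 =
    (d`!)%:R * \det (M^T *m M).
  rewrite det_gram [RHS](bigID (fun f : {ffun 'I_d -> 'I_N} => injectiveb f)) /=.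
  by rewrite [X in _ + X]big1 ?addr0// => f /det_rows_ninj ->; rewrite expr0n.
have -> : #|(fun f : {ffun 'I_d -> 'I_N} => injectiveb f)| = ('C(N, d) * d`!)%N.
  rewrite bin_ffact -[in RHS](card_ord d) -[in RHS](card_ord N) -card_inj_ffuns.
  by apply: eq_card => f; rewrite !inE.
by rewrite -[X in _ < X]mulr_natl natrM mulrA ltxx.
Qed.

(** Smith normal form A = L D Q with L and Q unimodular: the class of u is the vector of residues of
    L^-1 u modulo the diagonal entries of D, whose product is the determinant up to sign. *)
Lemma lattice_classes d (A : 'M[int]_d) : \det A != 0 ->
  exists (K : finType) (kappa : 'cV[int]_d -> K),
    [/\ #|K| = `|\det A|%N, forall k, exists u, kappa u = k &
        forall u v, kappa u = kappa v <-> exists m, u - v = A *m m].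
Proof.
have [L uL [Q uQ [ds _ AE]]] := int_Smith_normal_form A.
set D := \matrix_(_, _) _ in AE.
have detD : \det D = \prod_(i < d) ds`_i.
  have -> : D = diag_mx (\row_i ds`_i).
    by apply/matrixP => i j; rewrite !mxE -val_eqE; case: eqP => [->|].
  by rewrite det_diag; apply: eq_bigr => i _; rewrite mxE.
have absdet (U : 'M[int]_d) : U \in unitmx -> `|\det U|%N = 1%N.
  by rewrite unitmxE => /orP[/eqP ->|/eqP ->].
rewrite AE !det_mulmx !abszM (absdet _ uL) (absdet _ uQ) mul1n muln1 detD => dn0.
have dsn0 (i : 'I_d) : ds`_i != 0.
  move: dn0; rewrite !mulf_eq0 !negb_or => /andP[/andP[_ +] _].
  by rewrite prodf_seq_neq0 => /allP /(_ i); rewrite mem_index_enum; apply.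
pose T (i : 'I_d) : finType := 'I_(absz (ds`_i)%R).
have lt_mod (x : int) (i : 'I_d) : (absz (x %% (ds`_i)%R)%Z < absz (ds`_i)%R)%N.
  by rewrite -ltz_nat gez0_abs ?modz_ge0// ltz_mod.
pose kap (u : 'cV[int]_d) : {dffun forall i, T i} :=
  [ffun i => Ordinal (lt_mod ((invmx L *m u) i 0) i)].
have kapE u v : kap u = kap v <->
    forall i, ((ds`_i)%R %| ((invmx L *m (u - v)) i 0)%R)%Z.
  rewrite mulmxBr; split=> [/ffunP h i|h].
    have := h i; rewrite !ffunE => /(congr1 val)/= E.
    rewrite !mxE in E *; rewrite -eqz_mod_dvd; apply/eqP.
    by rewrite -[LHS]gez0_abs ?modz_ge0// E gez0_abs ?modz_ge0.
  apply/ffunP => i; rewrite !ffunE; apply: val_inj => /=.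
  have := h i; rewrite [X in (_ %| X)%Z]mxE [X in (_ %| _ + X)%Z]mxE -eqz_mod_dvd.
  by move=> /eqP ->.
have Dmul (w : 'cV[int]_d) i : (D *m w) i 0 = ds`_i * w i 0.
  rewrite mxE (bigD1 i)//= mxE eqxx mulr1n big1 ?addr0// => k ki.
  by rewrite mxE eq_sym val_eqE (negbTE ki) mulr0n mul0r.
exists {dffun forall i, T i}, kap; split.
- rewrite card_dep_ffun foldrE big_map big_enum /=.
  rewrite (big_morph absz abszM absz1) //.
  by apply: eq_bigr => i _; rewrite card_ord.
- move=> k; exists (L *m \col_i (k i : nat)%:Z).
  apply/ffunP => i; rewrite ffunE; apply: val_inj => /=.
  rewrite mulKmx// mxE -modz_abs modz_small ?absz_nat//.
  by apply/andP; split=> //; rewrite ltz_nat; exact: ltn_ord (k i).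
- move=> u v; rewrite kapE; split=> [h|[m uv] i].
    exists (invmx Q *m \col_i (((invmx L *m (u - v)) i 0)%R %/ (ds`_i)%R)%Z).
    rewrite -!mulmxA (mulKVmx uQ); apply: (can_inj (mulKVmx uL)); rewrite mulKmx//.
    apply/matrixP => i j; rewrite ord1 Dmul [X in _ * X]mxE mulrC divzK//.
  by rewrite uv -!mulmxA mulKmx// Dmul dvdz_mulr.
Qed.

Section Counting.
Variable R : realType.

(** Give weight x <= 1 to each coordinate other than [None]. A vector with at most b of them weighs
    at least x^b, and the total weight of all vectors factors as (1 + q x)^n. With b = o(n) and x
    small this count is subexponential. *)
Lemma card_sparse n q b (x : R) : 0 < x <= 1 ->
  #|[pred c : {ffun 'I_n -> option 'I_q} | #|[pred i | c i != None]| <= b]%N|%:R * x ^+ b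
    <= (1 + q%:R * x) ^+ n.
Proof.
move=> /andP[x0 x1].
pose F (o : option 'I_q) : R := if o is None then 1 else x.
have -> : (1 + q%:R * x) ^+ n = \sum_(c : {ffun 'I_n -> option 'I_q}) \prod_i F (c i).
  rewrite -(bigA_distr_bigA (fun=> F)) /= prodr_const card_ord; congr (_ ^+ _).
  rewrite (bigD1 None) //=; congr (_ + _).
  rewrite (eq_bigr (fun=> x)) => [|[i|]//]; rewrite sumr_const mulr_natl.
  congr (_ *+ _); have := cardC1 (None : option 'I_q); rewrite card_option card_ord /= => E; rewrite -{1}E.
  by apply: eq_card => o; rewrite !inE.
have prodF (c : {ffun 'I_n -> option 'I_q}) :
    \prod_i F (c i) = x ^+ #|[pred i | c i != None]|.
  rewrite (bigID (fun i => c i != None)) /= [X in _ * X]big1 ?mulr1; last first.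
    by move=> i; rewrite negbK => /eqP ->.
  rewrite (eq_bigr (fun=> x)) => [|i]; last by case: (c i).
  transitivity (\prod_(i in [pred i | c i != None]) x); last exact: prodr_const.
  by apply: eq_bigl => i; rewrite inE.
rewrite mulr_natl -sumr_const.
apply: (@le_trans _ _ (\sum_(c in [pred c : {ffun 'I_n -> option 'I_q} | #|[pred i | c i != None]| <= b]%N)
   \prod_i F (c i))).
  apply: ler_sum => c; rewrite inE prodF => cb.
  by apply: ler_wiXn2l => //; exact: ltW.
rewrite [leRHS](bigID (mem [pred c : {ffun 'I_n -> option 'I_q} | #|[pred i | c i != None]| <= b]%N)) /=.
by rewrite lerDl; apply: sumr_ge0 => c _; rewrite prodF exprn_ge0// ltW.
Qed.

Lemma bin_le (N k : nat) (x : R) : 0 <= x -> 'C(N, k)%:R * x ^+ k <= (1 + x) ^+ N.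
Proof.
move=> x0; have [kN|Nk] := leqP k N; last by rewrite bin_small// mul0r exprn_ge0// addr_ge0.
rewrite exprDn (bigD1 (Ordinal (kN : (k < N.+1)%N))) //= expr1n mul1r mulr_natl lerDl.
by apply: sumr_ge0 => i _; rewrite mulrn_wge0// expr1n mul1r exprn_ge0.
Qed.

End Counting.

(** * Counting separated sets *)

Section Windows.
Variables (G : groupType) (n : nat) (e : 'I_n -> G).
Implicit Types (K : seq G).

(* [e] enumerates a finite subset Phi of G. [bd e K] counts the pairs (g, k) in
   Phi x K with gk outside Phi; it is o(n) along a Folner sequence. *)
Definition bd K : nat := \sum_(k <- K) #|[pred j | (e j * k)%g \notin codom e]|.

Definition window K : seq G := undup [seq (g * k)%g | g <- codom e, k <- K].

Lemma windowP K g : reflect (exists j k, k \in K /\ g = (e j * k)%g) (g \in window K).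
Proof.
rewrite mem_undup; apply: (iffP allpairsP) => [[[h k] /= [/codomP[j ->] kK ->]]|[j [k [kK ->]]]].
  by exists j, k.
by exists (e j, k); rewrite codom_f.
Qed.

Lemma bd_has K : (#|[pred j | has (fun k => (e j * k)%g \notin codom e) K]| <= bd K)%N.
Proof.
rewrite /bd; elim: K => [|k K IH]; first by rewrite big_nil eq_card0.
rewrite big_cons; apply: leq_trans (leq_add (leqnn _) IH).
rewrite -cardUI; apply: leq_trans (leq_addr _ _); apply: subset_leq_card.
by apply/fintype.subsetP => j; rewrite !inE.
Qed.

Lemma bd_sub K K' : {subset K <= K'} -> uniq K -> (bd K <= bd K')%N.
Proof.
rewrite /bd; elim: K K' => [|k K IH] K' KK; first by rewrite big_nil.
have kK' : k \in K' by apply: KK; rewrite inE eqxx.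
rewrite [leqRHS](perm_big _ (perm_to_rem kK')) !big_cons /= leq_add2l => /andP[kK uK].
apply: IH => // x xK; have := KK x; rewrite inE xK orbT => /(_ isT).
rewrite (perm_mem (perm_to_rem kK')) inE => /orP[/eqP xk|//].
by rewrite -xk xK in kK.
Qed.

Lemma size_window_out K :
  (size [seq g <- window K | g \notin codom e] <= bd K)%N.
Proof.
have -> : bd K = size [seq (e j * k)%g | k <- K, j <- enum [pred j | (e j * k)%g \notin codom e]].
  rewrite size_allpairs_dep sumnE big_map; apply: eq_bigr => k _.
  by rewrite cardE.
apply: uniq_leq_size => [|g]; first by rewrite filter_uniq// undup_uniq.
rewrite mem_filter => /andP[ge /windowP[j [k [kK gE]]]].
apply/allpairsPdep; exists k, j; split=> //; rewrite mem_enum inE -gE //.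
Qed.

Lemma size_window K : injective e -> 1%g \in K ->
  size (window K) = (n + size [seq g <- window K | g \notin codom e])%N.
Proof.
move=> ie K1; rewrite size_filter -[LHS](count_predC (fun g => g \in codom e)).
congr (_ + _)%N; rewrite -size_filter.
have nE : size (codom e) = n by rewrite size_codom card_ord.
rewrite -[RHS]nE; apply/perm_size/uniq_perm.
- by rewrite filter_uniq// undup_uniq.
- by rewrite codomE map_inj_uniq// enum_uniq.
move=> g; rewrite mem_filter; case: (boolP (g \in codom e)) => //= /codomP[j ->].
by apply/windowP; exists j, 1%g; rewrite mulg1.
Qed.

End Windows.

Section Separated.
Variables (R : realType) (G : groupType).

(** Separation of points of the torus in terms of real lifts: quantifying over all integers m
    expresses the distance in R/Z. The family is indexed, so that its size is that of the index
    type. *)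
Definition sep (P : seq G) (eps : R) (I : Type) (y : I -> G -> R) :=
  forall i j, i <> j -> exists2 g, g \in P & forall m : int, eps <= `|y i g - y j g - m%:~R|.

Definition lop_int (a : seq (R * G)) (y : G -> R) := forall g, lop a y g \is a Num.int.

End Separated.

(** * Lower bound for separated families *)

Section LowerBound.
Variables (R : realType) (G : groupType) (ai : seq (int * G)).
Let a : seq (R * G) := [seq (s.1%:~R, s.2) | s <- ai].

Lemma lop_intr (m : G -> int) g : lop a (fun x => (m x)%:~R) g = (lop ai m g)%:~R.
Proof. by rewrite (lop_map (intmul 1)). Qed.

(** The image of [e'] contains the supports of all columns, so cutting off to it loses nothing and
    the Gram matrix of the rectangular section is the section of f^* f. *)
Lemma gram_mat (K : comNzRingType) (b : seq (K * G)) n N (e : 'I_n -> G) (e' : 'I_N -> G) :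
  injective e' -> (forall j s, s \in b -> (e j * s.2^-1)%g \in codom e') ->
  (mat b e' e)^T *m mat b e' e = mat (amul (adj b) b) e e.
Proof.
move=> ie' he; apply/matrixP => i j; rewrite trmx_mat !mxE -lop_comp.
transitivity (lop (adj b) (ext e' (fun l => lop b (dl K (e j)) (e' l))) (e i)).
  by rewrite /ext lop_lin; apply: eq_bigr => l _; rewrite !mxE mulrC.
apply: eq_lop; apply: ext_res => // g ge.
rewrite /lop big_seq big1// => s sb; rewrite /dl; case: eqP => [E|]; rewrite ?mulr0//.
by have := he j s sb; rewrite -E mulgK (negbTE ge).
Qed.

Lemma frac_part (x : R) : 0 <= x - (Num.floor x)%:~R < 1.
Proof.
rewrite subr_ge0 Num.Theory.floor_le ltrBlDl /=.
by have := Num.Theory.floorD1_gt x; rewrite intrD addrC.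
Qed.

Lemma inord_int_inj (B : nat) (m m' : int) : (absz m <= B)%N -> (absz m' <= B)%N ->
  inord (absz (m + B%:Z)) = inord (absz (m' + B%:Z)) :> 'I_(2 * B).+1 -> m = m'.
Proof.
move=> h h' /(congr1 val) /=.
have b x : (absz x <= B)%N -> (absz (x + B%:Z)%R < (2 * B).+1)%N by lia.
by rewrite !inordK ?b//; lia.
Qed.

Lemma int_lt1 (x : R) : x \is a Num.int -> `|x| < 1 -> x = 0.
Proof.
move=> /intrP[m ->]; rewrite -intr_norm -[1]/(1%:~R) ltr_int => h.
have -> : m = 0 by lia.
by [].
Qed.

Lemma codedP (I K T : finType) (rep : I -> K) (code : I -> T) (S : {pred K}) :
  (forall i, rep i \in S) ->
  (forall i j, rep i = rep j -> code i = code j -> i = j) ->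
  (#|I| <= #|S| * #|T|)%N.
Proof.
move=> hS inj.
pose F i := (rep i, code i).
have Fi : injective F by move=> i j [/inj h /h].
rewrite -(card_codom Fi).
have -> : (#|S| * #|T|)%N = #|[predX S & T]| by rewrite cardX.
by apply: subset_leq_card; apply/fintype.subsetP => _ /codomP[i ->]; rewrite inE /= hS.
Qed.

Variables (w : G -> R) (C : R).
Hypothesis aw : l1inv a w C.

(* The classes of Z^J modulo the lattice generated by the columns of a large
   n x n minor yield points [Wop w z], which are separated up to the choice of
   an integer vector outside the window. *)
Lemma separated_lower : exists (K : seq G) (eps : R) (c : nat),
  [/\ 0 < eps, (0 < c)%N & forall n (e : 'I_n -> G), injective e ->
    exists (I : finType) (y : I -> G -> R),
      [/\ forall i, lop_int a (y i), sep (window e K) eps y &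
        forall x : R, 0 < x <= 1 ->
        (\det (mat (amul (adj ai) ai) e e))%:~R * x ^+ bd e K <=
        (1 + x) ^+ (n + bd e K) * (#|I|%:R * c%:R ^+ bd e K) ^+ 2]].
Proof.
have [hw aw1 _] := aw; have C0 := l1bound_ge0 hw.
(* [nu] will bound the representatives of the classes, hence nu C the points built from them. [eps]
   is so small that a function bounded by eps whose image under [lop a] is integral has image 0. *)
pose nu := nrm a + 1; have nu0 : 0 < nu by rewrite ltr_wpDl ?nrm_ge0.
have nua : nrm a < nu by rewrite ltrDl ltr01.
pose eps := (2 * nu)^-1; have eps0 : 0 < eps by rewrite invr_gt0 mulr_gt0.
have e4 : 0 < eps / (4 * nu) by rewrite divr_gt0// mulr_gt0.
have [K0 hK0] := l1bound_tail hw e4.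
(* The window of [K1] contains the supports of the columns of the section. Enlarging by [K0], which
   carries w up to a small tail, ensures that outside the window of [K] all points are within eps /
   4 of 0. *)
pose K1 := 1%g :: [seq s.2^-1%g | s <- ai].
pose K := undup (K1 ++ [seq (k * h)%g | k <- K1, h <- enum_fset K0]).
have [B hB] : exists B : nat, 2 * nu * C <= B%:R.
  exists `|Num.ceil (2 * nu * C)|%N; apply: le_trans (Num.Theory.ceil_ge _) _.
  by rewrite natr_absz ler_int ler_norm.
exists K, eps, (2 * B).+1; split=> // n e ie.
have K1K : {subset K1 <= K} by move=> k kK; rewrite mem_undup mem_cat kK.
have K1one : 1%g \in K1 by rewrite inE eqxx.
pose P := window e (undup K1); pose N := size P.
have uP : uniq P by exact: undup_uniq.
pose e' (i : 'I_N) := nth 1%g P i.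
have ie' : injective e' by move=> i j /eqP; rewrite nth_uniq// => /eqP/val_inj.
have codome' g : (g \in codom e') = (g \in P).
  apply/codomP/idP => [[i ->]|gP]; first by rewrite mem_nth.
  have iN : (index g P < N)%N by rewrite index_mem.
  by exists (Ordinal iN); rewrite /e' nth_index.
have he' j s : s \in ai -> (e j * s.2^-1)%g \in codom e'.
  move=> sa; rewrite codome'; apply/windowP; exists j, s.2^-1%g.
  by split=> //; rewrite mem_undup inE (map_f (fun s : int * G => s.2^-1%g) sa) orbT.
set M := mat ai e' e.
have NE : N = (n + size [seq g <- P | g \notin codom e])%N.
  by rewrite /N /P size_window// mem_undup.
set o1 := size _ in NE.
have o1b : (o1 <= bd e K)%N.
  apply: leq_trans (size_window_out _ _) _; apply: bd_sub (undup_uniq _) => k.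
  by rewrite mem_undup => /K1K.
have nN : (n <= N)%N by rewrite NE leq_addr.
have [f [fi detf]] := large_minor M nN.
rewrite gram_mat// in detf.
set A := rows f M in detf.
have detfx (x : R) D : 0 < x <= 1 -> `|(\det A)%:~R| <= D ->
    (\det (mat (amul (adj ai) ai) e e))%:~R * x ^+ bd e K <=
        (1 + x) ^+ (n + bd e K) * D ^+ 2.
  move=> /andP[x0 x1] hD.
  have detf' : (\det (mat (amul (adj ai) ai) e e))%:~R <= 'C(N, n)%:R * (\det A)%:~R ^+ 2 :> R.
    by move: detf; rewrite -(ler_int R) rmorphM rmorph_nat rmorphXn.
  have xb0 : 0 <= x ^+ bd e K by rewrite exprn_ge0// ltW.
  apply: le_trans (ler_wpM2r xb0 detf') _.
  have dD : (\det A)%:~R ^+ 2 <= D ^+ 2 :> R.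
    rewrite -real_normK ?num_real// ler_sqr ?nnegrE//.
    exact: le_trans hD.
  (* Only N - n = o1 rows are omitted, a number of boundary size; so the binomial coefficient is at
     most (1 + x)^N x^-o1. *)
  have CE : 'C(N, n) = 'C(N, o1) by rewrite -bin_sub// {2}NE addKn.
  rewrite mulrAC CE; apply: ler_pM => //; first by rewrite mulr_ge0 ?ler0n.
    by rewrite sqr_ge0.
  apply: (@le_trans _ _ ('C(N, o1)%:R * x ^+ o1)).
    by rewrite ler_wpM2l// ler_wiXn2l// ltW.
  apply: le_trans (bin_le _ _ (ltW x0)) _.
  by rewrite ler_weXn2l ?lerDl ?ltW// NE leq_add2l.
(* If the largest minor vanishes, the Gram determinant is at most 0 and the empty family satisfies
   the estimate. *)
have [dA0|dA0] := eqVneq (\det A) 0.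
  exists 'I_0, (fun _ _ => 0); split=> [[]//|[]//|x x01].
  by apply: detfx => //; rewrite dA0 normr0 mulr_ge0.
have [Kt [kap [cardK ksurj kapE]]] := lattice_classes dA0.
pose J i := e' (f i).
have iJ : injective J by move=> i j /ie'/fi.
have AJ : A = mat ai J e by apply/matrixP => i j; rewrite !mxE.
pose AR : 'M[R]_n := map_mx intr A.
have ARE : AR = mat a J e.
  apply/matrixP => i j; rewrite /AR AJ !mxE -lop_intr; apply: eq_lop => x.
  by rewrite /dl rmorph_nat.
have uAR : AR \in unitmx by rewrite unitmxE det_map_mx unitfE intr_eq0.
(* From a representative u, subtract A applied to the integer part of A^-1 u. What remains is A
   applied to a vector with entries in [0, 1[, hence bounded by the l^1 norm of a. *)
have [r [rk rb]] : exists r : Kt -> 'cV[int]_n, (forall k, kap (r k) = k) /\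
    forall k i, `|(r k i 0)%:~R| <= nu :> R.
  have H k : exists r : 'cV[int]_n, kap r = k /\ forall i, `|(r i 0)%:~R| <= nu :> R.
    have [u uk] := ksurj k.
    pose fr := invmx AR *m map_mx intr u.
    pose m : 'cV[int]_n := \col_j Num.floor (fr j 0).
    exists (u - A *m m); split.
      rewrite -uk; apply/kapE; exists (- m).
      by rewrite mulmxN addrAC subrr add0r.
    move=> i.
    have -> : ((u - A *m m) i 0)%:~R = (AR *m (fr - map_mx intr m)) i 0 :> R.
      by rewrite mulmxBr /fr mulKVmx// -map_mxM !mxE rmorphB.
    rewrite ARE mat_mul; apply: (@le_trans _ _ (nrm a * 1)); last by rewrite mulr1 ltW.
    apply: lop_le => g; have [/codomP[j ->]|ge] := boolP (g \in codom e); last first.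
      by rewrite ext_out// normr0.
    rewrite extE// [X in `|X|]mxE [X in _ + X]mxE [X in - X]mxE [X in X%:~R]mxE.
    by have /andP[f0 f1] := frac_part (fr j 0); rewrite ger0_norm// ltW.
  exists (fun k => sval (cid (H k))); split=> [k|k i]; by case: (cid (H k)) => ? /= [].
pose z k : G -> int := ext J (fun i => r k i 0).
pose zR k g : R := (z k g)%:~R.
have zb k g : `|zR k g| <= nu.
  rewrite /zR /z; have [/codomP[i ->]|gJ] := boolP (g \in codom J).
    by rewrite extE.
  by rewrite ext_out// normr0 ltW.
pose y k := Wop w (zR k).
have ly k : lop a (y k) =1 zR k by exact: lop_Wop aw (zb k).
have yb k g : `|y k g| <= nu * C by exact: Wop_le.
(* If [Rel k k'] holds, the points of k and k' differ by the integral function m and coincide in the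
   torus, so one k is kept per class of [Rel]. This relation is coarser than equality of k and k'
   since m may live on the window outside Phi. *)
pose Rel k k' := exists m : G -> int, (forall g, g \notin window e K -> m g = 0) /\
   forall g, z k g - z k' g = lop ai m g.
have Rrefl k : Rel k k.
  by exists (fun=> 0); split=> // g; rewrite subrr lop0.
have Rsym k k' : Rel k k' -> Rel k' k.
  move=> [m [m0 hm]]; exists (fun g => 0 - m g); split=> [g /m0 ->|g]; first by rewrite subrr.
  by rewrite lopB lop0 -hm sub0r opprB.
have Rtrans k1 k2 k3 : Rel k1 k2 -> Rel k2 k3 -> Rel k1 k3.
  move=> [m [m0 hm]] [m' [m'0 hm']]; exists (fun g => m g + m' g); split=> [g gw|g].
    by rewrite m0// m'0// addr0.
  by rewrite lopD -hm -hm'; ring.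
pose rep k := odflt k [pick k' | `[< Rel k k' >]].
have Rrep k : Rel k (rep k).
  by rewrite /rep; case: pickP => [k' /asboolP//|_]; exact: Rrefl.
have repE k k' : Rel k k' -> rep k = rep k'.
  move=> h; rewrite /rep (eq_pick (Q := fun x => `[< Rel k' x >])).
    by case: pickP => // /(_ k') /asboolP; case; exact: Rrefl.
  move=> x; apply/asboolP/asboolP => h'; first exact: Rtrans (Rsym _ _ h) h'.
  exact: Rtrans h h'.
pose outs := [seq g <- window e K | g \notin codom e].
have outsb : (size outs <= bd e K)%N by exact: size_window_out.
have [m [m0 hm]] : exists m : Kt -> G -> int,
    (forall k g, g \notin window e K -> m k g = 0) /\
    forall k g, z k g - z (rep k) g = lop ai (m k) g.
  exists (fun k => sval (cid (Rrep k))).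
  by split=> k; case: (cid (Rrep k)) => ? /= [].
(* m k is the convolution by w of a difference of two functions bounded by nu, hence bounded by 2 nu
   C. *)
have mb k g : (absz (m k g) <= B)%N.
  rewrite -(ler_nat R) natr_absz intr_norm; apply: le_trans hB.
  have fb h : `|(m k h)%:~R : R| <= \sum_(x <- [fset x in window e K]%fset) `|(m k x)%:~R|.
    by apply: fin_bound => x; rewrite inE /= => /m0 ->.
  rewrite -(Wop_lop aw fb) (_ : lop a _ = fun x => zR k x - zR (rep k) x); last first.
    by apply/funext => x; rewrite lop_intr -hm rmorphB.
  apply: Wop_le => // h; rewrite mulrC mulr_natr mulr2n.
  by apply: le_trans (ler_normB _ _) _; exact: lerD.
(* Within a class of [Rel], k is determined by the values of [m k] on the window outside Phi: if
   these agree for k and k', the difference of m k and m k' is supported in Phi and the lattice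
   classes coincide. Each value lies in [-B, B]. *)
pose code k : {ffun 'I_(size outs) -> 'I_(2 * B).+1} :=
  [ffun i : 'I_(size outs) => inord (absz (m k (nth 1%g outs i) + B%:Z)%R)].
have codeE k k' g : code k = code k' -> g \in outs -> m k g = m k' g.
  move=> /ffunP E gI; have iN : (index g outs < size outs)%N by rewrite index_mem.
  have := E (Ordinal iN); rewrite !ffunE /= nth_index//.
  by apply: inord_int_inj.
pose S : {pred Kt} := [pred k | rep k == k].
have cardKS : (#|Kt| <= #|S| * #|{ffun 'I_(size outs) -> 'I_(2 * B).+1}|)%N.
  apply: (@codedP _ _ _ rep code) => [k|k k' rkk' ckk'].
    by rewrite inE /=; apply/eqP/esym/repE.
  rewrite -(rk k) -(rk k'); apply/kapE; exists (\col_j (m k (e j) - m k' (e j))).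
  apply/matrixP => i j; rewrite ord1 AJ mat_mul.
  have m0' g : g \notin codom e -> m k g - m k' g = 0.
    move=> ge; have [gw|gw] := boolP (g \in window e K); last by rewrite !m0// subrr.
    by rewrite (codeE k k') ?subrr// mem_filter ge.
  have -> : ext e ((\col_j1 (m k (e j1) - m k' (e j1)))^~ 0) = fun g => m k g - m k' g.
    apply/funext => g; rewrite -[RHS](ext_res ie m0'); congr ext.
    by apply/funext => l; rewrite mxE.
  rewrite lopB -!hm -rkk' opprB addrA subrK.
  by rewrite /z !extE// !mxE.
rewrite card_ffun !card_ord in cardKS.
exists {k : Kt | rep k == k}, (fun k => y (val k)); split.
- move=> k g; rewrite ly; exact: intr_int.
- move=> k k' kk'; apply: contrapT => nsep.
  have {}nsep g : exists m : int, g \in window e K -> `|y (val k) g - y (val k') g - m%:~R| < eps.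
    have [gw|] := boolP (g \in window e K); last by exists 0.
    apply: contrapT => h; apply: nsep; exists g => // m1.
    by rewrite leNgt; apply/negP => h'; apply: h; exists m1.
  (* [q] rounds the difference on the window and is 0 outside, where both points are close to 0. So
     s is bounded by eps everywhere, its image is integral and below 1, and s = 0; then [q]
     witnesses [Rel]. *)
  pose q g : int := if g \in window e K then sval (cid (nsep g)) else 0.
  pose s g := y (val k) g - y (val k') g - (q g)%:~R.
  have sb g : `|s g| <= eps.
    rewrite /s /q; case: ifP => gw.
      by apply: ltW; case: (cid (nsep g)) => /= m1; apply.
    have tail k1 : `|y k1 g| <= eps / 4.
      rewrite /y (Wop_fin (A := [fset J i | i in 'I_n]%fset) _ hw); last first.
        move=> h hJ; rewrite /zR /z ext_out//; apply/negP => /codomP[i hE].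
        by move/negP: hJ; apply; apply/imfsetP; exists i.
      apply: le_trans (ler_norm_sum _ _ _) _.
      apply: (@le_trans _ _ (\sum_(h <- [fset J i | i in 'I_n]%fset) nu * `|w (h^-1 * g)%g|)).
        by apply: ler_sum => h _; rewrite normrM ler_wpM2r.
      rewrite -big_distrr /=.
      have -> : \sum_(h <- [fset J i | i in 'I_n]%fset) `|w (h^-1 * g)%g| =
          \sum_(h <- [fset (h^-1 * g)%g | h in [fset J i | i in 'I_n]%fset]%fset) `|w h|.
        rewrite [RHS]big_imfset //= => x1 x2 _ _ /mulIg /invg_inj //.
      have -> : eps / 4 = nu * (eps / (4 * nu)) by field; rewrite gt_eqF.
      apply: ler_wpM2l; [exact: ltW|apply: hK0]; apply/fdisjointP => h hK.
      apply/negP => /imfsetP[h' /= /imfsetP[i /= _ ->] hE].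
      move/negP: gw; apply.
      have : J i \in P by rewrite -codome'; exact: (codom_f e' (f i)).
      move=> /windowP[j [k2 [k2K JE]]]; apply/windowP; exists j, (k2 * h)%g; split.
        rewrite mem_undup mem_cat; apply/orP; right; apply/allpairsP; exists (k2, h).
        by rewrite -(mem_undup K1).
      by rewrite mulgA -JE hE mulVKg.
    rewrite subr0; apply: le_trans (ler_normB _ _) _.
    have := tail (val k); have := tail (val k'); lra.
  have ls g : lop a s g = (z (val k) g - z (val k') g - lop ai q g)%:~R.
    have -> : lop a s g = lop a (y (val k)) g - lop a (y (val k')) g -
        lop a (fun x => (q x)%:~R) g by rewrite /s !lopB.
    by rewrite !ly lop_intr !rmorphB.
  have ls0 : lop a s =1 fun=> 0.
    move=> g; apply: int_lt1; first by rewrite ls; exact: intr_int.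
    apply: le_lt_trans (lop_le a g sb) _.
    rewrite /eps -ltr_pdivlMr ?invr_gt0 ?mulr_gt0// invrK mul1r.
    by apply: lt_trans nua _; rewrite ltr_pMl// ltr1n.
  have s0 := lop_inj0 aw sb ls0.
  apply: kk'; apply: val_inj.
  rewrite -(eqP (valP k)) -(eqP (valP k')) /=; apply: repE.
  exists q; split=> [g|g]; first by rewrite /q; case: ifP.
  by have := ls g; rewrite ls0 => /eqP; rewrite eq_sym intr_eq0 subr_eq0 => /eqP.
- move=> x x01; apply: detfx => //.
  rewrite -intr_norm -abszE -pmulrn -cardK card_sig.
  rewrite -natrX -natrM ler_nat; apply: leq_trans cardKS _.
  by rewrite leq_mul2l leq_pexp2l ?orbT.
Qed.

End LowerBound.

(** * Upper bound for separated families *)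

Section Quantize.
Variable R : realType.

Definition qz (q : nat) (x : R) : 'I_q.+1 := inord `|Num.floor (x * q.+1%:R)|%N.

Lemma qzP q (x x' : R) : 0 <= x < 1 -> 0 <= x' < 1 -> qz q x = qz q x' ->
  `|x - x'| * q.+1%:R <= 1.
Proof.
move=> /andP[x0 x1] /andP[x'0 x'1] /(congr1 val) /=.
have q0 : 0 < q.+1%:R :> R by rewrite ltr0n.
have b (z : R) : 0 <= z -> z < 1 ->
    0 <= Num.floor (z * q.+1%:R) /\ (`|Num.floor (z * q.+1%:R)| < q.+1)%N.
  move=> z0 z1; have f0 : 0 <= Num.floor (z * q.+1%:R) by rewrite Num.Theory.floor_ge0 mulr_ge0// ltW.
  split=> //; rewrite -ltz_nat gez0_abs// -(ltr_int R).
  apply: le_lt_trans (Num.Theory.floor_le _) _.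
  by rewrite -[X in _ < X]mul1r ltr_pM2r.
have [f0 f1] := b _ x0 x1; have [f0' f1'] := b _ x'0 x'1.
rewrite !inordK// => /(congr1 Posz); rewrite !gez0_abs// => E.
have := frac_part (x * q.+1%:R); have := frac_part (x' * q.+1%:R); rewrite E.
set F := (Num.floor _)%:~R => /andP[h1 h2] /andP[h3 h4].
rewrite -[q.+1%:R]ger0_norm// -normrM mulrBl; apply/ler_normlP; split; lra.
Qed.

End Quantize.

Section UpperBound.
Variables (R : realType) (G : groupType) (p : seq (int * G)).
Let pr : seq (R * G) := [seq (s.1%:~R, s.2) | s <- p].

Lemma map_mat n N (e : 'I_n -> G) (e' : 'I_N -> G) :
  map_mx intr (mat p e' e) = mat pr e' e.
Proof.
apply/matrixP => i j; rewrite !mxE -lop_intr; apply: eq_lop => x.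
by rewrite /dl rmorph_nat.
Qed.

Lemma card_nth (T : eqType) (x0 : T) (s : seq T) (P : pred T) :
  #|[pred l : 'I_(size s) | P (nth x0 s l)]| = count P s.
Proof.
have H : [seq nth x0 s (val l) | l <- enum 'I_(size s)] = s.
  by rewrite -[RHS](mkseq_nth x0) /mkseq -val_enum_ord -map_comp.
rewrite -[in RHS]H count_map -size_filter cardE enumT.
by congr size; rewrite /enum_mem -enumT; apply: eq_filter => l.
Qed.

Definition positive_by (alpha : R) n (M : 'M[R]_n) := forall v : 'cV[R]_n,
  alpha * \sum_i v i 0 ^+ 2 <= \sum_i v i 0 * (M *m v) i 0.

Lemma positive_by_det (alpha : R) n (M : 'M[R]_n) : 0 < alpha -> positive_by alpha M ->
  \det M != 0.
Proof.
move=> a0 h; apply/negP => /eqP; rewrite -det_tr => /eqP/det0P[v v0 vM].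
have Mv : M *m v^T = 0 by rewrite -[M]trmxK -trmx_mul vM trmx0.
have := h v^T; rewrite [leRHS]big1 => [|i _]; last by rewrite Mv [X in _ * X]mxE mulr0.
rewrite pmulr_rle0// => hv; move/negP: v0; apply; apply/eqP/rowP => i; rewrite mxE.
apply/eqP; rewrite -sqrf_eq0 eq_le sqr_ge0 andbT.
apply: le_trans hv; rewrite (bigD1 i)//= !mxE lerDl.
by apply: sumr_ge0 => j _; rewrite sqr_ge0.
Qed.

(** alpha |x|^2 <= <x, M x> <= (alpha/2) |x|^2 + |M x|^2 / (2 alpha), the last step because (alpha s
    - t)^2 >= 0. *)
Lemma positive_by_inv (alpha : R) n (M : 'M[R]_n) (x : 'cV[R]_n) : 0 < alpha -> positive_by alpha M ->
  alpha ^+ 2 * \sum_i x i 0 ^+ 2 <= \sum_i (M *m x) i 0 ^+ 2.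
Proof.
move=> a0 h; have := h x.
have : \sum_i x i 0 * (M *m x) i 0 <=
    alpha / 2 * \sum_i x i 0 ^+ 2 + (2 * alpha)^-1 * \sum_i (M *m x) i 0 ^+ 2.
  rewrite !big_distrr /= -big_split /=; apply: ler_sum => i _.
  set s := x i 0; set t := (M *m x) i 0.
  have -> : alpha / 2 * s ^+ 2 + (2 * alpha)^-1 * t ^+ 2 =
      s * t + (alpha * s - t) ^+ 2 / (2 * alpha) by field; rewrite gt_eqF.
  by rewrite lerDl divr_ge0 ?sqr_ge0// mulr_ge0// ltW.
set X := \sum_i _ ^+ 2; set D := \sum_i _ ^+ 2; set Y := \sum_i _ => h1 h2.
have : alpha / 2 * X <= (2 * alpha)^-1 * D by lra.
rewrite -(ler_pM2l (mulr_gt0 (ltr0n _ 2) a0 : 0 < 2 * alpha)).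
by rewrite mulVKf ?gt_eqF ?mulr_gt0// expr2 => h3; lra.
Qed.

(* With M the matrix of [pr] on the window, a point y is coded by the class of
   floor (M y) modulo M Z^n, by the quantized fractional parts of M y at the
   boundary, and by the sparse set of coordinates where the difference to the
   representative of its class is not close to an integer. *)
Lemma separated_upper (alpha eps : R) (Kw : seq G) :
  0 < alpha -> 0 < eps -> 1%g \in Kw -> uniq Kw ->
  exists (K : seq G) (q1 q : nat), forall n (e : 'I_n -> G), injective e ->
    positive_by alpha (mat pr e e) ->
    forall (I : finType) (y : I -> G -> R), (forall i, lop_int pr (y i)) ->
      sep (window e Kw) eps y -> forall x : R, 0 < x <= 1 ->
      #|I|%:R * x ^+ (2 * bd e K) <=
      `|\det (mat pr e e)| * q1.+1%:R ^+ bd e K * (1 + q.+1%:R * x) ^+ (n + bd e K).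
Proof.
move=> a0 eps0 K1 uKw.
(* Two points within theta of a common representative modulo Z are within eps / 2 of each other. *)
pose theta := eps / 4; have th0 : 0 < theta by rewrite divr_gt0.
have at0 : 0 <= alpha * theta by apply: mulr_ge0; exact: ltW.
have natgt (z : R) : exists q : nat, z < q.+1%:R.
  exists `|Num.ceil z|%N; apply: le_lt_trans (Num.Theory.ceil_ge _) _.
  apply: (@le_lt_trans _ _ (`|Num.ceil z|%N)%:R); last by rewrite ltr_nat.
  by rewrite natr_absz ler_int ler_norm.
(* 1/(q1 + 1) is below alpha theta, an error in M z that [positive_by_inv] converts into theta per
   coordinate; 1/(q + 1) is below eps, so that equal quantized values contradict separation. *)
have [q1 hq1] := natgt (alpha * theta)^-1.
have [q hq] := natgt eps^-1.
pose Ks := undup [seq s.2 | s <- p].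
exists (undup (Kw ++ Ks)), q1, q => n e ie pos I y0 y0int y0sep x /andP[x0 x1].
set K := undup _.
have bKs : (bd e Ks <= bd e K)%N.
  by apply: bd_sub (undup_uniq _) => k kK; rewrite mem_undup mem_cat kK orbT.
have bKw : (bd e Kw <= bd e K)%N.
  by apply: bd_sub => // k kK; rewrite mem_undup mem_cat kK.
pose P := window e Kw; pose N := size P.
have uP : uniq P by exact: undup_uniq.
pose o := size [seq g <- P | g \notin codom e].
have NE : N = (n + o)%N by rewrite /N /P size_window.
have oK : (o <= bd e K)%N by apply: leq_trans bKw; exact: size_window_out.
(* At an index outside [B] the row of M sees the whole support of f, so that (M y)_j is a value of
   [lop pr y], an integer, and has no fractional part. *)
pose B := [pred j | has (fun k => (e j * k)%g \notin codom e) Ks].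
have BK : (#|B| <= bd e K)%N by apply: leq_trans bKs; exact: bd_has.
pose y i g := y0 i g - (Num.floor (y0 i g))%:~R.
have y01 i g : 0 <= y i g < 1 by exact: frac_part.
have yint i : lop_int pr (y i).
  move=> g; have -> : lop pr (y i) g = lop pr (y0 i) g - lop pr (fun h => (Num.floor (y0 i h))%:~R) g.
    by rewrite /y lopB.
  by apply: rpredB; [exact: y0int|rewrite lop_intr; exact: intr_int].
have ysep : sep P eps y.
  move=> i j /y0sep[g gP hg]; exists g => // m.
  have := hg (m + Num.floor (y0 i g) - Num.floor (y0 j g)); rewrite rmorphB rmorphD /=.
  by congr (_ <= `|_|); rewrite /y; ring.
pose PR := mat pr e e.
pose v i : 'cV[R]_n := \col_j y i (e j).
pose t i := PR *m v i.
have tint i j : j \notin B -> t i j 0 \is a Num.int.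
  rewrite inE -all_predC => /allP jB; rewrite /t mat_mul.
  rewrite (_ : lop pr _ _ = lop pr (y i) (e j)); first exact: yint.
  rewrite /lop !big_seq; apply: eq_bigr => s sp; congr (_ * _).
  have : s.2 \in Ks.
    rewrite mem_undup; move: sp => /mapP[s' s'p ->] /=; exact: map_f.
  by move=> /jB /=; rewrite negbK => /codomP[l ->]; rewrite extE// mxE.
pose u i : 'cV[int]_n := \col_j Num.floor (t i j 0).
pose d i j := t i j 0 - (Num.floor (t i j 0))%:~R.
have d01 i j : 0 <= d i j < 1 by exact: frac_part.
have d0 i j : j \notin B -> d i j = 0.
  move=> /(tint i) /intrP[m tm]; rewrite /d tm Num.Theory.intrKfloor subrr//.
have dn0 : \det (mat p e e) != 0.
  have := positive_by_det a0 pos; rewrite -map_mat det_map_mx intr_eq0 //.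
have [Kt [kap [cardK _ kapE]]] := lattice_classes dn0.
pose T1 := (Kt * {ffun 'I_#|B| -> 'I_q1.+1})%type.
pose c1 i : T1 := (kap (u i), [ffun b => qz q1 (d i (enum_val b))]).
pose rep i := odflt i [pick i' | c1 i' == c1 i].
have c1rep i : c1 (rep i) = c1 i.
  by rewrite /rep; case: pickP => [i' /eqP//|/(_ i)]; rewrite eqxx.
have repE i i' : c1 i = c1 i' -> rep i = rep i'.
  move=> h; rewrite /rep h; case: pickP => // /(_ i'); by rewrite eqxx.
pose close i i' g := `[< exists m : int, `|y i g - y i' g - m%:~R| <= theta >].
(* If i and i' share the code [c1], some integral m makes z = v i - v i' - m satisfy M z = d i - d
   i', which vanishes off [B] and is at most alpha theta on it. Hence |z|^2 <= #|B| theta^2, and at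
   most #|B| coordinates of z reach theta. *)
have few i i' : c1 i = c1 i' -> (#|[pred j | ~~ close i i' (e j)]| <= #|B|)%N.
  move=> [kE /ffunP dE].
  have [m um] := (kapE (u i) (u i')).1 kE.
  pose z := v i - v i' - map_mx intr m.
  have PRz j : (PR *m z) j 0 = d i j - d i' j.
    rewrite /z !mulmxBr -/(t i) -/(t i') /PR -map_mat -map_mxM -um.
    have BR (X Y : 'cV[R]_n) : (X - Y) j 0 = X j 0 - Y j 0 by rewrite !mxE.
    have BZ (X Y : 'cV[int]_n) : (X - Y) j 0 = X j 0 - Y j 0 by rewrite !mxE.
    have uE i1 : u i1 j 0 = Num.floor (t i1 j 0) by rewrite /u mxE.
    rewrite !BR [X in _ - X]mxE BZ !uE rmorphB /d /=.
    have rr (b1 b2 b3 b4 : R) : b1 - b2 - (b3 - b4) = b1 - b3 - (b2 - b4) by ring.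
    exact: rr.
  have dz j : (d i j - d i' j) ^+ 2 <= (j \in B)%:R * (alpha * theta) ^+ 2.
    have [jB|jB] := boolP (j \in B); last by rewrite !d0// subrr expr0n mul0r.
    rewrite mul1r -real_normK ?num_real// ler_sqr ?nnegrE//.
    have := dE (enum_rank_in jB j); rewrite !ffunE enum_rankK_in// => /qzP.
    move=> /(_ (d01 _ _) (d01 _ _)) H.
    have q10 : 0 < q1.+1%:R :> R by rewrite ltr0n.
    rewrite -(ler_pM2r q10); apply: le_trans H _.
    rewrite -ler_pdivrMl ?mulr_gt0// mulr1; exact: ltW.
  have H : alpha ^+ 2 * \sum_j z j 0 ^+ 2 <= alpha ^+ 2 * (#|B|%:R * theta ^+ 2).
    apply: le_trans (positive_by_inv _ a0 pos) _.
    under eq_bigr do rewrite PRz.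
    apply: le_trans (ler_sum _ (fun j _ => dz j)) _.
    by rewrite -big_distrl /= -natr_sum -big_mkcond sum1_card exprMn mulrCA.
  have cz j : ~~ close i i' (e j) -> theta ^+ 2 <= z j 0 ^+ 2.
    move=> /asboolPn h; rewrite -[leRHS]real_normK ?num_real// ler_sqr ?nnegrE// ?(ltW th0)//.
    rewrite leNgt; apply/negP => h'; apply: h; exists (m j 0).
    by move: h'; rewrite !mxE => /ltW.
  rewrite -(ler_nat R) -(ler_pM2r (exprn_gt0 2 th0)).
  rewrite ler_pM2l ?exprn_gt0// in H; apply: le_trans H.
  rewrite -sum1_card natr_sum big_distrl /=.
  apply: (@le_trans _ _ (\sum_(j in [pred j | ~~ close i i' (e j)]) z j 0 ^+ 2)).
    by apply: ler_sum => j; rewrite inE mul1r => /cz.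
  rewrite [leRHS](bigID [pred j | ~~ close i i' (e j)]) /= lerDl.
  by apply: sumr_ge0 => j _; rewrite sqr_ge0.
(* [None] stands for a point of Phi where y i is close to its representative; elsewhere the
   quantized value is stored. The exceptions are the window outside Phi and at most #|B| points of
   Phi, whence twice the boundary size. *)
pose code2 i : {ffun 'I_N -> option 'I_q.+1} :=
  [ffun l : 'I_N => let g := nth 1%g P l in
    if (g \in codom e) && close i (rep i) g then None else Some (qz q (y i g))].
have code2b i : (#|[pred l | code2 i l != None]| <= 2 * bd e K)%N.
  rewrite mul2n -addnn.
  pose b1 := fun g => g \notin codom e.
  pose b2 := fun g => (g \in codom e) && ~~ close i (rep i) g.
  have -> : #|[pred l | code2 i l != None]| = count (predU b1 b2) P.
    rewrite -(card_nth 1%g); apply: eq_card => l; rewrite !inE ffunE /= /b1 /b2.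
    by case: (_ \in codom e); case: (close _ _ _).
  have : (count (predU b1 b2) P <= count b1 P + count b2 P)%N.
    by rewrite -count_predUI leq_addr.
  move=> /leq_trans; apply; apply: leq_add; first by rewrite -size_filter.
  apply: leq_trans BK; apply: leq_trans (few i (rep i) (esym (c1rep i))).
  rewrite -size_filter cardE -(size_map e).
  apply: uniq_leq_size; first by rewrite filter_uniq.
  move=> g; rewrite mem_filter => /andP[/andP[/codomP[j ->] h] _].
  by apply: map_f; rewrite mem_enum inE.
pose S := [pred c : {ffun 'I_N -> option 'I_q.+1} | #|[pred l | c l != None]| <= 2 * bd e K]%N.
have cardI : (#|I| <= #|S| * #|{: T1}|)%N.
  apply: (@codedP _ _ _ code2 c1) => [i|i i' /ffunP c2E c1E]; first by rewrite inE.
  apply: contrapT => /ysep[g gP hg].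
  have lN : (index g P < N)%N by rewrite index_mem.
  have := c2E (Ordinal lN); rewrite !ffunE /= nth_index// (repE _ _ c1E).
  case: ifP => [/andP[_ /asboolP[m hm]]|_]; case: ifP => [/andP[_ /asboolP[m' hm']]|_] //.
    move=> _; have := hg (m - m'); rewrite leNgt => /negP; apply.
    rewrite rmorphB /= (_ : _ - _ = (y i g - y (rep i') g - m%:~R) - (y i' g - y (rep i') g - m'%:~R)).
      apply: le_lt_trans (ler_normB _ _) _; apply: le_lt_trans (lerD hm hm') _.
      by rewrite /theta; move: eps0; lra.
    by ring.
  move=> [] /(qzP (y01 _ _) (y01 _ _)) H; have := hg 0; rewrite subr0 leNgt => /negP; apply.
  have q0 : 0 < q.+1%:R :> R by rewrite ltr0n.
  rewrite -(ltr_pM2r q0); apply: le_lt_trans H _.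
  by rewrite -ltr_pdivrMl// mulr1.
rewrite card_prod card_ffun !card_ord cardK in cardI.
have -> : `|\det (mat pr e e)| = (absz (\det (mat p e e)))%:R.
  by rewrite -map_mat det_map_mx natr_absz intr_norm.
apply: (@le_trans _ _ ((#|S| * (`|\det (mat p e e)| * q1.+1 ^ #|B|))%N%:R * x ^+ (2 * bd e K))).
  by rewrite ler_wpM2r ?ler_nat// exprn_ge0// ltW.
rewrite natrM mulrAC mulrC; apply: ler_pM; rewrite ?ler0n ?mulr_ge0 ?exprn_ge0 ?ler0n ?(ltW x0)//.
  by rewrite natrM ler_wpM2l// natrX ler_weXn2l// ler1n.
apply: le_trans (card_sparse _ _ _ _) _; first by rewrite x0.
by rewrite ler_weXn2l ?NE ?leq_add2l// lerDl mulr_ge0// ltW.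
Qed.

End UpperBound.

(** * Traces and determinants on finite windows *)

Section SymSpectrum.
Variable R : realType.

(** Powers as iterates, to be matched with [iter k (lop h)]; the case n = 0 is included. *)
Definition mxpow (K : nzRingType) n (M : 'M[K]_n) k : 'M[K]_n := iter k (mulmx M) 1%:M.

Lemma mxpow_map (K L : nzRingType) (phi : {rmorphism K -> L}) n (M : 'M[K]_n) k :
  map_mx phi (mxpow M k) = mxpow (map_mx phi M) k.
Proof. by elim: k => [|k IH]; rewrite /= ?map_mx1// map_mxM IH. Qed.

Lemma mxpow_conj (F : fieldType) n (P D : 'M[F]_n) k : P \in unitmx ->
  mxpow (invmx P *m D *m P) k = invmx P *m mxpow D k *m P.
Proof.
move=> uP; elim: k => [|k IH]; first by rewrite /= mulmx1 mulVmx.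
by rewrite /= IH !mulmxA mulmxK.
Qed.

Lemma mxpow_diag (F : fieldType) n (d : 'rV[F]_n) k :
  mxpow (diag_mx d) k = diag_mx (\row_i d 0 i ^+ k).
Proof.
elim: k => [|k IH] /=.
  have -> : \row_i d 0 i ^+ 0 = const_mx 1 by apply/rowP => i; rewrite !mxE expr0.
  by rewrite diag_const_mx.
by rewrite IH mulmx_diag; congr diag_mx; apply/rowP => i; rewrite !mxE exprS.
Qed.

Lemma mxtrace_pow_conj (F : fieldType) n (A P : 'M[F]_n) d k : P \in unitmx ->
  A = invmx P *m diag_mx d *m P -> \tr (mxpow A k) = \sum_i d 0 i ^+ k.
Proof.
move=> uP ->; rewrite mxpow_conj// mxpow_diag mxtrace_mulC mulmxA mulmxV// mul1mx.
by rewrite mxtrace_diag; apply: eq_bigr => i _; rewrite mxE.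
Qed.

(** Over R[i] a real symmetric matrix is hermitian, hence diagonalizable with real eigenvalues. Real
    eigenvectors come from the vanishing of det (M - lam i) over R. *)
Lemma sym_spectrum n (M : 'M[R]_n) : M^T = M -> exists lam : 'I_n -> R,
  [/\ \det M = \prod_i lam i, forall k, \tr (mxpow M k) = \sum_i lam i ^+ k &
      forall i, exists2 v : 'cV[R]_n, v != 0 & M *m v = lam i *: v].
Proof.
move=> MT; pose rc : {rmorphism R -> R[i]} := real_complex R.
pose A : 'M[R[i]]_n := map_mx rc M.
have Asym : A \is symmetricmx.
  by apply/is_hermitianmxP; rewrite /A /= map_mx_id// scale1r map_trmx MT.
have Areal : A \is a realmx.
  by apply/mxOverP => i j; rewrite mxE; apply/complex_realP; exists (M i j).
have Aherm := realsym_hermsym Asym Areal.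
have [P [d [uP AE dreal]]] : exists P d,
    [/\ P \in unitmx, A = invmx P *m diag_mx d *m P & forall j, d 0 j \is Num.real].
  exists (spectralmx A), (spectral_diag A); split; first exact: spectral_unit.
    by have /orthomx_spectralP := hermitian_normalmx Aherm.
  by move=> j; have /mxOverP := hermitian_spectral_diag_real Aherm; apply.
pose lam i := complex.Re (d 0 i).
have dE i : d 0 i = rc (lam i) by rewrite /lam -[LHS]RRe_real.
have detE z : \det (A - z%:M) = \prod_i (d 0 i - z).
  have -> : A - z%:M = invmx P *m (diag_mx d - z%:M) *m P.
    by rewrite mulmxBr mulmxBl -AE mul_mx_scalar -scalemxAl mulVmx// scalemx1.
  rewrite !det_mulmx mulrAC -det_mulmx mulVmx// det1 mul1r.
  have -> : diag_mx d - z%:M = diag_mx (\row_i (d 0 i - z)).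
    by apply/matrixP => i j; rewrite !mxE mulrnBl.
  by rewrite det_diag; apply: eq_bigr => i _; rewrite mxE.
exists lam; split.
- apply: (@complexI R); rewrite -[LHS]/(rc _) -[RHS]/(rc _) -det_map_mx rmorph_prod /=.
  have E := detE 0; rewrite raddf0 subr0 in E; rewrite -[X in \det X]/A E.
  by apply: eq_bigr => i _; rewrite subr0 dE.
- move=> k; apply: (@complexI R); rewrite -[LHS]/(rc _) -[RHS]/(rc _).
  rewrite -trace_map_mx mxpow_map -/A rmorph_sum /=.
  rewrite (mxtrace_pow_conj k uP AE).
  by apply: eq_bigr => i _; rewrite dE -rmorphXn.
- move=> i.
  have /eqP : \det (M^T - (lam i)%:M) = 0.
    rewrite MT; apply: (@complexI R); rewrite -[LHS]/(rc _) -[RHS]/(rc _) -det_map_mx.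
    rewrite map_mxB map_scalar_mx rmorph0 -/A detE (bigD1 i)//= dE subrr mul0r //.
  move=> /det0P[v v0]; rewrite mulmxBr mul_mx_scalar => /eqP; rewrite subr_eq0 => /eqP vM.
  exists v^T; first by rewrite trmx_eq0.
  by rewrite -{1}[M]trmxK -trmx_mul vM linearZ.
Qed.

End SymSpectrum.

Section LogPoly.
Variable R : realType.

(** P is the Taylor polynomial of ln at be, in powers of Q = 1 - x / be. The difference P - ln
    vanishes at be and has derivative -Q^M / z, so by the mean value theorem it is at most r^M (be -
    al) / al with r = 1 - al / be < 1. *)
Lemma ln_poly (al be eta : R) : 0 < al -> al <= be -> 0 < eta ->
  exists P : {poly R}, forall x, al <= x <= be -> `|P.[x] - ln x| <= eta.
Proof.
move=> al0 ab eta0; have be0 : 0 < be by exact: lt_le_trans ab.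
pose r := 1 - al / be.
have r01 : 0 <= r < 1.
  by rewrite /r subr_ge0 ler_pdivrMr// mul1r ab /= ltrBlDr ltrDl divr_gt0.
have [M hM] : exists M, r ^+ M * ((be - al) / al) <= eta.
  have c0 : 0 < (be - al) / al + 1 by rewrite ltr_wpDl// divr_ge0 ?subr_ge0// ltW.
  have [M hM] := geo_lt r01 (divr_gt0 eta0 c0); exists M.
  rewrite ltr_pdivlMr// in hM; apply: le_trans (ltW hM).
  by rewrite ler_wpM2l ?lerDl// exprn_ge0//; case/andP: r01.
pose Q : {poly R} := 1 - be^-1 *: 'X.
pose P : {poly R} := (ln be)%:P - \sum_(k < M) (k.+1%:R)^-1 *: Q ^+ k.+1.
have Qx x : Q.[x] = 1 - x / be by rewrite /Q !hornerE mulrC.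
exists P => x /andP[ax xb].
have x0 : 0 < x by exact: lt_le_trans ax.
pose f := fun z => P.[z] - ln z.
have dP z : 0 < z -> P^`().[z] = (1 - Q.[z] ^+ M) / z.
  move=> z0; rewrite /P derivB derivC sub0r hornerN raddf_sum horner_sum.
  transitivity (be^-1 * \sum_(k < M) Q.[z] ^+ k).
    rewrite -sumrN big_distrr /=; apply: eq_bigr => k _.
    rewrite derivZ deriv_exp hornerZ /=.
    have -> : Q^`() = (- be^-1)%:P.
      by rewrite /Q derivB derivC derivZ derivX sub0r alg_polyC polyCN.
    rewrite hornerMn hornerM hornerC horner_exp -[_ * _ *+ k.+1]mulr_natl.
    have : k.+1%:R != 0 :> R by rewrite pnatr_eq0.
    move: (k.+1%:R : R) => c c0; field.
    by rewrite c0 gt_eqF.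
  have -> : 1 - Q.[z] ^+ M = (1 - Q.[z]) * \sum_(k < M) Q.[z] ^+ k.
    by rewrite -opprB subrX1 -mulNr opprB.
  by rewrite Qx; field; rewrite !gt_eqF.
have df z : z \in `]x, be[ -> is_derive z 1 f (- Q.[z] ^+ M / z).
  rewrite in_itv /= => /andP[xz zb]; have z0 : 0 < z by exact: lt_trans xz.
  have -> : - Q.[z] ^+ M / z = P^`().[z] - z^-1 by rewrite dP//; field; rewrite gt_eqF.
  exact: is_deriveB (is_derive_poly P z) (is_derive1_ln z0).
have cf : {within `[x, be], continuous f}.
  apply: derivable_within_continuous => z; rewrite in_itv /= => /andP[xz zb].
  have z0 : 0 < z by exact: lt_le_trans xz.
  apply: derivableB; first exact: derivable_horner.
  by apply: ex_derive; exact: is_derive1_ln.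
have [c] := MVT_segment xb df cf.
rewrite in_itv /= => /andP[xc cb].
have c0 : 0 < c by exact: lt_le_trans xc.
have -> : f be = 0.
  rewrite /f /P hornerD hornerC hornerN horner_sum big1 ?subr0 ?subrr// => k _.
  by rewrite hornerZ horner_exp Qx divff ?gt_eqF// subrr expr0n mulr0.
rewrite sub0r => fE; rewrite -[X in `|X|]/(f x) -normrN fE normrM.
apply: le_trans hM; rewrite mulNr normrN normrM normfV (gtr0_norm c0) -mulrA.
have Qc : 0 <= Q.[c] <= r.
  rewrite Qx /r subr_ge0 ler_pdivrMr// mul1r cb lerB//= ler_pM2r ?invr_gt0//.
  exact: le_trans xc.
have /andP[Q0 Qr] := Qc.
rewrite normrX (ger0_norm Q0).
apply: ler_pM; rewrite ?exprn_ge0// ?mulr_ge0 ?invr_ge0 ?(ltW c0)//.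
  by rewrite lerXn2r ?nnegrE// (le_trans Q0).
rewrite ger0_norm ?subr_ge0// mulrC; apply: ler_pM; rewrite ?subr_ge0 ?invr_ge0 ?(ltW c0)//.
  by rewrite lerB.
by rewrite lef_pV2 ?posrE//; exact: le_trans xc.
Qed.

End LogPoly.

(** * Traces of powers of finite sections *)

Section Szego.
Variables (R : realType) (G : groupType) (h : seq (R * G)).

Lemma iter_lop_shift k0 k (x g : G) :
  iter k (lop h) (dl R (k0 * x)%g) (k0 * g)%g = iter k (lop h) (dl R x) g.
Proof.
elim: k g => [|k IH] g /=; first by rewrite /dl (inj_eq (mulgI k0)).
by rewrite -lop_shift; apply: eq_lop => y; exact: IH.
Qed.

Fixpoint reach k : seq G :=
  if k is k'.+1 then [seq (x * s.2^-1)%g | x <- reach k', s <- h] else [:: 1%g].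

Lemma iter_lop_reach k (x g : G) : iter k (lop h) (dl R x) g != 0 ->
  exists2 z, z \in reach k & g = (x * z)%g.
Proof.
elim: k g => [|k IH] g /=.
  rewrite /dl; case: (g =P x) => [->|]; last by rewrite eqxx.
  by exists 1%g; rewrite ?inE ?mulg1.
rewrite /lop big_seq => gn0.
have [s sh fs] : exists2 s, s \in h & iter k (lop h) (dl R x) (g * s.2)%g != 0.
  apply: contrapT => no; move/negP: gn0; apply; apply/eqP; apply: big1 => s sh.
  case: (iter k (lop h) (dl R x) (g * s.2)%g =P 0) => [->|/eqP n0]; first by rewrite mulr0.
  by case: no; exists s.
have [z zk gz] := IH _ fs; exists (z * s.2^-1)%g.
  by apply/allpairsP; exists (z, s).
by rewrite mulgA -gz mulgK.
Qed.

Variables (n : nat) (e : 'I_n -> G).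
Hypothesis ie : injective e.
Let M := mat h e e.

Lemma mat_mulm p (X : 'M[R]_(n, p)) l i :
  (M *m X) l i = lop h (ext e (fun j => X j i)) (e l).
Proof. by rewrite mxE /ext lop_lin; apply: eq_bigr => j _; rewrite mxE mulrC. Qed.

(** Compression to the window commutes with the iteration as long as the iterates that started at e
    i, supported in e i times [reach j], have not left the window. *)
Lemma mxpow_entry k i :
  (forall j z, (j < k)%N -> z \in reach j -> (e i * z)%g \in codom e) ->
  forall l, mxpow M k l i = iter k (lop h) (dl R (e i)) (e l).
Proof.
elim: k => [|k IH] hk l; first by rewrite /= mxE /dl (inj_eq ie).
rewrite /= mat_mulm; apply: eq_lop => g.
have E : (fun j => mxpow M k j i) = fun j => iter k (lop h) (dl R (e i)) (e j).
  by apply/funext => j; apply: IH => j' z jk; apply: hk; rewrite ltnS ltnW.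
rewrite E; apply: ext_res => // x xe; apply/eqP; apply: contrapT => /negP.
move=> /iter_lop_reach[z zk xz]; move/negP: xe; apply; rewrite xz.
by apply: (hk k).
Qed.

Lemma mxpow_le k l i : `|mxpow M k l i| <= nrm h ^+ k.
Proof.
elim: k l i => [|k IH] l i; first by rewrite expr0 mxE; case: (_ == _); rewrite ?normr1 ?normr0 ?ler01.
rewrite /= mat_mulm exprS; apply: lop_le => g.
have [/codomP[j ->]|ge] := boolP (g \in codom e); first by rewrite extE//; exact: IH.
by rewrite ext_out// normr0 exprn_ge0// nrm_ge0.
Qed.

Lemma iter_lop_le k g : `|iter k (lop h) (dl R 1%g) g| <= nrm h ^+ k.
Proof.
elim: k g => [|k IH] g; first by rewrite expr0 /= /dl normr_nat; case: (_ == _); rewrite ?ler01.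
by rewrite /= exprS; exact: lop_le.
Qed.

(** By translation invariance every diagonal entry whose iterates stay in the window equals the one
    at the identity. The others are counted by [bd] and bounded through the l^1 norm. *)
Lemma trace_pow k : `|\tr (mxpow M k) - n%:R * iter k (lop h) (dl R 1%g) 1%g|
   <= 2 * nrm h ^+ k * (bd e (undup (flatten [seq reach j | j <- iota 0 k])))%:R.
Proof.
set K := undup _.
have -> : \tr (mxpow M k) - n%:R * iter k (lop h) (dl R 1%g) 1%g =
    \sum_(i < n) (mxpow M k i i - iter k (lop h) (dl R 1%g) 1%g).
  by rewrite sumrB sumr_const card_ord mulr_natl.
apply: le_trans (ler_norm_sum _ _ _) _.
pose bad := [pred j | has (fun k => (e j * k)%g \notin codom e) K].
apply: (@le_trans _ _ (\sum_(i < n) 2 * nrm h ^+ k * (bad i)%:R)).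
  apply: ler_sum => i _; have [bi|] := boolP (bad i).
    rewrite mulr1 mulr_natl mulr2n; apply: le_trans (ler_normB _ _) _.
    by apply: lerD; [exact: mxpow_le|exact: iter_lop_le].
  rewrite /bad /= -all_predC => /allP good; rewrite mulr0 mxpow_entry.
    by have := iter_lop_shift (e i) k 1 1; rewrite !mulg1 => ->; rewrite subrr normr0.
  move=> j z jk zj; have := good z; rewrite /= negbK; apply.
  rewrite mem_undup; apply/flatten_mapP; exists j => //.
  by rewrite mem_iota.
rewrite -big_distrr /= ler_wpM2l ?mulr_ge0 ?exprn_ge0 ?nrm_ge0//.
rewrite -natr_sum ler_nat; apply: leq_trans (bd_has e K).
by rewrite -sum1_card [X in (_ <= X)%N]big_mkcond /=; apply: leq_sum => i _; rewrite inE; case: (has _ _).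
Qed.

End Szego.

Section SzegoLog.
Variables (R : realType) (G : groupType) (h : seq (R * G)).

(** The von Neumann trace of P(h), that is, its coefficient at the identity, computed without
    operators on l^2. *)
Definition poly_tr (P : {poly R}) : R :=
  \sum_(k < size P) P`_k * iter k (lop h) (dl R 1%g) 1%g.

Lemma ln_prod (I : Type) (r : seq I) (F : I -> R) : (forall i, 0 < F i) ->
  ln (\prod_(i <- r) F i) = \sum_(i <- r) ln (F i).
Proof.
move=> F0; elim: r => [|i r IH]; first by rewrite !big_nil ln1.
rewrite !big_cons lnM ?IH// posrE ?F0//.
by apply: prodr_gt0 => j _; exact: F0.
Qed.

(* tr P(M) = \sum_i P(lambda_i) is compared with ln (\det M) eigenvalue by
   eigenvalue, and with n [poly_tr P] entry by entry, where only the diagonal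
   entries near the boundary differ. *)
Lemma szego (P : {poly R}) (al be eta : R) : 0 < al ->
  (forall x, al <= x <= be -> `|P.[x] - ln x| <= eta) ->
  exists (K : seq G) (C : R), 0 <= C /\ forall n (e : 'I_n -> G), injective e ->
    (mat h e e)^T = mat h e e ->
    (forall v : 'cV[R]_n, al * \sum_i v i 0 ^+ 2 <= \sum_i v i 0 * (mat h e e *m v) i 0
        <= be * \sum_i v i 0 ^+ 2) ->
    0 < \det (mat h e e) /\
    `|ln (\det (mat h e e)) - n%:R * poly_tr P| <= n%:R * eta + C * (bd e K)%:R.
Proof.
move=> al0 hP.
pose K0 k := undup (flatten [seq reach h j | j <- iota 0 k]).
pose K := undup (flatten [seq K0 k | k <- iota 0 (size P)]).
pose C := \sum_(k < size P) `|P`_k| * (2 * nrm h ^+ k).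
exists K, C; split.
  by apply: sumr_ge0 => k _; rewrite mulr_ge0// mulr_ge0// exprn_ge0// nrm_ge0.
move=> n e ie MT Mpos; set M := mat h e e.
have [lam [detE trE eig]] := sym_spectrum MT.
have lamb i : al <= lam i <= be.
  have [v v0 Mv] := eig i.
  have v2 : 0 < \sum_i v i 0 ^+ 2.
    rewrite lt_neqAle sumr_ge0 ?andbT => [|j _]; last exact: sqr_ge0.
    apply/negP => /eqP/esym v20; move/negP: v0; apply; apply/eqP/colP => j.
    rewrite mxE; apply/eqP; rewrite -sqrf_eq0 eq_le sqr_ge0 andbT -v20.
    by rewrite (bigD1 j)//= lerDl; apply: sumr_ge0 => l _; rewrite sqr_ge0.
  have := Mpos v.
  have -> : \sum_i v i 0 * (M *m v) i 0 = lam i * \sum_i v i 0 ^+ 2.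
    by rewrite big_distrr /=; apply: eq_bigr => j _; rewrite /M Mv mxE; ring.
  by rewrite !ler_pM2r.
have lam0 i : 0 < lam i by case/andP: (lamb i) => + _; exact: lt_le_trans.
have det0 : 0 < \det M by rewrite detE; apply: prodr_gt0 => i _.
split=> //; rewrite {1}detE ln_prod//.
rewrite (_ : _ - _ = \sum_i (ln (lam i) - P.[lam i]) +
    \sum_(k < size P) P`_k * (\tr (mxpow M k) - n%:R * iter k (lop h) (dl R 1%g) 1%g)); last first.
  rewrite sumrB; under [X in _ = _ + X]eq_bigr do rewrite mulrBr.
  rewrite [X in _ = _ + X]sumrB addrA.
  have -> : \sum_(k < size P) P`_k * \tr (mxpow M k) = \sum_i P.[lam i].
    under [RHS]eq_bigr do rewrite horner_coef.
    rewrite exchange_big /=; apply: eq_bigr => k _.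
    by rewrite trE big_distrr.
  rewrite subrK; congr (_ - _); rewrite /poly_tr big_distrr /=.
  by apply: eq_bigr => k _; rewrite mulrCA.
apply: le_trans (ler_normD _ _) _; apply: lerD.
  apply: le_trans (ler_norm_sum _ _ _) _.
  rewrite -[n in leRHS]card_ord mulr_natl -sumr_const; apply: ler_sum => i _.
  by rewrite distrC; exact: hP.
apply: le_trans (ler_norm_sum _ _ _) _; rewrite /C big_distrl /=.
apply: ler_sum => k _; rewrite normrM -mulrA ler_wpM2l//.
apply: le_trans (trace_pow h ie k) _.
rewrite ler_wpM2l ?mulr_ge0 ?exprn_ge0 ?nrm_ge0// ler_nat.
apply: bd_sub (undup_uniq _) => x xk; rewrite mem_undup; apply/flatten_mapP.
by exists (k : nat) => //; rewrite mem_iota add0n ltn_ord.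
Qed.

End SzegoLog.

(** * The Hilbert space l^2 *)

Section L2Space.
Local Open Scope complex_scope.
Variables (R : realType) (G : groupType).
Local Notation H := (l2 R G).
Local Notation Re := complex.Re.
Local Notation Im := complex.Im.
Implicit Types (u v w : H) (A B : H -> H).

(** Estimates are made in l^2 as a real Hilbert space; [innerE] recovers the complex inner
    product. *)
Definition ip u v : R := Re (inner u v).
Definition nm u : R := l2norm u.

Lemma l2P (f : G -> R[i]^o) :
  f \in @square_summable R G <-> exists C, l1bound (fun g => normsq (f g)) C.
Proof. exact: in_L1P. Qed.

Lemma normsq_l1 u : exists C, l1bound (fun g => normsq (u g)) C.
Proof. exact/l2P/l2_valP. Qed.

Lemma mul_l1 (a b : G -> R) C D : l1bound (fun g => a g ^+ 2) C ->
  l1bound (fun g => b g ^+ 2) D -> l1bound (fun g => a g * b g) (C + D).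
Proof.
move=> ha hb; apply: l1bound_dom (l1boundD ha hb) => g.
rewrite [leRHS]ger0_norm ?addr_ge0 ?sqr_ge0// normrM.
rewrite -(real_normK (num_real (a g))) -(real_normK (num_real (b g))).
by have := normr_ge0 (a g); have := normr_ge0 (b g); nra.
Qed.

Lemma ReIm_l1 u : exists C, l1bound (fun g => Re (u g) ^+ 2) C /\
  l1bound (fun g => Im (u g) ^+ 2) C.
Proof.
have [C h] := normsq_l1 u; exists C; split; apply: l1bound_dom h => g;
  rewrite !ger0_norm ?normsq_ge0 ?sqr_ge0// /normsq ?lerDl ?lerDr ?sqr_ge0//.
Qed.

Lemma ip_l1 u v : exists C,
  l1bound (fun g => Re (u g) * Re (v g) + Im (u g) * Im (v g)) C.
Proof.
have [C [h1 h2]] := ReIm_l1 u; have [D [h3 h4]] := ReIm_l1 v.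
by exists ((C + D) + (C + D)); apply: l1boundD; exact: mul_l1.
Qed.

Lemma ip_has_sum u v :
  has_sum (fun g => Re (u g) * Re (v g) + Im (u g) * Im (v g)) (ip u v).
Proof.
have [C h] := ip_l1 u v; apply: eq_has_sum (rsum_has_sum (C := C) _) => [g|].
  by case: (u g) (v g) => [a b] [c d] /=; ring.
move=> A; apply: le_trans (h A); apply: ler_sum => g _.
by case: (u g) (v g) => [a b] [c d] /=; rewrite mulrN opprK.
Qed.

Lemma ipE u v l :
  has_sum (fun g => Re (u g) * Re (v g) + Im (u g) * Im (v g)) l -> ip u v = l.
Proof. exact: has_sum_uniq (ip_has_sum u v). Qed.

Lemma l2D u v g : (u + v) g = (u g : R[i]) + v g. Proof. by []. Qed.
Lemma l2Z (c : R[i]) u g : (c *: u) g = c * u g. Proof. by []. Qed.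
Lemma l2N u g : (- u) g = - (u g : R[i]). Proof. by []. Qed.
Lemma l2_ext u v : (forall g, u g = v g) -> u = v.
Proof. by move=> h; apply: val_inj; apply/funext. Qed.

Lemma ReD (x y : R[i]) : Re (x + y) = Re x + Re y. Proof. by case: x y => ? ? []. Qed.
Lemma ImD (x y : R[i]) : Im (x + y) = Im x + Im y. Proof. by case: x y => ? ? []. Qed.
Lemma ReN (x : R[i]) : Re (- x) = - Re x. Proof. by case: x. Qed.
Lemma ImN (x : R[i]) : Im (- x) = - Im x. Proof. by case: x. Qed.
Lemma ReM (x y : R[i]) : Re (x * y) = Re x * Re y - Im x * Im y. Proof. by case: x y => ? ? []. Qed.
Lemma ImM (x y : R[i]) : Im (x * y) = Re x * Im y + Im x * Re y. Proof. by case: x y => ? ? []. Qed.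

Lemma ipDl u v w : ip (u + v) w = ip u w + ip v w.
Proof.
apply: ipE; apply: eq_has_sum (has_sumD (ip_has_sum u w) (ip_has_sum v w)) => g.
by rewrite l2D ReD ImD; ring.
Qed.

Lemma ipC u v : ip u v = ip v u.
Proof. by apply: ipE; apply: eq_has_sum (ip_has_sum v u) => g; ring. Qed.

Lemma ipDr u v w : ip w (u + v) = ip w u + ip w v.
Proof. by rewrite ipC ipDl !(ipC w). Qed.

Lemma ipZl (c : R) u v : ip (c%:C *: u) v = c * ip u v.
Proof.
apply: ipE; apply: eq_has_sum (has_sumZ c (ip_has_sum u v)) => g.
by rewrite l2Z ReM ImM /=; ring.
Qed.

Lemma ipZr (c : R) u v : ip u (c%:C *: v) = c * ip u v.
Proof. by rewrite ipC ipZl ipC. Qed.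

Lemma ipNl u v : ip (- u) v = - ip u v.
Proof.
apply: ipE; rewrite -mulN1r; apply: eq_has_sum (has_sumZ (-1) (ip_has_sum u v)) => g.
by rewrite l2N ReN ImN; ring.
Qed.

Lemma ipNr u v : ip u (- v) = - ip u v.
Proof. by rewrite ipC ipNl ipC. Qed.

Lemma ip0l v : ip 0 v = 0.
Proof. by have := ipZl 0 0 v; rewrite scaler0 mul0r. Qed.

Lemma ip_ge u (A : {fset G}) : \sum_(g <- A) normsq (u g) <= ip u u.
Proof.
have := has_sum_ge A (fun g => normsq_ge0 (u g)); apply.
by apply: eq_has_sum (ip_has_sum u u) => g; rewrite /normsq !expr2.
Qed.

Lemma ip_ge0 u : 0 <= ip u u.
Proof. by have := ip_ge u fset0; rewrite big_nil. Qed.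

Lemma ip_ge1 u g : normsq (u g) <= ip u u.
Proof. by have := ip_ge u [fset g]%fset; rewrite big_seq_fset1. Qed.

Lemma normsq_eq0 (z : R[i]) : normsq z = 0 -> z = 0.
Proof.
case: z => a b; rewrite /normsq /= => /eqP.
by rewrite paddr_eq0 ?sqr_ge0// !sqrf_eq0 => /andP[/eqP -> /eqP ->].
Qed.

Lemma ip_eq0 u : ip u u = 0 -> u = 0.
Proof.
move=> h; apply: l2_ext => g; apply: normsq_eq0; apply/eqP.
by rewrite eq_le normsq_ge0 andbT -h ip_ge1.
Qed.

Lemma innerE u v : inner u v = (ip u v +i* ip u ('i *: v))%C.
Proof.
rewrite /inner /csum; congr Complex.
have [C h] := ip_l1 u ('i *: v).
apply: (rsumE (C := C)) => [A|]; last first.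
  apply: eq_has_sum (ip_has_sum u ('i *: v)) => g.
  by rewrite l2Z; case: (u g) (v g) => [a b] [c d] /=; ring.
apply: le_trans (h A); apply: ler_sum => g _.
suff -> : Im (u g * (v g)^*) = Re (u g) * Re (('i *: v) g) + Im (u g) * Im (('i *: v) g) by exact: lexx.
by rewrite l2Z; case: (u g) (v g) => [a b] [c d] /=; ring.
Qed.

Lemma nmE u : nm u = Num.sqrt (ip u u). Proof. by []. Qed.
Lemma nm_ge0 u : 0 <= nm u. Proof. exact: sqrtr_ge0. Qed.
Lemma nm_sqr u : nm u ^+ 2 = ip u u. Proof. by rewrite sqr_sqrtr// ip_ge0. Qed.

Lemma quad_disc (a b c : R) : (forall t, 0 <= a + 2 * t * b + t ^+ 2 * c) -> b ^+ 2 <= a * c.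
Proof.
move=> h; have a0 : 0 <= a by have := h 0; rewrite mulr0 mul0r expr0n mul0r !addr0.
have [c0|c0] := eqVneq c 0.
  rewrite c0 mulr0; have [->|b0] := eqVneq b 0; first by rewrite expr0n.
  have := h (- (a + 1) / (2 * b)); rewrite c0 mulr0 addr0.
  have -> : 2 * (- (a + 1) / (2 * b)) * b = - (a + 1) by field; rewrite b0.
  lra.
have := h (- b / c).
have -> : a + 2 * (- b / c) * b + (- b / c) ^+ 2 * c = (a * c - b ^+ 2) / c by field; rewrite c0.
have cpos : 0 < c.
  rewrite lt_neqAle eq_sym c0 /= leNgt; apply/negP => cneg.
  pose t := a / (- c) + 1.
  have t1 : 1 <= t by rewrite lerDr divr_ge0// oppr_ge0 ltW.
  have tc : t * c = - a + c by rewrite /t; field; rewrite lt_eqF.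
  have : t ^+ 2 * c <= t * c by rewrite expr2 -mulrA ler_neMl// tc; lra.
  by have := h t; have := h (- t); rewrite tc sqrrN; lra.
by rewrite pmulr_lge0 ?invr_gt0// subr_ge0.
Qed.

Lemma nm_leP u c : 0 <= c -> (nm u <= c) = (ip u u <= c ^+ 2).
Proof. by move=> c0; rewrite -nm_sqr ler_sqr ?nnegrE// nm_ge0. Qed.

(** Cauchy-Schwarz for the positive semidefinite form [ip (B u) v]. The case B = id is [cs]; the
    general case serves [pos_norm]. *)
Lemma psd_cs B u v : linear B -> (forall x y, ip (B x) y = ip x (B y)) ->
  (forall x, 0 <= ip (B x) x) -> ip (B u) v ^+ 2 <= ip (B u) u * ip (B v) v.
Proof.
move=> lB sB pB; apply: quad_disc => t.
have := pB (t%:C *: v + u); rewrite lB !ipDl !ipDr !ipZl !ipZr.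
have -> : ip (B v) u = ip (B u) v by rewrite sB ipC.
by congr (0 <= _); ring.
Qed.

Lemma cs u v : ip u v <= nm u * nm v.
Proof.
have := @psd_cs id u v (fun _ _ _ => erefl) (fun _ _ => erefl) ip_ge0.
rewrite -!nm_sqr -exprMn => h; apply: le_trans (ler_norm _) _.
rewrite -ler_sqr ?nnegrE ?mulr_ge0 ?nm_ge0//.
by rewrite real_normK ?num_real.
Qed.

Lemma cs_abs u v : `|ip u v| <= nm u * nm v.
Proof.
apply/ler_normlP; split; last exact: cs.
rewrite -ipNl; apply: le_trans (cs _ _) _.
by rewrite /nm /l2norm -/(ip _ _) ipNl ipNr opprK.
Qed.

Lemma nmD u v : nm (u + v) <= nm u + nm v.
Proof.
rewrite nm_leP ?addr_ge0 ?nm_ge0// ipDl !ipDr (ipC v u).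
by have := cs u v; rewrite -!nm_sqr; nra.
Qed.

Lemma nmN u : nm (- u) = nm u.
Proof. by rewrite !nmE ipNl ipNr opprK. Qed.

Lemma nmB u v : nm (u - v) <= nm u + nm v.
Proof. by rewrite -(nmN v); exact: nmD. Qed.

Lemma ipZZ (c : R[i]) u : ip (c *: u) (c *: u) = normsq c * ip u u.
Proof.
apply: ipE; apply: eq_has_sum (has_sumZ (normsq c) (ip_has_sum u u)) => g.
by rewrite l2Z; case: c (u g) => [a b] [x y]; rewrite /normsq /=; ring.
Qed.

Lemma nmZ (c : R[i]) u : nm (c *: u) = Num.sqrt (normsq c) * nm u.
Proof. by rewrite !nmE ipZZ sqrtrM// normsq_ge0. Qed.

Lemma nmZr (c : R) u : nm (c%:C *: u) = `|c| * nm u.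
Proof. by rewrite nmZ /normsq /= expr0n addr0 sqrtr_sqr. Qed.

Lemma nm0_eq u : nm u = 0 -> u = 0.
Proof. by move=> h; apply: ip_eq0; rewrite -nm_sqr h expr0n. Qed.

Lemma nm0 : nm 0 = 0. Proof. by rewrite nmE ip0l sqrtr0. Qed.

Lemma lshiftD g u v : Defs.lshift g (u + v) = Defs.lshift g u + Defs.lshift g v.
Proof. by apply: l2_ext. Qed.
Lemma lshiftZ g (c : R[i]) u : Defs.lshift g (c *: u) = c *: Defs.lshift g u.
Proof. by apply: l2_ext. Qed.

Lemma ip_lshift g u v : ip (Defs.lshift g u) (Defs.lshift g v) = ip u v.
Proof.
apply: ipE.
have := has_sum_reindex (p := fun x => (g^-1 * x)%g) (q := fun x => (g * x)%g) _ _ (ip_has_sum u v).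
by apply=> x; rewrite ?mulKVg ?mulKg.
Qed.

Lemma nm_lshift g u : nm (Defs.lshift g u) = nm u.
Proof. by rewrite !nmE ip_lshift. Qed.

Lemma rshift_subproof (g : G) u : (fun x => u (x * g)%g) \in @square_summable R G.
Proof.
apply/l2P; have [C h] := normsq_l1 u; exists C.
by apply: (l1bound_reindex (q := fun x => x * g^-1)%g) h => x; rewrite mulgK.
Qed.

Definition rshift g u : H := L2 (rshift_subproof g u).

Lemma ip_rshift g u v : ip (rshift g u) v = ip u (rshift g^-1%g v).
Proof.
apply: ipE.
have := has_sum_reindex (p := fun x => (x * g)%g) (q := fun x => (x * g^-1)%g) _ _
  (ip_has_sum u (rshift g^-1%g v)).
move=> /(_ (fun x => mulgK g x) (fun x => mulgKV g x)).
by apply: eq_has_sum => x /=; rewrite mulgK.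
Qed.

Lemma nm_rshift g u : nm (rshift g u) = nm u.
Proof.
rewrite !nmE ip_rshift; congr (Num.sqrt (ip _ _)).
by apply: l2_ext => x /=; rewrite mulgKV.
Qed.

(** [lop a] on l^2 as a combination of the isometric right shifts, from which boundedness and the
    adjoint are read off; [rho_Tl2] identifies it with [rho]. *)
Definition Tl2 (a : seq (R * G)) u : H := \sum_(s <- a) (s.1)%:C *: rshift s.2 u.

Lemma Tl2_val a u g :
  (Tl2 a u) g = lop [seq ((s.1)%:C, s.2) | s <- a] (fun x => u x : R[i]) g.
Proof.
rewrite /Tl2; elim: a => [|s a IH]; first by rewrite big_nil /lop big_nil.
by rewrite big_cons l2D IH /lop /= big_cons.
Qed.

Lemma Tl2_Re a u g : Re (Tl2 a u g) = lop a (fun x => Re (u x)) g.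
Proof.
rewrite Tl2_val; elim: a => [|s a IH]; first by rewrite /lop !big_nil.
by move: IH; rewrite /lop /= !big_cons ReD ReM /= mul0r subr0 => ->.
Qed.

Lemma Tl2_Im a u g : Im (Tl2 a u g) = lop a (fun x => Im (u x)) g.
Proof.
rewrite Tl2_val; elim: a => [|s a IH]; first by rewrite /lop !big_nil.
by move: IH; rewrite /lop /= !big_cons ImD ImM /= mul0r addr0 => ->.
Qed.

Lemma Tl2_linear a : linear (Tl2 a).
Proof.
move=> c u v; rewrite /Tl2 scaler_sumr -big_split /=; apply: eq_bigr => s _.
by rewrite scalerA mulrC -scalerA -scalerDr; congr (_ *: _); apply: l2_ext.
Qed.

Lemma Tl2_le a u : nm (Tl2 a u) <= nrm a * nm u.
Proof.
rewrite /Tl2 /nrm; elim: a => [|s a IH]; first by rewrite !big_nil nm0 mul0r.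
rewrite !big_cons mulrDl; apply: le_trans (nmD _ _) _; apply: lerD => //.
by rewrite nmZr nm_rshift.
Qed.

Lemma Tl2_NG a : in_NG (Tl2 a).
Proof.
split; first split; first exact: Tl2_linear.
  by exists (nrm a) => u; exact: Tl2_le.
move=> g u; apply: l2_ext => x; rewrite !Tl2_val -[RHS]/(Tl2 a u (g^-1 * x)%g) Tl2_val.
by apply: eq_bigr => s _ /=; rewrite mulgA.
Qed.

Lemma ip_Tl2 a u v : ip (Tl2 a u) v = ip u (Tl2 (adj a) v).
Proof.
rewrite /Tl2 /adj; elim: a => [|s a IH]; first by rewrite !big_nil ip0l ipC ip0l.
by rewrite /= !big_cons ipDl ipDr IH ipZl ipZr ip_rshift.
Qed.

Lemma e1E g : (@e1 R G) g = (g == 1%g)%:R :> R[i]. Proof. by []. Qed.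

Lemma ip_e1 u : ip u (@e1 R G) = Re (u 1%g).
Proof.
apply: ipE.
have := @has_sum1 R G (fun g => Re (u g) * Re (@e1 R G g) + Im (u g) * Im (@e1 R G g)) 1%g.
rewrite e1E eqxx /= mulr1 mulr0 addr0; apply => g g1.
by rewrite /delta1 (negbTE g1) /= !mulr0 addr0.
Qed.

Lemma nm_e1 : nm (@e1 R G) = 1.
Proof. by rewrite nmE ip_e1 e1E eqxx /= sqrtr1. Qed.

(** [adjoint] is defined by choice, so an adjoint has to be exhibited; it is unique because the
    difference of two of them is orthogonal to itself. *)
Lemma adjoint_eq A B : (forall u v, inner (A u) v = inner u (B v)) -> adjoint A = B.
Proof.
move=> h; rewrite /adjoint; case: xgetP => [B' _ hB'|/(_ B)//].
apply/funext => v; apply/eqP; rewrite -subr_eq0; apply/eqP; apply: ip_eq0.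
set d := _ - _; rewrite {2}/d ipDr ipNr.
by rewrite /ip -(hB' d v) -(h d v) subrr.
Qed.

Lemma adjoint_Tl2 a : adjoint (Tl2 a) = Tl2 (adj a).
Proof.
apply: adjoint_eq => u v; rewrite !innerE ip_Tl2; congr Complex.
have Zi (c : R[i]) x : Tl2 (adj a) (c *: x) = c *: Tl2 (adj a) x.
  by have := Tl2_linear (adj a) c x 0; rewrite addr0 => ->; rewrite (_ : Tl2 _ 0 = 0) ?addr0//;
     apply: l2_ext => g; rewrite Tl2_val lop0.
by rewrite ip_Tl2 Zi.
Qed.

Lemma lop_has_sum (a : seq (R * G)) (f : G -> R) (x : G -> R) g :
  (forall g, f g = \sum_(s <- a) s.1 * (g == s.2)%:R) ->
  rsum (fun g' => x g' * f (g^-1 * g')%g) = lop a x g.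
Proof.
move=> fE; apply: rsumE.
  apply: (@l1bound_fin _ _ _ [fset (g * s.2)%g | s in a]%fset) => h hA.
  rewrite fE big_seq big1 ?mulr0// => s sa; case: eqP => [hE|]; rewrite ?mulr0//.
  by move/imfsetP: hA; case; exists s => //=; rewrite -hE mulVKg.
rewrite /lop; apply: eq_has_sum (has_sum_lin a (fun s => s.1) (l := fun s => x (g * s.2)%g)
  (f := fun s g' => x g' * ((g^-1 * g')%g == s.2)%:R) _) => [h|s].
  by rewrite /= fE big_distrr /=; apply: eq_bigr => s _; rewrite mulrCA.
have := @has_sum1 R G (fun g' => x g' * ((g^-1 * g')%g == s.2)%:R) (g * s.2)%g.
rewrite mulKg eqxx mulr1; apply => h hs; case: eqP => [E|]; rewrite ?mulr0//.
by rewrite -E mulVKg eqxx in hs.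
Qed.

Lemma rho_Tl2 (a : seq (R * G)) (f : G -> R) : (forall g, f g = \sum_(s <- a) s.1 * (g == s.2)%:R) ->
  rho f = Tl2 a.
Proof.
move=> fE; apply/funext => v; rewrite /rho.
have -> : (cconv v (fun g => (star f g)%:C) : G -> R[i]^o) = Tl2 a v :> (G -> R[i]^o).
  apply/funext => g; rewrite /cconv /csum.
  have -> : (fun g' => Re (v g' * (star f (g'^-1 * g)%g)%:C)) =
      fun g' => Re (v g') * f (g^-1 * g')%g.
    by apply/funext => h; rewrite ReM /= mulr0 subr0 /star invMg invgK.
  have -> : (fun g' => Im (v g' * (star f (g'^-1 * g)%g)%:C)) =
      fun g' => Im (v g') * f (g^-1 * g')%g.
    by apply/funext => h; rewrite ImM /= mulr0 add0r /star invMg invgK.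
  rewrite !(lop_has_sum _ _ fE) -Tl2_Re -Tl2_Im.
  by case: (Tl2 a v g).
exact: (valKd 0 (Tl2 a v)).
Qed.

End L2Space.

(** * Spectral theory of self-adjoint operators *)

Section Limits.
Local Open Scope complex_scope.
Variable R : realType.

(** The limit is the supremum of the eventual lower bounds, that is, the lower limit. *)
Lemma cauchy_lim (x : nat -> R) :
  (forall e : R, 0 < e -> exists N, forall n m, (N <= n)%N -> (N <= m)%N -> `|x n - x m| <= e) ->
  exists l : R, x @ \oo --> l.
Proof.
move=> cx; pose S : set R := [set t | exists N, forall n, (N <= n)%N -> t <= x n].
have inS e N : (forall n m, (N <= n)%N -> (N <= m)%N -> `|x n - x m| <= e) -> S (x N - e).
  move=> h; exists N => n Nn; have /ler_normlP[] := h N n (leqnn _) Nn; lra.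
have ubS e N t : (forall n m, (N <= n)%N -> (N <= m)%N -> `|x n - x m| <= e) -> S t -> t <= x N + e.
  move=> h [M hM]; apply: le_trans (hM _ (leq_maxr N M)) _.
  by have /ler_normlP[] := h N (maxn N M) (leqnn _) (leq_maxl _ _); lra.
have hS : has_sup S.
  have [N hN] := cx 1 ltr01.
  split; first by exists (x N - 1); exact: inS hN.
  by exists (x N + 1) => t; exact: ubS hN.
exists (sup S); apply/cvgrPdist_le => e e0.
have e2 : 0 < e / 2 by rewrite divr_gt0.
have [N hN] := cx _ e2; exists N => // n /= Nn.
have h1 : x N - e / 2 <= sup S by apply: (sup_upper_bound hS); exact: inS hN.
have h2 : sup S <= x N + e / 2 by apply: ge_sup hS.1 _ => t; exact: ubS hN.
have h3 : `|x N - x n| <= e / 2 by apply: hN.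
rewrite (splitr e) (_ : sup S - x n = (sup S - x N) + (x N - x n)); last by ring.
apply: le_trans (ler_normD _ _) _; apply: lerD => //.
by apply/ler_normlP; split; lra.
Qed.

Lemma cvg_sum_seq (I : Type) (r : seq I) (f : I -> nat -> R) (l : I -> R) :
  (forall i, f i @ \oo --> l i) -> (fun n => \sum_(i <- r) f i n) @ \oo --> \sum_(i <- r) l i.
Proof.
move=> h; elim: r => [|i r IH].
  by rewrite big_nil; under eq_fun do rewrite big_nil; exact: cvg_cst.
by rewrite big_cons; under eq_fun do rewrite big_cons; exact: cvgD.
Qed.

End Limits.

Section Operators.
Local Open Scope complex_scope.
Variables (R : realType) (G : groupType).
Local Notation H := (l2 R G).
Local Notation Re := complex.Re.
Local Notation Im := complex.Im.
Implicit Types (u v w : H) (A B : H -> H).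

Section Linear.
Variables (A : H -> H) (lA : linear A).
Lemma linD u v : A (u + v) = A u + A v.
Proof. by have := lA 1 u v; rewrite !scale1r. Qed.
Lemma lin0 : A 0 = 0.
Proof. by have := linD 0 0; rewrite addr0 => /(congr1 (fun x => x - A 0)); rewrite subrr addrK. Qed.
Lemma linZ (c : R[i]) u : A (c *: u) = c *: A u.
Proof. by have := lA c u 0; rewrite lin0 !addr0. Qed.
Lemma linN u : A (- u) = - A u.
Proof. by rewrite -scaleN1r linZ scaleN1r. Qed.
Lemma linB u v : A (u - v) = A u - A v.
Proof. by rewrite linD linN. Qed.
Lemma lin_sum (I : Type) (r : seq I) (f : I -> H) :
  A (\sum_(i <- r) f i) = \sum_(i <- r) A (f i).
Proof. by elim: r => [|i r IH]; rewrite ?big_nil ?lin0// !big_cons linD IH. Qed.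
End Linear.

Lemma NG_lin A : in_NG A -> linear A. Proof. by case=> -[]. Qed.

Lemma NG_bd A : in_NG A -> exists2 M, 0 <= M & forall u, nm (A u) <= M * nm u.
Proof.
move=> [[_ [M hM]] _]; exists `|M| => // u; apply: le_trans (hM u) _.
by rewrite ler_wpM2r ?nm_ge0// ler_norm.
Qed.

Lemma NG_id : in_NG (@id H).
Proof. by split=> //; split=> //; exists 1 => u; rewrite mul1r. Qed.

Lemma NG_comp A B : in_NG A -> in_NG B -> in_NG (A \o B).
Proof.
move=> hA hB; have [M M0 hM] := NG_bd hA; have [N N0 hN] := NG_bd hB.
split; [split|].
- by move=> c u v /=; rewrite (NG_lin hB) (NG_lin hA).
- exists (M * N) => u /=; apply: le_trans (hM _) _.
  by rewrite -mulrA ler_wpM2l//; exact: hN.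
- by move=> g u /=; rewrite hB.2 hA.2.
Qed.

Lemma NG_lincomb (c d : R[i]) A B : in_NG A -> in_NG B ->
  in_NG (fun u => c *: A u + d *: B u).
Proof.
move=> hA hB; have [M M0 hM] := NG_bd hA; have [N N0 hN] := NG_bd hB.
split; [split|].
- move=> e u v; rewrite (NG_lin hB) (NG_lin hA) !scalerDr !scalerA !(mulrC e).
  by rewrite addrACA.
- exists (Num.sqrt (normsq c) * M + Num.sqrt (normsq d) * N) => u.
  rewrite mulrDl; apply: le_trans (nmD _ _) _; rewrite !nmZ.
  by apply: lerD; rewrite -mulrA ler_wpM2l ?sqrtr_ge0.
- by move=> g u; rewrite hA.2 hB.2 lshiftD !lshiftZ.
Qed.

Lemma NG_eq A B : A =1 B -> in_NG A -> in_NG B.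
Proof. by move=> /funext ->. Qed.

Lemma NG_sum (I : Type) (r : seq I) (f : I -> H -> H) : (forall i, in_NG (f i)) ->
  in_NG (fun u => \sum_(i <- r) f i u).
Proof.
move=> hf; elim: r => [|i r IH].
  apply: (NG_eq (A := fun u => 0 *: u + 0 *: u)); last exact: NG_lincomb NG_id NG_id.
  by move=> u; rewrite big_nil !scale0r addr0.
apply: (NG_eq (A := fun u => 1 *: f i u + 1 *: \sum_(i <- r) f i u)); last exact: NG_lincomb.
by move=> u; rewrite big_cons !scale1r.
Qed.

Lemma NG_scale (c : R[i]) A : in_NG A -> in_NG (fun u => c *: A u).
Proof.
move=> hA; apply: (NG_eq (A := fun u => c *: A u + 0 *: A u)); last exact: NG_lincomb.
by move=> u; rewrite scale0r addr0.
Qed.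

Lemma NG_iter A k : in_NG A -> in_NG (iter k A).
Proof. by move=> hA; elim: k => [|k IH]; [exact: NG_id|exact: NG_comp]. Qed.

Lemma NG_subZ A (z : R[i]) : in_NG A -> in_NG (fun u => A u - z *: u).
Proof.
move=> hA; apply: (NG_eq (A := fun u => 1 *: A u + (- z) *: u)).
  by move=> u; rewrite scale1r scaleNr.
exact: NG_lincomb hA NG_id.
Qed.

Lemma nm_small u (c : R) : (forall e : R, 0 < e -> nm u <= e * c) -> u = 0.
Proof.
move=> h; apply: nm0_eq; apply/eqP; rewrite eq_le nm_ge0 andbT.
apply/ler_addgt0Pl => e e0; rewrite addr0.
have c1 : 0 < `|c| + 1 by rewrite ltr_wpDl.
apply: le_trans (h _ (divr_gt0 e0 c1)) _.
rewrite mulrAC ler_pdivrMr// ler_wpM2l ?(ltW e0)//.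
by apply: le_trans (ler_norm _) _; rewrite lerDl.
Qed.

Lemma nm_coord u g : `|Re (u g)| <= nm u /\ `|Im (u g)| <= nm u.
Proof.
have h := ip_ge1 u g.
by split; rewrite -ler_sqr ?nnegrE ?nm_ge0// nm_sqr real_normK ?num_real//;
  apply: le_trans h; rewrite /normsq ?lerDl ?lerDr sqr_ge0.
Qed.

Lemma nm_fin u (c : R) : 0 <= c -> (forall A : {fset G}, \sum_(g <- A) normsq (u g) <= c ^+ 2) ->
  nm u <= c.
Proof.
move=> c0 h; rewrite nm_leP//; apply: has_sum_le h _.
by apply: eq_has_sum (ip_has_sum u u) => g; rewrite /normsq !expr2.
Qed.

(** Completeness of N G in operator norm. The limit is formed coordinatewise; letting m tend to
    infinity in the estimate on each finite subset of G gives both square-summability and the norm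
    bound. *)
Lemma op_limit (An : nat -> H -> H) (en : nat -> R) : (forall n, in_NG (An n)) ->
  (forall n, 0 <= en n) -> en @ \oo --> 0 ->
  (forall n m u, (n <= m)%N -> nm (An n u - An m u) <= en n * nm u) ->
  exists L, in_NG L /\ forall n u, nm (An n u - L u) <= en n * nm u.
Proof.
move=> hA e0 ecv hAm.
have esmall (e : R) : 0 < e -> exists N, forall n, (N <= n)%N -> en n <= e.
  move=> ep; move/cvgrPdist_le: ecv => /(_ _ ep)[N _ hN]; exists N => n /hN.
  by rewrite sub0r normrN ger0_norm.
have cau (f : R[i] -> R) : (forall x y, f (x - y) = f x - f y) ->
    (forall u g, `|f (u g)| <= nm u) -> forall u g, exists l : R, (fun n => f (An n u g)) @ \oo --> l.
  move=> fB fle u g; apply: cauchy_lim => e ep.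
  have c1 : 0 < 2 * nm u + 1 by rewrite ltr_wpDl// mulr_ge0// nm_ge0.
  have [N hN] := esmall _ (divr_gt0 ep c1); exists N => n m Nn Nm.
  wlog nm' : n m Nn Nm / (n <= m)%N.
    by move=> W; have [/W|/ltnW/W] := leqP n m; [apply|rewrite distrC; apply].
  rewrite -fB; apply: le_trans (fle (An n u - An m u) g) _.
  apply: le_trans (hAm _ _ _ nm') _; apply: le_trans (ler_wpM2r (nm_ge0 _) (hN _ Nn)) _.
  rewrite mulrAC ler_pdivrMr// ler_wpM2l ?(ltW ep)//.
  by have := nm_ge0 u; lra.
have ReB (x y : R[i]) : Re (x - y) = Re x - Re y by rewrite ReD ReN.
have ImB (x y : R[i]) : Im (x - y) = Im x - Im y by rewrite ImD ImN.
have cRe := cau _ ReB (fun u g => (nm_coord u g).1).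
have cIm := cau _ ImB (fun u g => (nm_coord u g).2).
pose lf u g : R[i]^o := (sval (cid (cRe u g)) +i* sval (cid (cIm u g)))%C.
have lRe u g : (fun n => Re (An n u g)) @ \oo --> Re (lf u g) by rewrite /lf /=; case: (cid (cRe u g)).
have lIm u g : (fun n => Im (An n u g)) @ \oo --> Im (lf u g) by rewrite /lf /=; case: (cid (cIm u g)).
have fin n u (A : {fset G}) : \sum_(g <- A) normsq (An n u g - lf u g) <= (en n * nm u) ^+ 2.
  have H : (fun m => \sum_(g <- A) normsq ((An n u - An m u) g)) @ \oo -->
      \sum_(g <- A) normsq (An n u g - lf u g).
    apply: cvg_sum_seq => g; rewrite /normsq; apply: cvgD.
      rewrite ReB !expr2; under eq_fun do rewrite l2D l2N ReB expr2.
      by apply: cvgM; apply: cvgB => //; exact: cvg_cst.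
    rewrite ImB !expr2; under eq_fun do rewrite l2D l2N ImB expr2.
    by apply: cvgM; apply: cvgB => //; exact: cvg_cst.
  apply: (cvgr_to_le H); exists n => // m /= nm'.
  apply: le_trans (ip_ge (An n u - An m u) A) _; rewrite -nm_sqr ler_sqr ?nnegrE ?mulr_ge0 ?nm_ge0//.
  exact: hAm.
have dS n u : (fun g => An n u g - lf u g : R[i]^o) \in @square_summable R G.
  apply/l2P; exists ((en n * nm u) ^+ 2) => A.
  by under eq_bigr do rewrite ger0_norm ?normsq_ge0//.
have lfS u : lf u \in @square_summable R G.
  have -> : lf u = l2_val (An 0%N u - L2 (dS 0%N u)).
    by apply/funext => g; rewrite l2D l2N /= opprB addrC subrK.
  exact: l2_valP.
pose L u : H := L2 (lfS u).
have hL n u : nm (An n u - L u) <= en n * nm u.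
  by apply: nm_fin => [|A]; [rewrite mulr_ge0 ?nm_ge0|exact: fin].
exists L; split=> //.
split; [split|].
- move=> c u v; apply/eqP; rewrite -subr_eq0; apply/eqP.
  apply: (@nm_small _ (nm (c *: u + v) + Num.sqrt (normsq c) * nm u + nm v)) => e ep.
  have [N /(_ N (leqnn _)) hN] := esmall _ ep.
  have -> : L (c *: u + v) - (c *: L u + L v) =
      - (An N (c *: u + v) - L (c *: u + v)) + (c *: (An N u - L u)) + (An N v - L v).
    rewrite (NG_lin (hA N)); apply: l2_ext => g; rewrite !(l2D, l2N, l2Z); ring.
  rewrite !mulrDr; apply: le_trans (nmD _ _) _; apply: lerD; last first.
    by apply: le_trans (hL _ _) _; rewrite ler_wpM2r ?nm_ge0.
  apply: le_trans (nmD _ _) _; apply: lerD.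
    by rewrite nmN; apply: le_trans (hL _ _) _; rewrite ler_wpM2r ?nm_ge0.
  rewrite nmZ mulrCA ler_wpM2l ?sqrtr_ge0//.
  by apply: le_trans (hL _ _) _; rewrite ler_wpM2r ?nm_ge0.
- have [M M0 hM] := NG_bd (hA 0%N); exists (M + en 0%N) => u.
  have -> : L u = An 0%N u - (An 0%N u - L u) by rewrite opprB addrC subrK.
  by rewrite mulrDl; apply: le_trans (nmB _ _) _; apply: lerD.
- move=> g u; apply/eqP; rewrite -subr_eq0; apply/eqP.
  apply: (@nm_small _ (2 * nm u)) => e ep.
  have [N /(_ N (leqnn _)) hN] := esmall _ ep.
  have -> : L (Defs.lshift g u) - Defs.lshift g (L u) =
      Defs.lshift g (An N u - L u) - (An N (Defs.lshift g u) - L (Defs.lshift g u)).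
    have -> : An N (Defs.lshift g u) = Defs.lshift g (An N u) by exact: (hA N).2.
    apply: l2_ext => x; rewrite !(l2D, l2N).
    have lsE v : Defs.lshift g v x = v (g^-1 * x)%g by [].
    by rewrite !lsE !(l2D, l2N); ring.
  apply: le_trans (nmB _ _) _; rewrite nm_lshift mulrCA mulr_natl mulr2n.
  apply: lerD; apply: le_trans (hL _ _) _; rewrite ?nm_lshift ler_wpM2r ?nm_ge0//.
Qed.

(** Symmetry for the real part of the inner product; for complex linear B this is full
    self-adjointness, on replacing v by i v. *)
Definition sa B := in_NG B /\ forall u v, ip (B u) v = ip u (B v).

Lemma sa_lincomb (c d : R) A B : sa A -> sa B -> sa (fun u => c%:C *: A u + d%:C *: B u).
Proof.
move=> [hA sA] [hB sB]; split; first exact: NG_lincomb.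
by move=> u v; rewrite ipDl ipDr !ipZl !ipZr sA sB.
Qed.

Lemma sa_id : sa (@id H). Proof. by split; first exact: NG_id. Qed.

Lemma sa_sq A : sa A -> sa (A \o A).
Proof. by move=> [hA sA]; split; [exact: NG_comp|move=> u v /=; rewrite !sA]. Qed.

(** By [psd_cs] for u and B u, |B u|^4 <= <B u, u> <B B u, B u> <= <B u, u> r |B u|^2. *)
Lemma pos_norm B (r : R) u : 0 <= r -> sa B -> (forall x, 0 <= ip (B x) x <= r * ip x x) ->
  ip (B u) (B u) <= r * ip (B u) u.
Proof.
move=> r0 [hB sB] pB.
have p0 x : 0 <= ip (B x) x by case/andP: (pB x).
have h := psd_cs u (B u) (NG_lin hB) sB p0.
have /andP[_ h2] := pB (B u).
have [->|n0] := eqVneq (ip (B u) (B u)) 0.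
  exact: mulr_ge0.
have pos : 0 < ip (B u) (B u) by rewrite lt_neqAle eq_sym n0 ip_ge0.
rewrite -(ler_pM2r pos) -expr2; apply: le_trans h _.
by rewrite [leRHS]mulrAC [leLHS]mulrC ler_wpM2r.
Qed.

(** With E = max(D, del), the operator S = 1 - B / E satisfies 0 <= S <= r = 1 - del / E < 1, so |S
    u| <= r |u| by [pos_norm], and B = E (1 - S) is inverted by E^-1 \sum_k S^k. *)
Lemma neumann B (del D : R) : sa B -> 0 < del ->
  (forall u, del * ip u u <= ip (B u) u <= D * ip u u) -> NG_invertible B.
Proof.
move=> hB del0 bB; have [NB sB] := hB.
have [M M0 hM] := NG_bd NB.
pose E := Num.max D del; have E0 : 0 < E by rewrite /E lt_max del0 orbT.
have E0' : E != 0 by rewrite gt_eqF.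
pose S u := (1 : R)%:C *: u + (- E^-1)%:C *: B u.
have SE u : S u = u - (E^-1)%:C *: B u.
  by rewrite /S scale1r rmorphN scaleNr.
have saS : sa S by exact: sa_lincomb sa_id hB.
pose r := 1 - del / E.
have r01 : 0 <= r < 1.
  rewrite /r subr_ge0 ler_pdivrMr// mul1r ltrBlDr ltrDl divr_gt0// andbT.
  by rewrite /E le_max lexx orbT.
have /andP[r0 r1] := r01.
have pS u : 0 <= ip (S u) u <= r * ip u u.
  have /andP[b1 b2] := bB u; have u0 := ip_ge0 u.
  have DE : ip (B u) u <= E * ip u u.
    by apply: le_trans b2 _; rewrite ler_wpM2r// /E le_max lexx.
  rewrite SE ipDl ipNl ipZl /r mulrBl mul1r; apply/andP; split.
    by rewrite subr_ge0 ler_pdivrMl.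
  by rewrite lerD2l lerN2 mulrC mulrA [leLHS]mulrC ler_wpM2l ?invr_ge0 ?(ltW E0)// mulrC.
have nS u : nm (S u) <= r * nm u.
  rewrite nm_leP ?mulr_ge0 ?nm_ge0//; apply: le_trans (pos_norm u r0 saS pS) _.
  rewrite exprMn nm_sqr expr2 -mulrA ler_wpM2l//.
  by case/andP: (pS u).
have nSk k u : nm (iter k S u) <= r ^+ k * nm u.
  elim: k => [|k IH]; first by rewrite expr0 mul1r.
  by rewrite /= exprS -mulrA; apply: le_trans (nS _) _; rewrite ler_wpM2l.
pose V n u := (E^-1)%:C *: \sum_(k < n) iter k S u.
have NS := saS.1.
have NV n : in_NG (V n).
  by apply: NG_scale; apply: NG_sum => k; exact: NG_iter.
pose en n := E^-1 * (r ^+ n * (1 - r)^-1).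
have q0 : 0 <= (1 - r)^-1 by rewrite invr_ge0 subr_ge0 ltW.
have [|||L [NL hL]] := @op_limit V en NV.
- by move=> n; rewrite /en mulr_ge0 ?invr_ge0 ?(ltW E0)// mulr_ge0// exprn_ge0.
- rewrite /en -(mulr0 E^-1); apply: cvgMr; rewrite -(mul0r (1 - r)^-1); apply: cvgMl.
  by apply: cvg_expr; rewrite ger0_norm.
- move=> n m u nm'; rewrite /V -scalerBr nmZr ger0_norm ?invr_ge0 ?(ltW E0)//.
  rewrite /en -mulrA ler_wpM2l ?invr_ge0 ?(ltW E0)//.
  have -> : \sum_(k < n) iter k S u - \sum_(k < m) iter k S u =
      - \sum_(k < m - n) iter (n + k) S u.
    rewrite -(subnKC nm') big_split_ord /= opprD addrA subrr sub0r addKn //.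
  rewrite nmN.
  have step N : nm (\sum_(k < N) iter (n + k) S u) <= \sum_(k < N) r ^+ (n + k) * nm u.
    elim: N => [|N IH]; first by rewrite !big_ord0 nm0.
    by rewrite !big_ord_recr /=; apply: le_trans (nmD _ _) _; apply: lerD.
  apply: le_trans (step _) _; rewrite -big_distrl /= ler_wpM2r ?nm_ge0//.
  under eq_bigr do rewrite exprD.
  by rewrite -big_distrr /= ler_wpM2l ?exprn_ge0// geo_sum_le.
have lB := NG_lin NB; have lS := NG_lin NS.
have BE u : B u = E%:C *: (u - S u).
  by rewrite SE opprB addrC subrK scalerA -rmorphM mulfV// scale1r.
have tel n u : \sum_(k < n) iter k S u - S (\sum_(k < n) iter k S u) = u - iter n S u.
  rewrite (lin_sum lS) -sumrB; elim: n => [|n IH]; first by rewrite big_ord0 subrr.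
  by rewrite big_ord_recr /= IH addrA subrK.
have BV n u : B (V n u) = u - iter n S u.
  rewrite /V (linZ lB) BE scalerA -rmorphM mulVf// scale1r; exact: tel.
have SBc u : S (B u) = B (S u) by rewrite !SE (linB lB) (linZ lB).
have iSB k u : iter k S (B u) = B (iter k S u) by elim: k => //= k ->; rewrite SBc.
have VB n u : V n (B u) = u - iter n S u.
  rewrite -BV /V (linZ lB) (lin_sum lB); congr (_ *: _); apply: eq_bigr => k _.
  exact: iSB.
have rsmall e : 0 < e -> exists n, r ^+ n <= e.
  by move=> ep; have [n hn] := geo_lt r01 ep; exists n; exact: ltW.
pose c := E^-1 * (1 - r)^-1.
have c0 : 0 <= c by rewrite mulr_ge0// invr_ge0 ltW.
have enE n : en n = r ^+ n * c by rewrite /en /c; ring.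
split=> //; exists L; split=> // u; apply/eqP; rewrite -subr_eq0; apply/eqP.
- apply: (@nm_small _ (c * nm (B u) + nm u)) => e ep.
  have [n hn] := rsmall _ ep.
  have -> : L (B u) - u = - (V n (B u) - L (B u)) - iter n S u.
    rewrite VB; apply: l2_ext => g; rewrite !(l2D, l2N); ring.
  rewrite mulrDr; apply: le_trans (nmB _ _) _; rewrite nmN; apply: lerD.
    apply: le_trans (hL _ _) _; rewrite enE -mulrA ler_wpM2r// mulr_ge0 ?nm_ge0//.
  by apply: le_trans (nSk _ _) _; rewrite ler_wpM2r ?nm_ge0.
- apply: (@nm_small _ (M * (c * nm u) + nm u)) => e ep.
  have [n hn] := rsmall _ ep.
  have -> : B (L u) - u = - B (V n u - L u) - iter n S u.
    rewrite (linB lB) BV; apply: l2_ext => g; rewrite !(l2D, l2N); ring.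
  rewrite mulrDr; apply: le_trans (nmB _ _) _; rewrite nmN; apply: lerD.
    apply: le_trans (hM _) _; rewrite mulrCA ler_wpM2l//.
    apply: le_trans (hL _ _) _; rewrite enE -mulrA ler_wpM2r// mulr_ge0 ?nm_ge0//.
  by apply: le_trans (nSk _ _) _; rewrite ler_wpM2r ?nm_ge0.
Qed.

Lemma inv_comp A B : NG_invertible A -> NG_invertible B -> NG_invertible (A \o B).
Proof.
move=> [hA [A' [hA' k1 k2]]] [hB [B' [hB' k3 k4]]]; split; first exact: NG_comp.
by exists (B' \o A'); split; [exact: NG_comp|move=> u /=; rewrite k1 k3|move=> u /=; rewrite k4 k2].
Qed.

Lemma inv_scale (c : R[i]) A : c != 0 -> NG_invertible A -> NG_invertible (fun u => c *: A u).
Proof.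
move=> c0 [hA [A' [hA' k1 k2]]]; split; first exact: NG_scale.
exists (fun u => c^-1 *: A' u); split; first exact: NG_scale.
  by move=> u; rewrite (linZ (NG_lin hA')) scalerA mulVf// scale1r k1.
by move=> u; rewrite (linZ (NG_lin hA)) scalerA mulfV// scale1r k2.
Qed.

Lemma NG_inv_eq A B : A =1 B -> NG_invertible A -> NG_invertible B.
Proof. by move=> /funext ->. Qed.

Lemma inv_factor A A' : in_NG A -> in_NG A' -> (forall u, A (A' u) = A' (A u)) ->
  NG_invertible (A \o A') -> NG_invertible A.
Proof.
move=> hA hA' comm [_ [V [hV k1 k2]]]; split=> //; exists (A' \o V).
have AV u : A' (V u) = V (A' u).
  by rewrite -[LHS]k1 /= comm -[A (A' (V u))]/((A \o A') (V u)) k2.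
split; [exact: NG_comp| |] => u /=; last exact: k2.
by rewrite AV -comm; exact: k1.
Qed.

(** s0 is the least upper bound of the numerical range. If S - s0 had a bounded inverse, then B = s0
    - S >= 0 would satisfy |u|^2 <= C^2 |B u|^2 <= C^2 D <B u, u> by [pos_norm], and s0 could be
    lowered. The summand 1 in the constant keeps it positive. *)
Lemma sa_spec S : sa S -> exists s0 : R, spectrum S s0%:C /\
  forall u, ip (S u) u <= s0 * ip u u.
Proof.
move=> hS; have [NS sS] := hS; have [M M0 hM] := NG_bd NS.
have upM u : `|ip (S u) u| <= M * ip u u.
  apply: le_trans (cs_abs _ _) _; rewrite -nm_sqr expr2 mulrA.
  by rewrite ler_wpM2r ?nm_ge0.
pose W : set R := [set s | forall u, ip (S u) u <= s * ip u u].
have e11 : ip (@e1 R G) (@e1 R G) = 1 by rewrite -nm_sqr nm_e1 expr1n.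
have hW : has_inf W.
  split; first by exists M => u; apply: le_trans (ler_norm _) (upM u).
  exists (ip (S (@e1 R G)) (@e1 R G)) => s /(_ (@e1 R G)); by rewrite e11 mulr1.
pose s0 := inf W; exists s0.
have s0W u : ip (S u) u <= s0 * ip u u.
  have [u0|u0] := eqVneq (ip u u) 0.
    by rewrite (ip_eq0 u0) (lin0 (NG_lin NS)) ip0l mulr0.
  have up : 0 < ip u u by rewrite lt_neqAle eq_sym u0 ip_ge0.
  rewrite -ler_pdivrMr//; apply: lb_le_inf => [|s hs]; first exact: hW.1.
  by rewrite ler_pdivrMr.
split=> //; rewrite /spectrum /= => -[_ [V [NV k1 _]]].
have [C C0 hC] := NG_bd NV.
pose B u := s0%:C *: u + (-1)%:C *: S u.
have saB : sa B by exact: sa_lincomb sa_id hS.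
have BE u : ip (B u) u = s0 * ip u u - ip (S u) u by rewrite /B ipDl !ipZl mulN1r.
pose D := `|s0| + M; have D0 : 0 <= D by rewrite addr_ge0.
have pB u : 0 <= ip (B u) u <= D * ip u u.
  rewrite BE subr_ge0 s0W /= /D mulrDl; apply: lerD.
    by rewrite ler_wpM2r ?ip_ge0// ler_norm.
  by have /ler_normlP[] := upM u.
have low u : ip u u <= (C ^+ 2 * D + 1) * ip (B u) u.
  have p0 : 0 <= ip (B u) u by case/andP: (pB u).
  have h1 := pos_norm u D0 saB pB.
  have h2 : nm u <= C * nm (B u).
    rewrite -{1}(k1 u); apply: le_trans (hC _) _.
    have -> : S u - s0%:C *: u = - B u.
      by rewrite /B opprD addrC rmorphN1 scaleN1r opprK.
    by rewrite nmN.
  have : ip u u <= C ^+ 2 * ip (B u) (B u).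
    by rewrite -!nm_sqr -exprMn ler_sqr ?nnegrE ?mulr_ge0 ?nm_ge0.
  move=> h3; apply: le_trans h3 _; rewrite mulrDl mul1r.
  apply: (@le_trans _ _ (C ^+ 2 * (D * ip (B u) u))); first by rewrite ler_wpM2l ?sqr_ge0.
  by rewrite mulrA lerDl.
have K0 : 0 < C ^+ 2 * D + 1 by rewrite ltr_wpDl// mulr_ge0// sqr_ge0.
have : W (s0 - (C ^+ 2 * D + 1)^-1).
  move=> u; have := low u; rewrite BE -ler_pdivrMl// => h.
  by rewrite mulrBl; lra.
move=> /(ge_inf hW.2); rewrite -/s0.
have : 0 < (C ^+ 2 * D + 1)^-1 by rewrite invr_gt0.
lra.
Qed.

Lemma sa_bound S : sa S -> exists2 M, 0 <= M & forall u, `|ip (S u) u| <= M * ip u u.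
Proof.
move=> [NS sS]; have [M M0 hM] := NG_bd NS; exists M => // u.
apply: le_trans (cs_abs _ _) _; rewrite -nm_sqr expr2 mulrA.
by rewrite ler_wpM2r ?nm_ge0.
Qed.

(** For z = a + i b with b nonzero, T - z and T minus the conjugate of z commute and have product (T
    - a)^2 + b^2 >= b^2, which is invertible by [neumann]; so its factors are. *)
Lemma spectrum_real T (z : R[i]) : sa T -> spectrum T z -> exists x : R, z = x%:C.
Proof.
move=> hT; have [NT sT] := hT; case: z => a b hz.
have [->|b0] := eqVneq b 0; first by exists a.
exfalso; apply: hz.
pose T1 u := 1%:C *: T u + (- a)%:C *: u.
have saT1 : sa T1 by exact: sa_lincomb hT sa_id.
pose B u := 1%:C *: T1 (T1 u) + (b ^+ 2)%:C *: u.
have saB : sa B by exact: sa_lincomb (sa_sq saT1) sa_id.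
have [M M0 hM] := sa_bound saB.
have b2 : 0 < b ^+ 2 by rewrite lt_neqAle eq_sym sqrf_eq0 b0 sqr_ge0.
have invB : NG_invertible B.
  apply: (@neumann B (b ^+ 2) M) => // u.
  rewrite (le_trans (ler_norm _) (hM u)) andbT /B ipDl !ipZl mul1r saT1.2.
  by rewrite lerDr ip_ge0.
pose A' u := T u - (a -i* b)%C *: u.
apply: (@inv_factor _ A').
- exact: NG_subZ.
- exact: NG_subZ.
- move=> u; rewrite /A' !(linB (NG_lin NT)) !(linZ (NG_lin NT)).
  by apply: l2_ext => g; rewrite !(l2D, l2N, l2Z); ring.
apply: NG_inv_eq invB => u; rewrite /B /A' /T1 /=.
have lT := NG_lin NT.
rewrite !(linD lT, linN lT, linZ lT).
apply: l2_ext => g; rewrite !(l2D, l2N, l2Z).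
move: (T (T u) g) (T u g) (u g) => [t1 t2] [s1 s2] [u1 u2].
by apply/eqP; rewrite eq_complex /=; apply/andP; split; apply/eqP; ring.
Qed.

(** The complex version of [op_poly], needed because the real polynomials at hand split into linear
    factors only over R[i]. *)
Definition cpoly (p : {poly R[i]}) A u : H := \sum_(i < size p) p`_i *: iter i A u.

Lemma cpoly_wide n (p : {poly R[i]}) A u : (size p <= n)%N -> cpoly p A u = \sum_(i < n) p`_i *: iter i A u.
Proof.
move=> pn; rewrite /cpoly (big_ord_widen n (fun i => p`_i *: iter i A u))//.
rewrite big_mkcond /=; apply: eq_bigr => i _; case: ltnP => // h.
by rewrite nth_default// scale0r.
Qed.

Lemma cpolyD (p q : {poly R[i]}) A u : cpoly (p + q) A u = cpoly p A u + cpoly q A u.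
Proof.
rewrite !(@cpoly_wide (maxn (size p) (size q))) ?leq_max ?leqnn ?orbT//; last first.
  by rewrite -leq_max size_polyD.
by rewrite -big_split /=; apply: eq_bigr => i _; rewrite coefD scalerDl.
Qed.

Lemma cpolyC (c : R[i]) A u : cpoly c%:P A u = c *: u.
Proof. by rewrite (@cpoly_wide 1) ?size_polyC_leq1// big_ord1 coefC. Qed.

Lemma cpolyZ (c : R[i]) (p : {poly R[i]}) A u : cpoly (c%:P * p) A u = c *: cpoly p A u.
Proof.
rewrite (@cpoly_wide (size p)); last by rewrite mul_polyC size_scale_leq.
by rewrite /cpoly scaler_sumr; apply: eq_bigr => i _; rewrite coefCM scalerA.
Qed.

Lemma cpolyMX (p : {poly R[i]}) A u : cpoly (p * 'X) A u = cpoly p A (A u).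
Proof.
rewrite (@cpoly_wide (size p).+1); last first.
  by apply: leq_trans (size_polyMleq _ _) _; rewrite size_polyX addn2.
rewrite big_ord_recl coefMX eqxx scale0r add0r; apply: eq_bigr => i _.
by rewrite coefMX -iterSr.
Qed.

Lemma cpoly_comm (p : {poly R[i]}) A u : linear A -> cpoly p A (A u) = A (cpoly p A u).
Proof.
move=> lA; rewrite /cpoly (lin_sum lA); apply: eq_bigr => i _.
by rewrite (linZ lA) -iterSr.
Qed.

Lemma cpolyM (p q : {poly R[i]}) A u : in_NG A -> cpoly (p * q) A u = cpoly p A (cpoly q A u).
Proof.
move=> hA; have lA := NG_lin hA; elim/poly_ind: p u => [|p c IH] u.
  by rewrite mul0r /cpoly size_poly0 !big_ord0.
rewrite mulrDl !cpolyD -mulrA (mulrC 'X) mulrA !cpolyMX IH cpolyC cpolyZ; congr (_ + _).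
by rewrite cpoly_comm.
Qed.

Lemma op_polyE (P : {poly R}) A : op_poly P A =1 cpoly (map_poly (real_complex R) P) A.
Proof.
move=> u; rewrite /op_poly /cpoly size_map_poly; apply: eq_bigr => i _.
by rewrite coef_map.
Qed.

Lemma sa_op_poly (P : {poly R}) A : sa A -> sa (op_poly P A).
Proof.
move=> [hA sA]; split; first by apply: NG_sum => i; apply: NG_scale; exact: NG_iter.
have sAi k u v : ip (iter k A u) v = ip u (iter k A v).
  by elim: k u v => // k IH u v; rewrite iterS sA IH -iterSr.
have ip_sum (I : Type) (r : seq I) (f : I -> H) v :
    ip (\sum_(i <- r) f i) v = \sum_(i <- r) ip (f i) v.
  by elim: r => [|i r IH]; rewrite ?big_nil ?ip0l// !big_cons ipDl IH.
move=> u v; rewrite /op_poly ip_sum (ipC u) ip_sum; apply: eq_bigr => i _.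
by rewrite !ipZl sAi ipC.
Qed.

Lemma inv_prod (r : seq R[i]) T : in_NG T ->
  (forall z, z \in r -> ~ spectrum T z) ->
  NG_invertible (cpoly (\prod_(z <- r) ('X - z%:P)) T).
Proof.
move=> hT; elim: r => [|z r IH] hr.
  rewrite big_nil; apply: (NG_inv_eq (A := id)).
    by move=> u; rewrite -[1]/(1%:P) cpolyC scale1r.
  by split; [exact: NG_id|exists id; split=> //; exact: NG_id].
rewrite big_cons.
apply: (NG_inv_eq (A := (fun u => T u - z *: u) \o cpoly (\prod_(j <- r) ('X - j%:P)) T)).
  move=> u /=; rewrite cpolyM//.
  rewrite -['X]mul1r cpolyD cpolyMX -polyCN (cpolyC (- z)) scaleNr.
  by rewrite -[1]/(1%:P) cpolyC scale1r.
apply: inv_comp.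
  by apply: contrapT; apply: hr; rewrite inE eqxx.
by apply: IH => y yr; apply: hr; rewrite inE yr orbT.
Qed.

(* Let s0 be the supremum of the numerical range of P(T), which lies in its
   spectrum. As P - s0 splits over C and nonreal numbers are not in the spectrum
   of T, some real root of P - s0 is. *)
Lemma spectral_upper T (P : {poly R}) (m : R) : sa T ->
  (forall x : R, spectrum T x%:C -> P.[x] <= m) ->
  forall u, ip (op_poly P T u) u <= m * ip u u.
Proof.
move=> hT hP u; have NT := hT.1.
have [s0 [sp hs]] := sa_spec (sa_op_poly P hT).
apply: le_trans (hs u) _; rewrite ler_wpM2r ?ip_ge0//.
pose Q := P - s0%:P; pose rc := real_complex R.
have QE v : cpoly (map_poly rc Q) T v = op_poly P T v - s0%:C *: v.
  by rewrite /Q rmorphB /= map_polyC -polyCN cpolyD cpolyC scaleNr -op_polyE.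
have [Q0|Q0] := eqVneq Q 0.
  (* Here P is the constant s0, and the hypothesis is used at any point of the spectrum of T, which
     is nonempty by [sa_spec]. *)
  have [z [zT _]] := sa_spec hT; apply: le_trans (hP z zT).
  by have /eqP := Q0; rewrite subr_eq0 => /eqP ->; rewrite hornerC.
have [r rE] := closed_field_poly_normal (map_poly rc Q).
have [[z [zr zT]]|no] := pselect (exists z, z \in r /\ spectrum T z).
  have [x zx] := spectrum_real hT zT; rewrite zx in zT; apply: le_trans (hP x zT).
  have : (map_poly rc Q).[rc x] = 0.
    rewrite rE hornerZ horner_prod (big_rem z)//= hornerXsubC zx subrr mul0r mulr0 //.
  rewrite horner_map => /complexI /eqP; rewrite /Q hornerD hornerN hornerC subr_eq0.
  by move=> /eqP ->.
exfalso; apply: sp.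
have lc0 : lead_coef (map_poly rc Q) != 0.
  by rewrite lead_coef_eq0 map_poly_eq0.
apply: NG_inv_eq (inv_scale lc0 (inv_prod NT (r := r) _)) => [v|z zr zT]; last by apply: no; exists z.
by rewrite -QE {2}rE -mul_polyC cpolyM// cpolyC.
Qed.

(** P(T) is self-adjoint, so |P(T) u|^2 = <P^2(T) u, u>, and [spectral_upper] applies to P^2. *)
Lemma spectral_norm T (P : {poly R}) (m : R) : sa T -> 0 <= m ->
  (forall x : R, spectrum T x%:C -> `|P.[x]| <= m) ->
  forall u, nm (op_poly P T u) <= m * nm u.
Proof.
move=> hT m0 hP u; rewrite nm_leP ?mulr_ge0 ?nm_ge0//.
have [_ sP] := sa_op_poly P hT; rewrite -sP exprMn nm_sqr.
have -> : op_poly P T (op_poly P T u) = op_poly (P ^+ 2) T u.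
  by rewrite !op_polyE rmorphXn /= expr2 cpolyM//; case: hT.
apply: spectral_upper => // x /hP h; rewrite horner_exp -real_normK ?num_real// ler_sqr ?nnegrE//.
Qed.

End Operators.

(** * Lower bounds for rho_f and for the sections of f^* f *)

Section Positive.
Local Open Scope complex_scope.
Variables (R : realType) (G : groupType).
Local Notation H := (l2 R G).
Local Notation Re := complex.Re.
Local Notation Im := complex.Im.
Implicit Types (u v : H) (a : seq (R * G)).

Definition pt (g : G) : H := Defs.lshift g (@e1 R G).

Lemma ptE g h : pt g h = (h == g)%:R.
Proof.
by rewrite /pt /= /delta1 -(inj_eq (mulgI g)) mulKVg mulg1.
Qed.

Lemma ip_pt g u : ip u (pt g) = Re (u g).
Proof.
have -> : u = Defs.lshift g (Defs.lshift g^-1%g u).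
  by apply: l2_ext => h; rewrite /= invgK mulKVg.
by rewrite ip_lshift ip_e1 /= invgK mulg1 mulVg mulg1.
Qed.

Lemma ReZ (c : R) u g : Re ((c%:C *: u) g) = c * Re (u g).
Proof. have h (x : R[i]) : Re (c%:C * x) = c * Re x by case: x => p q /=; ring.
exact: h (u g). Qed.

Lemma sum_l2 (I : Type) (r : seq I) (F : I -> H) g : (\sum_(i <- r) F i) g = \sum_(i <- r) F i g.
Proof. by elim: r => [|i r IH]; rewrite ?big_nil// !big_cons l2D IH. Qed.

Definition trunc (F : {fset G}) u : H := \sum_(g <- F) u g *: pt g.

Lemma truncE F u h : trunc F u h = if h \in F then u h else 0.
Proof.
rewrite /trunc sum_l2; under eq_bigr do rewrite l2Z ptE.
case: ifPn => hF.
  rewrite (big_fsetD1 h)//= eqxx mulr1 big_seq big1 ?addr0// => g.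
  by rewrite !inE => /andP[gh _]; rewrite eq_sym (negbTE gh) mulr0.
rewrite big_seq big1// => g gF; case: eqP => [hg|_]; last by rewrite mulr0.
by rewrite hg gF in hF.
Qed.

Lemma trunc_small u (e : R) : 0 < e -> exists F, nm (u - trunc F u) <= e.
Proof.
move=> e0; have [C hC] := normsq_l1 u; have [F hF] := l1bound_tail hC (exprn_gt0 2 e0).
exists F; apply: nm_fin => [|A]; first exact: ltW.
apply: le_trans (hF (A `\` F)%fset _); last first.
  by rewrite fdisjoint_sym; apply/fdisjointP => g; rewrite !inE => /andP[].
have E g : normsq ((u - trunc F u) g) = if g \in F then 0 else normsq (u g).
  rewrite l2D l2N truncE; case: ifP => _; last by rewrite subr0.
  by rewrite subrr /normsq /= expr0n addr0.
under eq_bigr do rewrite E.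
rewrite (big_fsetID _ (mem F)) /= [X in X + _]big1_fset ?add0r => [|g].
  rewrite (_ : [fset x | x in A & x \notin F]%fset = (A `\` F)%fset); last first.
    by apply/fsetP => g; rewrite !inE /= andbC.
  apply: ler_sum => g _; case: ifP => _; first by rewrite normr_ge0.
  exact: ler_norm.
by rewrite !inE /= => /andP[_ ->].
Qed.

Lemma nm_lower_trunc a w C (F : {fset G}) u : l1inv a w C ->
  nm (trunc F u) <= C * nm (Tl2 a (trunc F u)).
Proof.
move=> ha; have C0 : 0 <= C by case: ha => /l1bound_ge0.
set v := trunc F u.
rewrite nm_leP ?mulr_ge0 ?nm_ge0// exprMn nm_sqr.
pose B := [fset x in [seq (g * s.2^-1)%g | g <- F, s <- a]]%fset.
have vF h : h \notin F -> v h = 0 by rewrite truncE => /negbTE ->.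
have TB h : h \notin B -> Tl2 a v h = 0.
  move=> hB; rewrite Tl2_val /lop big_map big_seq big1// => s sa.
  rewrite vF ?mulr0//; apply: contra hB => hs; rewrite inE /=; apply/allpairsP.
  by exists ((h * s.2)%g, s); rewrite /= mulgK.
have h1 := l2_lower (y := fun g => Re (v g)) (A := F) (B := B) ha _ _.
have h2 := l2_lower (y := fun g => Im (v g)) (A := F) (B := B) ha _ _.
have e1 : ip v v = \sum_(g <- F) normsq (v g).
  apply: ipE; apply: eq_has_sum (has_sum_fin (A := F) _) => g; first by rewrite /normsq !expr2.
  by move=> /vF ->; rewrite /normsq /= expr0n addr0.
have e2 : \sum_(g <- B) normsq (Tl2 a v g) <= nm (Tl2 a v) ^+ 2 by rewrite nm_sqr; exact: ip_ge.
rewrite -(nm_sqr (Tl2 a v)) e1; apply: le_trans (ler_wpM2l (sqr_ge0 C) e2).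
rewrite /normsq !big_split /= mulrDr; apply: lerD.
  under [X in _ <= _ * X]eq_bigr do rewrite Tl2_Re.
  apply: h1 => h hh; first by rewrite vF.
  by rewrite -Tl2_Re TB.
under [X in _ <= _ * X]eq_bigr do rewrite Tl2_Im.
apply: h2 => h hh; first by rewrite vF.
by rewrite -Tl2_Im TB.
Qed.

(** Finitely supported functions are dense and [Tl2 a] is bounded, so the bound from Schur's test
    extends to all of l^2. *)
Lemma nm_lower a w C u : l1inv a w C -> nm u <= C * nm (Tl2 a u).
Proof.
move=> ha; have C0 : 0 <= C by case: ha => /l1bound_ge0.
apply/ler_addgt0Pr => e e0.
have c1 : 0 < C * nrm a + 1 by rewrite ltr_wpDl// mulr_ge0// nrm_ge0.
have [F hF] := trunc_small u (divr_gt0 e0 c1).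
set v := trunc F u in hF.
have uE : nm u <= nm v + nm (u - v) by rewrite -{1}(subrK v u) addrC; exact: nmD.
apply: le_trans uE _.
have h1 : nm v <= C * nm (Tl2 a v) by exact: nm_lower_trunc ha.
have h2 : nm (Tl2 a v) <= nm (Tl2 a u) + nrm a * nm (u - v).
  have -> : Tl2 a v = Tl2 a u - Tl2 a (u - v).
    by rewrite -(linB (@Tl2_linear _ _ a)) opprB addrC subrK.
  by apply: le_trans (nmB _ _) _; rewrite lerD2l; exact: Tl2_le.
have h3 : C * nm (Tl2 a v) <= C * nm (Tl2 a u) + C * nrm a * nm (u - v).
  by rewrite -mulrA -mulrDr ler_wpM2l.
have h4 : (C * nrm a + 1) * nm (u - v) <= e.
  by rewrite -ler_pdivlMl// mulrC.
by move: h4; rewrite mulrDl mul1r; lra.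
Qed.

Lemma Tl2_amul a b u : Tl2 (amul a b) u = Tl2 a (Tl2 b u).
Proof.
apply: l2_ext => g; apply/eqP; rewrite eq_complex !Tl2_Re !Tl2_Im.
rewrite -!lop_comp; apply/andP; split; apply/eqP; apply: eq_lop => x.
  by rewrite Tl2_Re.
by rewrite Tl2_Im.
Qed.

Variables (a : seq (R * G)) (w : G -> R) (C : R).
Hypothesis ha : l1inv a w C.

Lemma l1inv_gt0 : 0 < C.
Proof.
have C0 : 0 <= C by case: ha => /l1bound_ge0.
rewrite lt_neqAle C0 andbT; apply/eqP => C00.
by have := nm_lower (@e1 R G) ha; rewrite nm_e1 -C00 mul0r leNgt ltr01.
Qed.

Lemma Tl2_bounds u : (C ^+ 2)^-1 * ip u u <= ip (Tl2 a u) (Tl2 a u) <= nrm a ^+ 2 * ip u u.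
Proof.
have C0 := l1inv_gt0.
rewrite -!nm_sqr ler_pdivrMl ?exprn_gt0// -!exprMn !ler_sqr ?nnegrE ?mulr_ge0 ?nm_ge0 ?nrm_ge0// ?(ltW C0)//.
by rewrite (nm_lower _ ha) Tl2_le.
Qed.

Lemma l1inv_bounds : 0 < (C ^+ 2)^-1 /\ (C ^+ 2)^-1 <= nrm a ^+ 2.
Proof.
split; first by rewrite invr_gt0 exprn_gt0// l1inv_gt0.
by have /andP[h1 h2] := Tl2_bounds (@e1 R G); have := le_trans h1 h2; rewrite -nm_sqr nm_e1 expr1n !mulr1.
Qed.

(** The quadratic form of the section at v is |T_a u|^2 for u = \sum_i v_i [pt (e i)], so every
    section inherits the bounds of the operator on l^2. *)
Lemma gram_bounds n (e : 'I_n -> G) (v : 'cV[R]_n) : injective e ->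
  (C ^+ 2)^-1 * \sum_i v i 0 ^+ 2 <=
    \sum_i v i 0 * (mat (amul (adj a) a) e e *m v) i 0 <= nrm a ^+ 2 * \sum_i v i 0 ^+ 2.
Proof.
move=> ie; pose u := \sum_i (v i 0)%:C *: pt (e i).
have ip_u x : ip x u = \sum_i v i 0 * Re (x (e i)).
  rewrite /u; elim: (index_enum _) => [|i r IH]; first by rewrite !big_nil ipC ip0l.
  by rewrite !big_cons ipDr ipZr ip_pt IH.
have Re_u g : Re (u g) = ext e (fun j => v j 0) g.
  rewrite /u sum_l2 /ext; elim: (index_enum _) => [|i r IH]; first by rewrite !big_nil.
  rewrite !big_cons ReD IH ReZ ptE /dl.
  by case: (g == e i).
have uu : ip u u = \sum_i v i 0 ^+ 2.
  by rewrite ip_u; apply: eq_bigr => i _; rewrite Re_u extE.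
have pu : ip (Tl2 a u) (Tl2 a u) = \sum_i v i 0 * (mat (amul (adj a) a) e e *m v) i 0.
  rewrite ip_Tl2 -Tl2_amul ipC ip_u; apply: eq_bigr => i _.
  by rewrite mat_mul Tl2_Re; congr (_ * _); apply: eq_lop => g; rewrite Re_u.
by rewrite -uu -pu; exact: Tl2_bounds.
Qed.

Lemma gram_sym n (e : 'I_n -> G) :
  (mat (amul (adj a) a) e e)^T = mat (amul (adj a) a) e e.
Proof.
have E x y : lop (amul (adj a) a) (dl R y) x = ip (Tl2 a (pt x)) (Tl2 a (pt y)).
  rewrite ip_Tl2 -Tl2_amul ipC ip_pt Tl2_Re; apply: eq_lop => g.
  by rewrite ptE /dl; case: (g == y).
by apply/matrixP => i j; rewrite !mxE !E ipC.
Qed.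

End Positive.

(** * The Fuglede-Kadison determinant *)

Section FugledeKadison.
Local Open Scope complex_scope.
Variables (R : realType) (G : groupType) (a : seq (R * G)) (w : G -> R) (C : R).
Hypothesis ha : l1inv a w C.
Local Notation H := (l2 R G).
Local Notation Re := complex.Re.
Implicit Types (u v : H).
Let T := Tl2 a \o Tl2 (adj a).
Let al := (C ^+ 2)^-1.
Let be := nrm a ^+ 2.

Lemma sa_T : sa T.
Proof.
split; first by apply: NG_comp; exact: Tl2_NG.
move=> u v; rewrite -[ip (T u) v]/(ip (Tl2 a (Tl2 (adj a) u)) v) ip_Tl2.
by rewrite -[ip u (T v)]/(ip u (Tl2 a (Tl2 (adj a) v))) [RHS]ipC [RHS]ip_Tl2 ipC.
Qed.

Lemma T_bounds u : al * ip u u <= ip (T u) u <= be * ip u u.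
Proof.
have := Tl2_bounds (l1inv_adj ha) u; rewrite nrm_adj -/al -/be.
by rewrite ip_Tl2 adjK ipC.
Qed.

(** For x below al the operator T - x, for x above be the operator x - T, is bounded below by a
    positive constant, and [neumann] inverts it. *)
Lemma spectrum_T (x : R) : spectrum T x%:C -> al <= x <= be.
Proof.
move=> hx; apply/andP; split; rewrite leNgt; apply/negP => hlt; apply: hx.
- pose B u := (1 : R)%:C *: T u + (- x)%:C *: u.
  have saB : sa B by exact: sa_lincomb sa_T (@sa_id _ _).
  apply: (NG_inv_eq (A := B)); first by move=> u; rewrite /B rmorph1 scale1r rmorphN scaleNr.
  apply: (neumann (del := al - x) (D := be - x) saB); first by rewrite subr_gt0.
  by move=> u; rewrite /B ipDl !ipZl mul1r mulNr !mulrBl !lerD2r; exact: T_bounds.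
- pose B u := (- 1 : R)%:C *: T u + x%:C *: u.
  have saB : sa B by exact: sa_lincomb sa_T (@sa_id _ _).
  apply: (NG_inv_eq (A := fun u => (-1) *: B u)).
    by move=> u; rewrite /B rmorphN rmorph1 !scaleN1r opprD opprK.
  apply: inv_scale; first by rewrite oppr_eq0 oner_eq0.
  apply: (neumann (del := x - be) (D := x - al) saB); first by rewrite subr_gt0.
  move=> u; rewrite /B ipDl !ipZl mulN1r !mulrBl ![x * _ - _]addrC !lerD2r !lerN2.
  by rewrite andbC; exact: T_bounds.
Qed.

Lemma op_polyB (P Q : {poly R}) u : op_poly (P - Q) T u = op_poly P T u - op_poly Q T u.
Proof.
rewrite !op_polyE rmorphB /= cpolyD; congr (_ + _).
by rewrite -mulN1r -polyC1 -polyCN cpolyZ scaleN1r.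
Qed.

Lemma iter_T k g : Re (iter k T (@e1 R G) g) = iter k (lop (amul a (adj a))) (dl R 1%g) g.
Proof.
elim: k g => [|k IH] g; first by rewrite /= /delta1 /dl; case: (_ == _).
rewrite !iterS -lop_comp [T _ _]/(Tl2 a (Tl2 (adj a) (iter k T (@e1 R G))) g) Tl2_Re.
by apply: eq_lop => h; rewrite Tl2_Re; apply: eq_lop => x; exact: IH.
Qed.

Lemma tr_op_poly P : ip (op_poly P T (@e1 R G)) (@e1 R G) = poly_tr (amul a (adj a)) P.
Proof.
rewrite ip_e1 /op_poly /poly_tr.
elim/big_ind2: _ => [//|? ? ? ? <- <-|i _]; first by rewrite l2D ReD.
by rewrite ReZ iter_T.
Qed.

(** [fun_calculus] is defined by choice, so a limit has to be produced. Polynomials within 1/(n + 1)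
    of ln on [al, be] are Cauchy in operator norm at rate 2/(n + 1), by [spectral_norm]. *)
Lemma calculus_exists : exists L, exists p : nat -> {poly R},
  (forall e : R, 0 < e -> \forall n \near \oo,
     forall x : R, spectrum T x%:C -> `|(p n).[x] - ln x| <= e) /\
  op_cvg (fun n => op_poly (p n) T) L.
Proof.
have [al0 albe] := l1inv_bounds ha; rewrite -/al -/be in al0 albe.
have ex n : exists P : {poly R}, forall x, al <= x <= be -> `|P.[x] - ln x| <= n.+1%:R^-1.
  by apply: ln_poly => //; rewrite invr_gt0.
have [p hp] := choice ex.
pose en n : R := 2 * n.+1%:R^-1.
have en0 n : 0 <= en n by rewrite mulr_ge0// invr_ge0.
have ecv : en @ \oo --> 0.
  by rewrite -[0](mulr0 (2 : R)); apply: cvgMr; exact: cvg_harmonic.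
have [||||L [NL hL]] := @op_limit _ _ (fun n => op_poly (p n) T) en.
- by move=> n; have [] := sa_op_poly (p n) sa_T.
- exact: en0.
- exact: ecv.
- move=> n m u nm'; rewrite -op_polyB; apply: spectral_norm => //; first exact: sa_T.
  move=> x /spectrum_T hx; rewrite hornerD hornerN.
  have h1 := hp n x hx; have h2 := hp m x hx.
  have h3 : m.+1%:R^-1 <= n.+1%:R^-1 :> R by rewrite lef_pV2 ?posrE// ler_nat.
  rewrite (_ : _ - _ = ((p n).[x] - ln x) - ((p m).[x] - ln x)); last by ring.
  apply: le_trans (ler_normB _ _) _; rewrite /en mulr_natl mulr2n; apply: lerD => //.
  exact: le_trans h3.
exists L, p; split.
  move=> e e0; move/cvgrPdist_le: (@cvg_harmonic R) => /(_ _ e0)[N _ hN].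
  exists N => // n /hN /=; rewrite sub0r normrN ger0_norm ?invr_ge0// => hn x /spectrum_T hx.
  by apply: le_trans hn; exact: hp.
move=> e e0; move/cvgrPdist_le: ecv => /(_ _ e0)[N _ hN].
exists N => // n /hN /=; rewrite sub0r normrN ger0_norm// => hn u.
by apply: le_trans (hL n u) _; rewrite ler_wpM2r ?nm_ge0.
Qed.

(** Whichever operator and polynomials p n the choice in [fun_calculus] yields, p n and P differ on
    the spectrum by at most eta up to an arbitrarily small error, hence so do p n(T) and P(T) in
    norm, and then their traces. The factor 2 undoes the 1/2 in the definition of the
    determinant. *)
Lemma FK_poly (P : {poly R}) (eta : R) :
  (forall x, al <= x <= be -> `|P.[x] - ln x| <= eta) ->
  `|2 * ln (FK_det (Tl2 a)) - poly_tr (amul a (adj a)) P| <= eta.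
Proof.
move=> hP; have [al0 albe] := l1inv_bounds ha; rewrite -/al -/be in al0 albe.
have eta0 : 0 <= eta by apply: le_trans (normr_ge0 _) (hP al _); rewrite lexx.
rewrite /FK_det expRK mulrA mulfV ?pnatr_eq0// mul1r adjoint_Tl2 -/T /tr -[Re (inner _ _)]/(ip _ _).
rewrite /fun_calculus; have := getPex calculus_exists; set L := get _ => -[p [hp hL]].
apply/ler_addgt0Pr => e e0; have e2 : 0 < e / 2 by rewrite divr_gt0.
have [N _ hN] := hp _ e2; have [M _ hM] := hL _ e2.
pose n := maxn N M.
have := hM n (leq_maxr N M) (@e1 R G); rewrite -/(nm _) -/(nm (@e1 R G)) nm_e1 mulr1 => h1.
have h2 : nm (op_poly (p n - P) T (@e1 R G)) <= e / 2 + eta.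
  rewrite -[leRHS]mulr1 -[X in _ <= _ * X](@nm_e1 R G); apply: spectral_norm => //; first exact: sa_T.
    by rewrite addr_ge0// ltW.
  move=> x xT; rewrite hornerD hornerN.
  rewrite (_ : _ - _ = ((p n).[x] - ln x) - (P.[x] - ln x)); last by ring.
  apply: le_trans (ler_normB _ _) _; apply: lerD.
    by apply: (hN n) => //; exact: leq_maxl.
  by apply: hP; exact: spectrum_T.
have ip1 u : `|ip u (@e1 R G)| <= nm u by have := cs_abs u (@e1 R G); rewrite nm_e1 mulr1.
rewrite -tr_op_poly.
have -> : ip (L (@e1 R G)) (@e1 R G) - ip (op_poly P T (@e1 R G)) (@e1 R G) =
   ip (op_poly (p n - P) T (@e1 R G)) (@e1 R G) -
   ip (op_poly (p n) T (@e1 R G) - L (@e1 R G)) (@e1 R G).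
  by rewrite op_polyB !ipDl !ipNl; ring.
apply: le_trans (ler_normB _ _) _.
apply: (@le_trans _ _ (nm (op_poly (p n - P) T (@e1 R G)) + nm (op_poly (p n) T (@e1 R G) - L (@e1 R G)))).
  by apply: lerD; exact: ip1.
lra.
Qed.

End FugledeKadison.

Section DetAsymptotics.
Local Open Scope complex_scope.
Variables (R : realType) (G : groupType).
Implicit Types a b : seq (R * G).

(** (a b)^(k+1) = a c with c = (b a)^k b, and the trace of a c is that of c a. It reconciles f f^*
    in the Fuglede-Kadison determinant with f^* f in the Gram matrices. *)
Lemma iter_amul_comm a b k : iter k (lop (amul a b)) (dl R 1%g) 1%g =
  iter k (lop (amul b a)) (dl R 1%g) 1%g.
Proof.
case: k => // k.
have [c hc] : exists c, forall y, iter k (lop (amul b a)) (lop b y) =1 lop c y.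
  elim: k => [|k [c hc]]; first by exists b.
  by exists (amul (amul b a) c) => y g; rewrite iterS -(lop_comp (amul b a)); apply: eq_lop => x; exact: hc.
have h1 y g : iter k.+1 (lop (amul a b)) y g = lop a (lop c y) g.
  rewrite -(eq_lop a (hc y)).
  elim: k g {c hc} => [|k IH] g; first by rewrite /= -lop_comp.
  rewrite iterS -lop_comp; apply: eq_lop => x; rewrite [RHS]/= -lop_comp.
  by apply: eq_lop => x'; exact: IH.
rewrite h1 lop_tr -(hc (lop a (dl R 1%g))) iterSr; congr (iter k _ _ _).
by apply/funext => g; rewrite lop_comp.
Qed.

(** The log determinant of the section and n times 2 log det f are both compared with n times the
    trace of one polynomial, which cancels. *)
Lemma det_asymp a w C : l1inv a w C -> forall eta : R, 0 < eta ->
  exists (K : seq G) (D : R), 0 <= D /\ forall n (e : 'I_n -> G), injective e ->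
    0 < \det (mat (amul (adj a) a) e e) /\
    `|ln (\det (mat (amul (adj a) a) e e)) - 2 * n%:R * ln (FK_det (Tl2 a))|
      <= n%:R * eta + D * (bd e K)%:R.
Proof.
move=> ha eta eta0; have [al0 albe] := l1inv_bounds ha.
have eta2 : 0 < eta / 2 by rewrite divr_gt0.
have [P hP] := ln_poly al0 albe eta2.
have hFK := FK_poly ha hP.
have [K [D [D0 hD]]] := szego (amul (adj a) a) al0 hP.
exists K, D; split=> // n e ie.
have [dpos hd] := hD n e ie (gram_sym a e) (fun v => gram_bounds ha v ie); split=> //.
have trE : poly_tr (amul a (adj a)) P = poly_tr (amul (adj a) a) P.
  by apply: eq_bigr => k _; rewrite iter_amul_comm.
rewrite trE in hFK.
set t := poly_tr _ P in hFK hd; set l := ln (\det _) in hd *; set F := ln (FK_det _) in hFK *.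
have -> : l - 2 * n%:R * F = (l - n%:R * t) - n%:R * (2 * F - t) by ring.
apply: le_trans (ler_normB _ _) _; rewrite normrM normr_nat.
have : n%:R * `|2 * F - t| <= n%:R * (eta / 2) by rewrite ler_wpM2l.
lra.
Qed.

End DetAsymptotics.

(** * Lifts of points of X_f *)

Section Circle.
Local Open Scope quotient_scope.
Variable R : realType.

Definition qc (x : R) : circle R := \pi_(quotient_topology (RmodZ R)) x.

Lemma qcB x y : qc (x - y) = qc x - qc y.
Proof. by rewrite /qc -[LHS]/(\pi_(RmodZ R) (x - y)) raddfB. Qed.

Lemma qc0 : qc 0 = 0.
Proof. by rewrite -(subrr 0) qcB subrr. Qed.

Lemma qcD x y : qc (x + y) = qc x + qc y.
Proof. by rewrite -[y in LHS]opprK qcB -[- y]sub0r qcB qc0 sub0r opprK. Qed.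

Lemma qc_eq x y : qc x = qc y <-> x - y \is a Num.int.
Proof.
rewrite /qc; split => [h|h].
  have : x = y %[mod RmodZ R] by exact: h.
  by move=> /eqP; rewrite -Quotient.idealrBE.
have /eqP : x == y %[mod RmodZ R] by rewrite -Quotient.idealrBE.
exact.
Qed.

Lemma qc_eq0 x : qc x = 0 <-> x \is a Num.int.
Proof. by rewrite -qc0 qc_eq subr0. Qed.

Lemma qcMz x (m : int) : qc (x *~ m) = qc x *~ m.
Proof.
have nat n : qc (x *+ n) = qc x *+ n.
  by elim: n => [|n IH]; rewrite ?mulr0n ?qc0// !mulrS qcD IH.
case: m => n; first by rewrite -!pmulrn.
by rewrite NegzE !mulrNz -!pmulrn -[- (x *+ n.+1)]sub0r qcB qc0 sub0r nat.
Qed.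

Lemma qc_sum (I : Type) (r : seq I) (F : I -> R) : qc (\sum_(i <- r) F i) = \sum_(i <- r) qc (F i).
Proof. by elim: r => [|i r IH]; rewrite ?big_nil ?qc0// !big_cons qcD IH. Qed.

Lemma qc_lift (c : circle R) : exists x, qc x = c /\ 0 <= x < 1.
Proof.
pose rc : R := generic_quotient.repr c.
exists (rc - (Num.floor rc)%:~R); split; last exact: frac_part.
rewrite -[RHS]reprK; apply/qc_eq; rewrite -/rc addrAC subrr sub0r rpredN.
exact: intr_int.
Qed.

Lemma qc_continuous : continuous qc.
Proof. exact: pi_continuous. Qed.

Lemma qc_open (O : set (circle R)) : open (qc @^-1` O) -> open O.
Proof. by []. Qed.

Definition cball (c : circle R) (eps : R) : set (circle R) :=
  [set c' | exists x y, [/\ qc x = c, qc y = c' & `|x - y| < eps]].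

Lemma cball_qc x y eps : cball (qc x) eps (qc y) <-> exists m : int, `|x - y - m%:~R| < eps.
Proof.
split=> [ [x' [y' [/qc_eq/intrP[m hm] /qc_eq/intrP[k hk] h]]]|[m h]].
  exists (k - m); move: h; congr (`|_| < _); rewrite intrB -hm -hk; ring.
exists x, (y + m%:~R); split=> //; last by rewrite opprD addrA.
by apply/qc_eq; rewrite addrAC subrr add0r intr_int.
Qed.

Lemma cball_open c eps : open (cball c eps).
Proof.
apply: qc_open; have [x [<- _]] := qc_lift c.
have -> : qc @^-1` cball (qc x) eps = \bigcup_(m in [set: int]) ball (x - m%:~R) eps.
  apply/seteqP; split=> y /=.
    move=> /cball_qc[m h]; exists m => //; rewrite /ball /=; move: h; congr (`|_| < _); ring.
  move=> [m _]; rewrite /ball /= => h; apply/cball_qc; exists m; move: h; congr (`|_| < _); ring.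
by apply: bigcup_open => m _; exact: ball_open.
Qed.

End Circle.

Section Points.
Local Open Scope quotient_scope.
Variables (R : realType) (G : groupType).
Local Notation TG := {ptws G -> circle R}.
Local Notation TR := {ptws G -> R}.

Definition qG (y : G -> R) : TG := fun g => qc (y g).

Lemma ptws_cvg (V : topologicalType) (F : set_system (G -> V)) (f : {ptws G -> V}) : Filter F ->
  (forall t, (fun g => g t) @ F --> f t) -> F --> f.
Proof.
move=> FF h; apply/cvg_sup => i.
rewrite cvg_image; last by rewrite eqEsubset; split=> v // _; exists (cst v).
move=> W /= hW; exists ((fun g => g i) @^-1` W); first exact: h hW.
by rewrite eqEsubset; split => [j [? + <-//]|j Wj]; exists (fun _ => j).
Qed.

Definition close (K : seq G) (eps : R) (y z : G -> R) := forall g, g \in K -> `|y g - z g| < eps.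

(** The sets [close K eps y] generate a filter along which every coordinate tends to that of y. So
    [qG] tends to [qG y] in the product topology, and one of these sets is mapped into O. *)
Lemma open_close (O : set TG) y : open O -> O (qG y) ->
  exists (K : seq G) (eps : R), 0 < eps /\ forall z, close K eps y z -> O (qG z).
Proof.
move=> oO Oy.
pose D : set (seq G * R) := [set p | 0 < p.2].
pose B (p : seq G * R) : set (G -> R) := [set z | close p.1 p.2 y z].
have FF : Filter (filter_from D B).
  apply: filter_from_filter; first by exists ([::], 1); exact: ltr01.
  move=> [K e] [K' e'] /= e0 e0'; exists (K ++ K', Num.min e e'); first by rewrite /D /= lt_min e0.
  by move=> z /= h; split=> g gK; have := h g; rewrite mem_cat gK ?orbT lt_min => /(_ isT)/andP[].
have cv : qG @ filter_from D B --> (qG y : TG).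
  apply: ptws_cvg => t W.
  move=> hW; have : nbhs (y t) (qc (R := R) @^-1` W) by exact: qc_continuous.
  move=> /nbhs_ballP[e e0 he]; exists ([:: t], e) => //= z /(_ t); rewrite inE eqxx => /(_ isT) h.
  exact: he.
have : nbhs (qG y : TG) O by exact: open_nbhs_nbhs.
move=> /cv[ [K e] e0 h]; exists K, e; split=> // z zc; exact: h.
Qed.

Lemma close_nbhs (K : seq G) (eps : R) (y : TR) : 0 < eps -> nbhs y [set z : TR | close K eps y z].
Proof.
have FF : Filter (nbhs y) := nbhs_filter y.
move=> e0; elim: K => [|k K IH].
  by apply: filterS filterT => z _ g; rewrite in_nil.
have hk : nbhs y ((fun z : TR => z k) @^-1` ball (y k) eps).
  by apply: proj_continuous; exact: nbhsx_ballx.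
apply: filterS2 IH hk => z h1 h2 g; rewrite inE => /orP[/eqP ->|]; last exact: h1.
exact: h2.
Qed.

Lemma ev_open g (O : set (circle R)) : open O -> open [set x : TG | O (x g)].
Proof.
move=> oO; have /continuousP h : continuous (fun x : TG => x g) by exact: proj_continuous.
exact: h oO.
Qed.

End Points.

Section GroupRing.
Local Open Scope quotient_scope.
Variables (R : realType) (G : groupType) (f : group_ring G).
Local Notation TG := {ptws G -> circle R}.

Definition ai : seq (int * G) := [seq (f s, s) | s <- finsupp f].
Definition ar : seq (R * G) := [seq (s.1%:~R, s.2) | s <- ai].

Lemma ar_lop (y : G -> R) g : lop ar y g = \sum_(s <- finsupp f) y (g * s)%g *~ f s.
Proof.
by rewrite /lop /ar /ai !big_map; apply: eq_bigr => s _ /=; rewrite mulrzl.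
Qed.

Lemma ar_coef g : ZG_L1 R f g = \sum_(s <- ar) s.1 * (g == s.2)%:R.
Proof.
rewrite /ar /ai !big_map /= /ZG_L1; have [gf|gf] := boolP (g \in finsupp f).
  rewrite (big_fsetD1 g)//= eqxx mulr1 big_seq big1 ?addr0// => s.
  by rewrite !inE => /andP[sg _]; rewrite eq_sym (negbTE sg) mulr0.
rewrite fsfun_dflt// big_seq big1// => s sf; case: eqP => [gs|_]; last by rewrite mulr0.
by rewrite gs sf in gf.
Qed.

Lemma Xf_lift (y : G -> R) : Xf f (qG y) <-> lop_int ar y.
Proof.
split=> h g.
  apply/qc_eq0; rewrite ar_lop qc_sum -[RHS](h g).
  by apply: eq_bigr => s _; rewrite qcMz.
have := h g; rewrite -qc_eq0 ar_lop qc_sum => {}h; rewrite -[RHS]h.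
by apply: eq_bigr => s _; rewrite qcMz.
Qed.

Lemma lift_ex (x : TG) : exists y : G -> R, qG y = x /\ forall g, 0 <= y g < 1.
Proof.
have [y hy] := choice (fun g => qc_lift (x g)); exists y; split=> [|g].
  by apply/funext => g; have [] := hy g.
by have [] := hy g.
Qed.

Lemma act_qG g (y : G -> R) : Defs.act g (qG y) = qG (fun h => y (g^-1 * h)%g).
Proof. by []. Qed.

Lemma adj_coef g : ZG_L1 R f g^-1%g = \sum_(s <- adj ar) s.1 * (g == s.2)%:R.
Proof.
rewrite ar_coef /adj [RHS]big_map; apply: eq_bigr => s _ /=.
by rewrite (can2_eq invgK invgK).
Qed.

Lemma in_L1_f : in_L1 (ZG_L1 R f).
Proof.
apply/in_L1P; eexists; apply: (l1bound_fin (A := finsupp f)) => g gf.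
by rewrite /ZG_L1 fsfun_dflt.
Qed.

Lemma int_closed (x : R) : (forall e, 0 < e -> exists m : int, `|x - m%:~R| <= e) -> x \is a Num.int.
Proof.
move=> h; have := frac_part x; set t := x - _ => /andP[t0 t1].
have [t0'|tn] := eqVneq t 0.
  by have -> : x = (Num.floor x)%:~R; [apply/eqP; rewrite -subr_eq0 -/t t0'|exact: intr_int].
have tp : 0 < t by rewrite lt_neqAle eq_sym tn.
have d0 : 0 < Num.min t (1 - t) / 2 by rewrite divr_gt0// lt_min tp subr_gt0.
have [m hm] := h _ d0.
have : `|t - (m - Num.floor x)%:~R| < Num.min t (1 - t).
  rewrite (_ : t - _ = x - m%:~R); last by rewrite /t intrB; ring.
  by apply: le_lt_trans hm _; rewrite ltr_pdivrMr// mulr_natr mulr2n ltrDl; move: d0; rewrite pmulr_lgt0.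
rewrite lt_min; set j := m - _ => /andP[]; have [j0|j1] := lerP j 0.
  have : (j%:~R : R) <= 0 by rewrite -[0]/(0%:~R) ler_int.
  by move=> jj /ltr_normlP[]; lra.
have : 1 <= (j%:~R : R) by rewrite -[1]/(1%:~R) ler_int; lia.
by move=> jj _ /ltr_normlP[]; lra.
Qed.

Lemma conv_fk (k : G -> R) g : Defs.conv (ZG_L1 R f) k g = lop ar (fun x => k x^-1%g) g^-1%g.
Proof.
have -> : Defs.conv (ZG_L1 R f) k g = lop ar (fun x => k (x^-1 * g)%g) 1%g.
  rewrite -(lop_has_sum _ _ ar_coef); congr rsum; apply/funext => x.
  by rewrite invg1 mul1g mulrC.
by apply: eq_bigr => s _; rewrite mul1g invMg invgK.
Qed.

Lemma conv_kf (k : G -> R) g : Defs.conv k (ZG_L1 R f) g = lop (adj ar) k g.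
Proof.
rewrite -(lop_has_sum (a := adj ar) (f := fun g => ZG_L1 R f g^-1%g)); last exact: adj_coef.
by congr rsum; apply/funext => x; rewrite invMg invgK.
Qed.

(** The inverse k of f and w determine each other by w = k^*; then f . k = 1 and k . f = 1 become
    the two equations of [l1inv]. *)
Lemma unit_l1inv : L1_unit (ZG_L1 R f) <-> exists w C, l1inv ar w C.
Proof.
split=> [ [_ [k [/in_L1P[C hC] fk kf]]]|[w [C [hw h1 h2]]]].
  exists (fun g => k g^-1%g), C; split.
  - by apply: (l1bound_reindex (q := fun g => g^-1%g)) hC => g; rewrite invgK.
  - move=> g; rewrite -[g]invgK -conv_fk fk /delta1 /dl invgK.
    by rewrite (can2_eq invgK invgK) invg1.
  - move=> g; rewrite -[RHS]/(delta1 R g) -kf conv_kf; apply: eq_lop => x.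
    by rewrite invgK.
split; first exact: in_L1_f.
exists (fun g => w g^-1%g); split.
- apply/in_L1P; exists C.
  by apply: (l1bound_reindex (q := fun g => g^-1%g)) hw => g; rewrite invgK.
- apply/funext => g; rewrite conv_fk -[RHS]/(dl R 1%g g).
  rewrite (_ : (fun x => w (x^-1)^-1%g) = w); last by apply/funext => x; rewrite invgK.
  by rewrite h1 /dl (can2_eq invgK invgK) invg1.
- by apply/funext => g; rewrite conv_kf h2.
Qed.

Lemma unit_expansive w C : l1inv ar w C -> expansive R f.
Proof.
(* As |f|_1 eps < 1, a lift bounded by eps of a point of X_f has an image under [lop ar] that is
   integral and below 1, hence 0. *)
move=> ha; pose eps : R := (nrm ar + 1)^-1 / 2.
have n0 := nrm_ge0 ar.
have eps0 : 0 < eps by rewrite divr_gt0// invr_gt0 ltr_wpDl.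
have eps1 : nrm ar * eps < 1.
  rewrite /eps mulrA ltr_pdivrMr// mul1r; apply: (@le_lt_trans _ _ 1); last by rewrite ltr1n.
  by rewrite ler_pdivrMr ?ltr_wpDl// mul1r lerDl.
pose O : set TG := [set x | cball 0 eps (x 1%g)].
exists (Xf f `&` O); split.
- by exists O => //; apply: (@ev_open R G 1%g (cball 0 eps)); exact: cball_open.
- split; first by move=> g; rewrite big1// => s _; rewrite mul0rz.
  by exists 0, 0; rewrite qc0 subrr normr0.
- apply/seteqP; split=> x /=; last first.
    move=> -> g _; exists (fun=> 0); last by [].
    split; first by move=> h; rewrite big1// => s _; rewrite mul0rz.
    by exists 0, 0; rewrite qc0 subrr normr0.
  move=> hx.
  have xO g : cball 0 eps (x g).
    have [x' [_ hx'] <-] := hx g I.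
    by rewrite /Defs.act mulVg.
  have xX : Xf f x.
    by have [x' [hX _] <-] := hx 1%g I; move=> h; rewrite /Defs.act invg1; under eq_bigr do rewrite mul1g; exact: hX.
  have [y hy] : exists y : G -> R, forall g, qc (y g) = x g /\ `|y g| < eps.
    suff h g : exists t, qc t = x g /\ `|t| < eps by have [y hy] := choice h; exists y.
    have [x1 [y1 [/qc_eq0/intrP[m hm] qy h]]] := xO g.
    exists (y1 - m%:~R); split; last by rewrite distrC -hm.
    by rewrite -qy; apply/qc_eq; rewrite addrAC subrr sub0r rpredN intr_int.
  have xE : x = qG y by apply/funext => g; have [] := hy g.
  have yb g : `|y g| <= eps by have [_ /ltW] := hy g.
  move: xX; rewrite xE Xf_lift => yint.
  have y0 : y =1 (fun=> 0).
    apply: (lop_inj0 ha yb) => g; apply: int_lt1 => //.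
    exact: le_lt_trans (lop_le _ _ yb) eps1.
  by apply/funext => g; rewrite /qG y0 qc0.
Qed.

Lemma expansive_inj : expansive R f -> inj_linfty ar.
Proof.
move=> [U [ [Os oO UE] U0 hU]] y M yM y0.
have q0 : qG (fun=> 0) = (fun=> 0) :> TG by apply/funext => g; rewrite /qG qc0.
have Oq0 : Os (qG (fun=> 0)) by move: U0; rewrite UE q0 => -[].
have [K [eps [eps0 hK]]] := open_close oO Oq0.
have M0 : 0 <= M by apply: le_trans (normr_ge0 _) (yM 1%g).
(* t y stays below eps, so all its translates lie in U, and below 1, so that it vanishes once it is
   integral. *)
pose t := Num.min eps 1 / (M + 1).
have c0 : 0 < Num.min eps 1 by rewrite lt_min eps0 ltr01.
have t0 : 0 < t by rewrite divr_gt0// ltr_wpDl.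
have ty g : `|t * y g| < Num.min eps 1.
  rewrite normrM (gtr0_norm t0) /t mulrAC ltr_pdivrMr ?ltr_wpDl// ltr_pM2l//.
  by apply: le_lt_trans (yM g) _; rewrite ltrDl.
have int0 : qG (fun g => t * y g) = (fun=> 0) :> TG.
  have : (\bigcap_(g in [set: G]) (Defs.act g @` U)) (qG (fun g => t * y g)).
    move=> g _; exists (qG (fun h => t * y (g * h)%g)); last first.
      by rewrite act_qG; apply/funext => h; rewrite /qG mulKVg.
    rewrite UE; split.
      apply/Xf_lift => h; rewrite lopZ lop_shift y0 mulr0; exact: rpred0.
    apply: hK => h _; rewrite sub0r normrN.
    by have := ty (g * h)%g; rewrite lt_min => /andP[].
  by rewrite hU.
move=> g; have := congr1 (fun x => x g) int0; rewrite /qG => /qc_eq0 hint.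
have : t * y g = 0.
  by apply: int_lt1 => //; have := ty g; rewrite lt_min => /andP[].
by move=> /eqP; rewrite mulf_eq0 (gt_eqF t0) /= => /eqP.
Qed.

Lemma expansive_l1inv : residually_finite G -> expansive R f -> exists w C, l1inv ar w C.
Proof. by move=> rf /expansive_inj; exact: l1_inverse. Qed.

(** Compactness of [0, 1]^G; the closed interval is why y g = 1 is allowed. If the claim failed, the
    lifts failing at (K, eps) would generate a filter. A cluster point is again a lift of a point of
    X_f, and a member of V around that point serves the failing lifts near it. *)
Lemma lebesgue_number (V : set (set TG)) : open_cover f V ->
  exists (K : seq G) (eps : R), 0 < eps /\ forall y : G -> R, (forall g, 0 <= y g <= 1) -> lop_int ar y ->
    exists2 U, V U & forall z, lop_int ar z ->
      (forall g, g \in K -> exists m : int, `|y g - z g - m%:~R| < eps) -> U (qG z).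
Proof.
move=> [Vo Vc]; apply: contrapT => no.
pose TR := {ptws G -> R}.
pose good (K : seq G) (eps : R) (y : G -> R) := exists2 U, V U & forall z, lop_int ar z ->
      (forall g, g \in K -> exists m : int, `|y g - z g - m%:~R| < eps) -> U (qG z).
pose A : set TR := [set y | forall g, y g \in `[0, 1]%R].
have cA : compact A.
  by apply: (@tychonoff G (fun=> R) (fun=> `[0, 1]%classic)) => g; exact: segment_compact.
pose D : set (seq G * R) := [set p | 0 < p.2].
pose B (p : seq G * R) : set TR := [set y | [/\ A y, lop_int ar y & ~ good p.1 p.2 y]].
have good_sub K K' (e e' : R) y : {subset K <= K'} -> e' <= e -> good K e y -> good K' e' y.
  move=> KK ee [U VU h]; exists U => // z hz hc; apply: h => // g gK.
  by have [m hm] := hc g (KK g gK); exists m; exact: lt_le_trans ee.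
have FF : ProperFilter (filter_from D B).
  apply: filter_from_proper; last first.
    move=> [K e] /= e0; apply: contrapT => nB; apply: no; exists K, e; split=> // y hy yi.
    apply: contrapT => ng; apply: nB; exists y; split=> // g; rewrite in_itv /=; exact: hy.
  apply: filter_from_filter; first by exists ([::], 1); exact: ltr01.
  move=> [K e] [K' e'] /= e0 e0'; exists (K ++ K', Num.min e e'); first by rewrite /D /= lt_min e0.
  move=> y /= [Ay yi ng]; split; split=> // h; apply: ng; apply: good_sub h => //.
  - by move=> g gK; rewrite mem_cat gK.
  - by rewrite ge_min lexx.
  - by move=> g gK; rewrite mem_cat gK orbT.
  - by rewrite ge_min lexx orbT.
have FA : filter_from D B A by exists ([::], 1) => [|y []//]; exact: ltr01.
have [y0 [Ay0 cl]] := cA _ FF FA.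
have near0 (K : seq G) (e : R) p : D p -> 0 < e -> exists y, B p y /\ close K e y0 y.
  move=> Dp e0; have FB : filter_from D B (B p) by exists p.
  by have [y [By yc]] := cl _ _ FB (close_nbhs K y0 e0); exists y.
have y0i : lop_int ar y0.
  move=> g.
  apply: int_closed => e e0; pose K := [seq (g * s.2)%g | s <- ar].
  have n0 : 0 < nrm ar + 1 by rewrite ltr_wpDl// nrm_ge0.
  have [|y [ [_ yi _] yc]] := near0 K (e / (nrm ar + 1)) ([::], 1) _ (divr_gt0 e0 n0); first exact: ltr01.
  have /intrP[m hm] := yi g; exists m; rewrite -hm -lopB.
  apply: (@le_trans _ _ (nrm ar * (e / (nrm ar + 1)))).
    by apply: lop_le_at => s sa; apply/ltW/yc; apply/mapP; exists s.
  by rewrite mulrCA ger_pMr// ler_pdivrMr// mul1r lerDl.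
have [U VU Uy0] : exists2 U, V U & U (qG y0).
  by have /Xf_lift := y0i; rewrite -Vc => -[U]; exists U.
have [Os oO UE] := Vo U VU.
have Oy0 : Os (qG y0) by move: Uy0; rewrite UE => -[].
have [K [e [e0 hK]]] := open_close oO Oy0.
have e2 : 0 < e / 2 by rewrite divr_gt0.
have [y [ [Ay yi ng] yc]] := near0 K (e / 2) (K, e / 2) e2 e2.
apply: ng; exists U => // z zi hz; rewrite UE; split; first exact/Xf_lift.
have [m hm] : exists m : G -> int, forall g, g \in K -> `|y g - z g - (m g)%:~R| < e / 2.
  suff h g : exists m : int, g \in K -> `|y g - z g - m%:~R| < e / 2.
    by have [m hm] := choice h; exists m.
  by have [/hz[m hm]|gK] := boolP (g \in K); [exists m|exists 0].
have -> : qG z = qG (fun g => z g + (m g)%:~R).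
  apply/funext => g; apply/qc_eq; rewrite opprD addrA subrr sub0r rpredN; exact: intr_int.
apply: hK => g gK; rewrite (splitr e).
rewrite (_ : _ - _ = (y0 g - y g) + (y g - z g - (m g)%:~R)); last by ring.
by apply: le_lt_trans (ler_normD _ _) _; apply: ltrD; [exact: yc|exact: hm].
Qed.

End GroupRing.

(** * Exponential growth of separated families *)

Section Counting.
Variables (R : realType) (G : groupType).

Definition real_seq (ai : seq (int * G)) : seq (R * G) := [seq (s.1%:~R, s.2) | s <- ai].

Lemma real_amul ai bi : real_seq (amul ai bi) = amul (real_seq ai) (real_seq bi).
Proof.
rewrite /real_seq /amul map_allpairs allpairs_mapl allpairs_mapr /=.
by apply: eq_allpairs => s t; rewrite /= intrM.
Qed.

Lemma real_adj ai : real_seq (adj ai) = adj (real_seq ai).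
Proof. by rewrite /real_seq /adj -!map_comp. Qed.

Lemma bd_cat n (e : 'I_n -> G) K K' : bd e (K ++ K') = (bd e K + bd e K')%N.
Proof. by rewrite /bd big_cat. Qed.

Lemma dist_half (u v p e : R) : `|2 * u - p| <= e -> `|2 * v - p| <= e -> `|v - u| <= e.
Proof.
by move=> /ler_normlP[h3 h4] /ler_normlP[h5 h6]; apply/ler_normlP; split; lra.
Qed.

(** f and f^* have the same determinant, since polynomials in f f^* and in f^* f have equal traces.
    The bound for X_f thus involves a single rate. *)
Lemma lnFK_adj (a : seq (R * G)) w C : l1inv a w C ->
  ln (FK_det (Tl2 (adj a))) = ln (FK_det (Tl2 a)).
Proof.
move=> ha; have [al0 albe] := l1inv_bounds ha.
apply/eqP; rewrite -subr_eq0 -normr_eq0 eq_le normr_ge0 andbT.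
apply/ler_addgt0Pl => e e0; rewrite addr0.
have [P hP] := ln_poly al0 albe e0.
have h1 := FK_poly ha hP.
have h2 : `|2 * ln (FK_det (Tl2 (adj a))) - poly_tr (amul (adj a) (adj (adj a))) P| <= e.
  by apply: (FK_poly (l1inv_adj ha)) => x; rewrite nrm_adj; exact: hP.
have trE : poly_tr (amul (adj a) (adj (adj a))) P = poly_tr (amul a (adj a)) P.
  by rewrite adjK; apply: eq_bigr => k _; rewrite iter_amul_comm.
by rewrite trE in h2; exact: dist_half h1 h2.
Qed.

(** The section determinants of f^* f grow like e^(2 n L) up to boundary terms. The counting uses
    this rate alone; L will be log det f. *)
Definition gram_rate (a : seq (R * G)) (L : R) := forall eta : R, 0 < eta ->
  exists (K : seq G) (D : R), 0 <= D /\ forall n (e : 'I_n -> G), injective e ->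
    0 < \det (mat (amul (adj a) a) e e) /\
    `|ln (\det (mat (amul (adj a) a) e e)) - 2 * n%:R * L| <= n%:R * eta + D * (bd e K)%:R.

Section Lower.
Variables (ai : seq (int * G)) (w : G -> R) (C : R).
Let a := real_seq ai.
Hypothesis ha : l1inv a w C.
Variable L : R.
Hypothesis hL : gram_rate a L.

Lemma det_gram_int n (e : 'I_n -> G) :
  (\det (mat (amul (adj ai) ai) e e))%:~R = \det (mat (amul (adj a) a) e e) :> R.
Proof. by rewrite -det_map_mx map_mat -/(real_seq _) real_amul real_adj. Qed.

(** The logarithm of [separated_lower]; the square there turns 2 L into L. K and eps precede eta
    because they define one open cover on which the entropy is attained. *)
Lemma sep_lower_exp : exists (K : seq G) (eps : R), 0 < eps /\ forall eta : R, 0 < eta ->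
  exists (K' : seq G) (D : R), 0 <= D /\ forall n (e : 'I_n -> G), injective e ->
    exists (I : finType) (y : I -> G -> R), [/\ forall i, lop_int a (y i), sep (window e K) eps y &
      expR (n%:R * L - n%:R * eta - D * (bd e K')%:R) <= #|I|%:R].
Proof.
have [K [eps [c [eps0 c0 H]]]] := separated_lower ha.
exists K, eps; split=> // eta eta0.
have [K1 [D1 [D10 hD]]] := hL eta0.
(* x <= eta bounds ln (1 + x) by eta, while x^bd costs only -ln x per boundary point. *)
pose x : R := Num.min eta 1.
have x01 : 0 < x <= 1 by rewrite /x lt_min eta0 ltr01 ge_min lexx orbT.
have /andP[x0 x1] := x01.
have lx : ln x <= 0 by exact: ln_le0.
have lc : 0 <= ln (c%:R : R) by rewrite ln_ge0// ler1n.
exists (K1 ++ K), (D1 + (eta - ln x + 2 * ln c%:R)); split; first by lra.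
move=> n e ie; have [I [y [yi ys hy]]] := H n e ie; exists I, y; split=> //.
have [d0 /ler_normlP[hd _]] := hD n e ie.
have := hy x x01; rewrite det_gram_int; set d := \det _ in d0 hd *; set b := bd e K.
move=> {}hy; have xb : 0 < x ^+ b by exact: exprn_gt0.
have c0' : 0 < (c%:R : R) by rewrite ltr0n.
have N0 : 0 < (#|I|%:R : R).
  rewrite lt_neqAle ler0n andbT; apply/eqP => N0; move: hy; rewrite -N0 mul0r expr0n mulr0.
  by rewrite leNgt mulr_gt0.
have x10 : 0 < 1 + x by rewrite ltr_wpDl.
have := hy; rewrite -ler_ln ?posrE ?mulr_gt0// ?exprn_gt0// ?mulr_gt0// ?exprn_gt0//.
rewrite !lnM ?posrE ?exprn_gt0// ?mulr_gt0// ?exprn_gt0// !lnXn ?mulr_gt0// ?exprn_gt0//.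
rewrite -!(mulr_natr (ln _)) natrD bd_cat natrD.
have l1x : ln (1 + x) <= eta.
  by apply: (@le_trans _ _ x); [apply: le_ln1Dx; lra|rewrite ge_min lexx].
rewrite -/b => h; rewrite -[leRHS](@lnK R) ?posrE// ler_expR.
have b0 : 0 <= (b%:R : R) by []; have n0 : 0 <= (n%:R : R) by [].
have b1 : 0 <= ((bd e K1)%:R : R) by [].
have m1 : ln (1 + x) * (n%:R + b%:R) <= eta * (n%:R + b%:R) by rewrite ler_wpM2r// addr_ge0.
have p1 : 0 <= D1 * (bd e K1)%:R by rewrite mulr_ge0.
have p2 : 0 <= (eta - ln x + 2 * ln c%:R) * (bd e K1)%:R by rewrite mulr_ge0//; lra.
have p3 : 0 <= D1 * b%:R by rewrite mulr_ge0.
have p4 : 0 <= eta * b%:R by rewrite mulr_ge0// ltW.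
have p5 : 0 <= - ln x * b%:R by rewrite mulr_ge0//; lra.
have p6 : 0 <= ln (c%:R : R) * b%:R by rewrite mulr_ge0.
lra.
Qed.

Lemma sep_gram_upper (Kw : seq G) (eps eta : R) : 0 < eps -> 0 < eta ->
  exists (K' : seq G) (D : R), 0 <= D /\ forall n (e : 'I_n -> G), injective e ->
    forall (I : finType) (y : I -> G -> R), (forall i, lop_int (amul (adj a) a) (y i)) ->
      sep (window e Kw) eps y -> #|I|%:R <= expR (2 * n%:R * L + n%:R * eta + D * (bd e K')%:R).
Proof.
move=> eps0 eta0; have [al0 _] := l1inv_bounds ha.
pose Kw' := undup (1%g :: Kw).
have Kw1 : 1%g \in Kw' by rewrite mem_undup inE eqxx.
have [K [q1 [q H]]] := separated_upper (amul (adj ai) ai) al0 eps0 Kw1 (undup_uniq _).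
have eta2 : 0 < eta / 2 by rewrite divr_gt0.
have [K1 [D1 [D10 hD]]] := hL eta2.
have q0 : 0 < (q.+1%:R : R) by rewrite ltr0n.
have q10 : 0 < (q1.+1%:R : R) by rewrite ltr0n.
(* This makes ln (1 + (q + 1) x) at most eta / 2; the other half of eta is spent on the
   determinant. *)
pose x : R := Num.min (eta / 2 / q.+1%:R) 1.
have x01 : 0 < x <= 1 by rewrite /x lt_min divr_gt0// ltr01 ge_min lexx orbT.
have /andP[x0 x1] := x01.
have lx : ln x <= 0 by exact: ln_le0.
have lq : 0 <= ln (q1.+1%:R : R) by rewrite ln_ge0// ler1n.
exists (K1 ++ K), (D1 + (ln q1.+1%:R + eta - 2 * ln x)); split; first by lra.
move=> n e ie I y yi ys.
have [d0 /ler_normlP[_ hd]] := hD n e ie.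
have [N0|] := eqVneq (#|I|%:R : R) 0; first by rewrite N0 expR_ge0.
rewrite neq_lt ltNge ler0n /= => N0.
have := H n e ie; rewrite -/(real_seq _) real_amul real_adj => {}H.
have pos : positive_by (C ^+ 2)^-1 (mat (amul (adj a) a) e e).
  by move=> v; have /andP[] := gram_bounds ha v ie.
have ys' : sep (window e Kw') eps y.
  move=> i j ij; have [g gW hg] := ys i j ij; exists g => //.
  move: gW => /windowP[l [k [kK ->]]]; apply/windowP; exists l, k; split=> //.
  by rewrite mem_undup inE kK orbT.
have := H pos I y yi ys' x x01; set d := \det _ in d0 hd *; set b := bd e K.
rewrite (gtr0_norm d0) => h.
have qx : 0 < 1 + q.+1%:R * x by rewrite ltr_wpDr// mulr_ge0 // ltW.
move: h; rewrite -ler_ln ?posrE ?mulr_gt0// ?exprn_gt0// ?mulr_gt0// ?exprn_gt0//.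
rewrite !lnM ?posrE ?mulr_gt0// ?exprn_gt0// !lnXn// -!(mulr_natr (ln _)) natrD natrM bd_cat natrD => h.
have lqx : ln (1 + q.+1%:R * x) <= eta / 2.
  have qx0 : 0 < q.+1%:R * x by rewrite mulr_gt0.
  apply: (@le_trans _ _ (q.+1%:R * x)); first by apply: le_ln1Dx; lra.
  by rewrite mulrC -ler_pdivlMr// ge_min lexx.
rewrite -[leLHS](@lnK R) ?posrE// ler_expR.
have b0 : 0 <= (b%:R : R) by []; have n0 : 0 <= (n%:R : R) by [].
have b1 : 0 <= ((bd e K1)%:R : R) by [].
have m1 : ln (1 + q.+1%:R * x) * (n%:R + b%:R) <= eta / 2 * (n%:R + b%:R) by rewrite ler_wpM2r// addr_ge0.
have p1 : 0 <= D1 * (bd e K1)%:R by rewrite mulr_ge0.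
have p2 : 0 <= (ln q1.+1%:R + eta - 2 * ln x) * (bd e K1)%:R by rewrite mulr_ge0//; lra.
have p3 : 0 <= D1 * b%:R by rewrite mulr_ge0.
have p4 : 0 <= eta * b%:R by rewrite mulr_ge0// ltW.
lra.
Qed.

End Lower.

Section Product.
Variables (ai : seq (int * G)) (w : G -> R) (C : R).
Let a := real_seq ai.
Hypothesis ha : l1inv a w C.

(* If T_a y is integral and z~ is a lift of a point z of X_(f^* ), then
   T_a (y + W z~) = T_a y + z~, so y + W z~ is a lift of a point of X_(f^* f). *)
Lemma sep_product (K1 K2 : seq G) (eps1 eps2 : R) : 0 < eps1 -> 0 < eps2 ->
  exists (K3 : seq G) (eps : R), 0 < eps /\ forall n (e : 'I_n -> G) (I J : finType)
    (y : I -> G -> R) (z : J -> G -> R),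
    (forall i, lop_int a (y i)) -> sep (window e K1) eps1 y ->
    (forall j, lop_int (adj a) (z j)) -> sep (window e K2) eps2 z ->
    exists u : I * J -> G -> R,
      (forall p, lop_int (amul (adj a) a) (u p)) /\ sep (window e K3) eps u.
Proof.
move=> eps10 eps20.
have n0 : 0 < nrm a + 1 by rewrite ltr_wpDl// nrm_ge0.
(* For equal second indices, eps <= eps1 leads back to the separation of y. For different ones,
   [lop a] maps the difference to that of the z modulo Z and enlarges the error at most to
   [nrm a * eps], which is below eps2; this is also why the window contains K2 times the support of
   f. *)
pose eps := Num.min eps1 (eps2 / (nrm a + 1)).
have eps0 : 0 < eps by rewrite /eps lt_min eps10 divr_gt0.
exists (K1 ++ [seq (k * s.2)%g | k <- K2, s <- a]), eps; split=> // n e I J y z yi ys zi zs.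
(* The lifts are reduced modulo Z because [Wop w] is controlled on bounded functions. *)
pose zt j g := z j g - (Num.floor (z j g))%:~R.
have ztb j g : `|zt j g| <= 1.
  by have /andP[h1 h2] := frac_part (z j g); rewrite ger0_norm// ltW.
have Wz j : lop a (Wop w (zt j)) =1 zt j by exact: (lop_Wop ha (ztb j)).
have lop_int_fun b (m : G -> int) g : lop (real_seq b) (fun x => (m x)%:~R) g \is a Num.int.
  by rewrite lop_intr intr_int.
exists (fun p g => y p.1 g + Wop w (zt p.2) g); split.
- move=> [i j] g /=; rewrite -lop_comp.
  have [m hm] : exists m : G -> int, forall x, lop a (y i) x = (m x)%:~R.
    suff h x : exists m : int, lop a (y i) x = m%:~R by have [m hm] := choice h; exists m.
    by have /intrP[m hm] := yi i x; exists m.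
  rewrite (@eq_lop _ _ (adj a) _ (fun x => (m x - Num.floor (z j x))%:~R + z j x)); last first.
    by move=> x; rewrite lopD hm Wz /zt intrB; ring.
  by rewrite lopD rpredD//; [rewrite -real_adj; exact: lop_int_fun|exact: zi].
- move=> [i j] [i' j'] ij /=; apply: contrapT => no.
  have near g : g \in window e (K1 ++ [seq (k * s.2)%g | k <- K2, s <- a]) ->
      exists m : int, `|y i g + Wop w (zt j) g - (y i' g + Wop w (zt j') g) - m%:~R| < eps.
    move=> gW; apply: contrapT => nm; apply: no; exists g => // m; rewrite leNgt; apply/negP => h.
    by apply: nm; exists m.
  have [jj|jj] := eqVneq j j'.
    have ii : i <> i' by move=> ii; apply: ij; rewrite ii jj.
    have [g gW hg] := ys i i' ii; have [|m hm] := near g.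
      by move: gW => /windowP[l [k [kK ->]]]; apply/windowP; exists l, k; rewrite mem_cat kK.
    have := hg m; rewrite leNgt => /negP; apply; move: hm; rewrite jj opprD addrACA subrr addr0.
    by move=> /lt_le_trans; apply; rewrite ge_min lexx.
  have [h hW hh] := zs j j' (elimN eqP jj).
  have [m hm] : exists m : G -> int, forall s, s \in a ->
      `|y i (h * s.2)%g + Wop w (zt j) (h * s.2)%g -
        (y i' (h * s.2)%g + Wop w (zt j') (h * s.2)%g) - (m (h * s.2)%g)%:~R| <= eps.
    pose S := [seq (h * s.2)%g | s <- a].
    suff hx x : exists m : int, x \in S ->
        `|y i x + Wop w (zt j) x - (y i' x + Wop w (zt j') x) - m%:~R| <= eps.
      have [m hm] := choice hx; exists m => s sa; apply: hm; apply/mapP; by exists s.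
    have [xS|xS] := boolP (x \in S); last by exists 0.
    have [|m hm] := near x; last by exists m => _; exact: ltW.
    move: xS => /mapP[s sa ->]; move: hW => /windowP[l [k [kK ->]]].
    apply/windowP; exists l, (k * s.2)%g; rewrite mulgA; split=> //.
    by rewrite mem_cat; apply/orP; right; apply/allpairsP; exists (k, s).
  have := @lop_le_at _ _ a (fun x => y i x + Wop w (zt j) x - (y i' x + Wop w (zt j') x) - (m x)%:~R) _ h hm.
  have E (u1 u2 u3 u4 u5 : G -> R) : lop a (fun x => u1 x + u2 x - (u3 x + u4 x) - u5 x) h =
      lop a u1 h + lop a u2 h - (lop a u3 h + lop a u4 h) - lop a u5 h.
    rewrite (lopB a (fun x => u1 x + u2 x - (u3 x + u4 x))) (lopB a (fun x => u1 x + u2 x)).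
    by rewrite (lopD a u1) (lopD a u3).
  rewrite E !Wz.
  have /intrP[m1 ->] := yi i h; have /intrP[m2 ->] := yi i' h.
  rewrite (lop_intr R ai m h) => hle.
  have := hh (Num.floor (z j h) - Num.floor (z j' h) - m1 + m2 + lop ai m h).
  rewrite leNgt => /negP; apply; apply: le_lt_trans (_ : nrm a * eps < eps2).
    by apply: le_trans hle; rewrite /zt !(intrB, intrD) le_eqVlt; apply/orP; left; apply/eqP; congr `|_|; ring.
  have : eps * (nrm a + 1) <= eps2 by rewrite -ler_pdivlMr// ge_min lexx orbT.
  by rewrite mulrDr mulr1 mulrC; lra.
Qed.

(** The family is multiplied by one of size about e^(n L) for f^*; dividing the bound e^(2 n L) for
    the product leaves e^(n L). *)
Lemma sep_upper_exp (L : R) (K1 : seq G) (eps1 eta : R) : gram_rate a L -> gram_rate (adj a) L -> 0 < eps1 -> 0 < eta ->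
  exists (K' : seq G) (D : R), 0 <= D /\ forall n (e : 'I_n -> G), injective e ->
    forall (I : finType) (y : I -> G -> R), (forall i, lop_int a (y i)) ->
      sep (window e K1) eps1 y ->
      #|I|%:R <= expR (n%:R * L + n%:R * eta + D * (bd e K')%:R).
Proof.
move=> hL hL' eps10 eta0; have ha' := l1inv_adj ha; rewrite -[adj a]real_adj in ha' hL'.
have [K2 [eps2 [eps20 low]]] := sep_lower_exp ha' hL'.
have [K3 [eps3 [eps30 prod]]] := sep_product K1 K2 eps10 eps20.
have eta2 : 0 < eta / 2 by rewrite divr_gt0.
have [K4 [D4 [D40 up]]] := sep_gram_upper ha hL K3 eps30 eta2.
have [K5 [D5 [D50 {}low]]] := low _ eta2.
exists (K4 ++ K5), (D4 + D5); split; first exact: addr_ge0.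
move=> n e ie I y yi ys.
have [J [z [zi zs zN]]] := low n e ie.

have [|u [ui us]] := prod n e I J y z yi ys _ zs; first by move=> j; rewrite -real_adj; exact: zi.
have := up n e ie _ u ui us; rewrite card_prod natrM => h.
set X := expR _ in zN; have X0 : 0 < X by exact: expR_gt0.
rewrite -(ler_pM2r X0); apply: le_trans (ler_wpM2l (ler0n _ _) zN) _.
apply: le_trans h _; rewrite -expRD ler_expR bd_cat natrD.
have : 0 <= D4 * (bd e K5)%:R by rewrite mulr_ge0.
have : 0 <= D5 * (bd e K4)%:R by rewrite mulr_ge0.
lra.
Qed.

End Product.

End Counting.

(** * Covers and entropy *)

Section Folner.
Variables (R : realType) (G : groupType).

(* The sets of [cover_join F V] constrain x at the points g^-1 k with g in F,
   hence the window F^-1. *)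
Definition inv_enum (A : {fset G}) : 'I_#|`A|%fset -> G := fun j => (nth 1%g (enum_fset A) j)^-1%g.

Lemma inv_enum_inj (A : {fset G}) : injective (@inv_enum A).
Proof.
move=> i j /invg_inj /eqP; rewrite nth_uniq ?fset_uniq ?ltn_ord// => /eqP.
exact: val_inj.
Qed.

Lemma codom_inv_enum (A : {fset G}) g : (g \in codom (@inv_enum A)) = (g^-1%g \in A).
Proof.
apply/codomP/idP => [[j ->]|gA].
  by rewrite /inv_enum invgK; apply: mem_nth; exact: ltn_ord.
have h : (index g^-1%g (enum_fset A) < #|` A|)%N by rewrite index_mem.
by exists (Ordinal h); rewrite /inv_enum /= nth_index// invgK.
Qed.

(** For x in A, the point x^-1 leaves the window under right translation by k exactly when k^-1 x
    leaves A. *)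
Lemma bd_inv_enum1 (A : {fset G}) k :
  (#|[pred j | (@inv_enum A j * k)%g \notin codom (@inv_enum A)]| <=
   #|` ([fset (k^-1 * x)%g | x in A] `\` A)%fset|)%N.
Proof.
rewrite cardE -(size_map (fun j => (inv_enum j * k)^-1%g)); apply: uniq_leq_size.
  by rewrite map_inj_uniq ?enum_uniq// => i j /invg_inj /mulIg; exact: inv_enum_inj.
move=> g /mapP[j]; rewrite mem_enum inE codom_inv_enum => hj ->.
rewrite -[_ \in _]/(_ \in ([fset (k^-1 * x)%g | x in A] `\` A)%fset) inE hj /=.
apply/imfsetP; exists (inv_enum j)^-1%g; last by rewrite invMg.
by rewrite /= -codom_inv_enum codom_f.
Qed.

Lemma folner_bd (F : nat -> {fset G}) (K : seq G) (del : R) : folner R F -> 0 < del ->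
  exists N, forall n, (N <= n)%N -> (bd (@inv_enum (F n)) K)%:R <= del * #|` F n|%:R.
Proof.
move=> [F0 hF]; elim: K del => [|k K IH] del del0.
  by exists 0%N => n _; rewrite /bd big_nil mulr_ge0// ltW.
have d2 : 0 < del / 2 by rewrite divr_gt0.
have [N hN] := IH _ d2.
have /cvgrPdist_le/(_ _ d2)[M _ hM] := hF k^-1%g.
exists (maxn N M) => n; rewrite geq_max => /andP[Nn Mn].
rewrite /bd big_cons natrD (splitr del) mulrDl; apply: lerD; last exact: hN.
have Fn0 : 0 < (#|` F n|%:R : R) by rewrite ltr0n lt0n cardfs_eq0.
have := hM n Mn; rewrite /= sub0r normrN ger0_norm ?divr_ge0// ler_pdivrMr// => h.
apply: le_trans h; rewrite ler_nat; apply: leq_trans (bd_inv_enum1 _ _) _.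
by apply: fsubset_leq_card; exact: fsubsetUl.
Qed.

End Folner.

Lemma fin_card (I : finType) : ([set: I] #= `I_#|I|)%card.
Proof.
have -> : [set: I] = enum_val @` [set: 'I_#|I|].
  by apply/seteqP; split=> // i _; exists (enum_rank i); rewrite ?enum_rankK.
apply: card_eq_trans (inj_card_eq _) _; first by move=> i j _ _; exact: enum_val_inj.
by rewrite card_eq_sym; exact: card_II.
Qed.

Section Subcovers.
Variables (R : realType) (G : groupType) (f : group_ring G).
Local Notation TG := {ptws G -> circle R}.
Implicit Types (V : set (set TG)) (A : {fset G}).
Local Notation a := (ar R f).

Lemma act_image g (U : set TG) x : (Defs.act g^-1%g @` U) x <-> U (Defs.act g x).
Proof.
split=> [[y Uy <-]|h].
  rewrite (_ : Defs.act g _ = y)//; apply/funext => h.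
  by rewrite /Defs.act invgK mulKVg.
exists (Defs.act g x) => //; apply/funext => k.
by rewrite /Defs.act invgK mulKg.
Qed.

Lemma Xf_act g (x : TG) : Xf f x -> Xf f (Defs.act g x).
Proof.
by move=> h k; rewrite /Defs.act; under eq_bigr do rewrite mulgA; exact: h.
Qed.

Lemma subcover_numberP V n : has_subcover f V n ->
  has_subcover f V (subcover_number f V) /\ (subcover_number f V <= n)%N.
Proof.
move=> hn; have ex : exists n, `[< has_subcover f V n >] by exists n; apply/asboolP.
case: (ex_minnP ex) => m /asboolP hm hmin.
have : [set n | has_subcover f V n /\ forall m, has_subcover f V m -> (n <= m)%N] m.
  by split=> // k hk; apply: hmin; apply/asboolP.
move=> /(xgetI 0%N); rewrite -/(subcover_number f V) => -[h1 h2]; split=> //.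
exact: h2.
Qed.

Lemma subcover_gt0 V n : has_subcover f V n -> (0 < n)%N.
Proof.
move=> [C [_ UC CI]]; rewrite lt0n; apply/eqP => n0.
move: CI; rewrite n0 II0 card_eq0 => /eqP C0.
have : Xf f (fun=> 0 : circle R) by move=> g; rewrite big1// => s _; rewrite mul0rz.
by rewrite -UC C0 => -[].
Qed.

Lemma sepW n (e : 'I_n -> G) K (eps : R) (I : finType) (y : I -> G -> R) (x : G -> R) :
  sep (window e K) eps y ->
  (forall i, exists2 g, g \in window e K & forall m : int, eps <= `|y i g - x g - m%:~R|) ->
  sep (window e K) eps (fun i : option I => if i is Some i' then y i' else x).
Proof.
move=> ys hx [i|] [j|] // ij.
- by apply: ys => ij'; apply: ij; rewrite ij'.
- have [g gW h] := hx j; exists g => // m; rewrite distrC.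
  have := h (- m); congr (_ <= `|_|); rewrite intrN; ring.
Qed.

(** A separated family of maximal size spans: every point is eps-close modulo Z on the window to
    some y i. For each i and each g in A, a member of V contains all points close to the translate
    of y i by g; intersecting over g gives a subcover of the join indexed by i. *)
Lemma subcover_upper V A (K : seq G) (eps X : R) : open_cover f V -> A != fset0 ->
  (forall y : G -> R, (forall g, 0 <= y g <= 1) -> lop_int a y ->
    exists2 U, V U & forall z, lop_int a z ->
      (forall g, g \in K -> exists m : int, `|y g - z g - m%:~R| < eps) -> U (qG z)) ->
  (forall (I : finType) (y : I -> G -> R), (forall i, lop_int a (y i)) ->
    sep (window (@inv_enum G A) K) eps y -> #|I|%:R <= X) ->
  exists n, n%:R <= X /\ has_subcover f (cover_join A V) n.
Proof.
move=> [Vo Vc] A0 leb hX; set W := window _ _ in hX.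
pose P k := `[< exists (I : finType) (y : I -> G -> R), [/\ #|I| = k, forall i, lop_int a (y i),
  forall i g, 0 <= y i g <= 1 & sep W eps y] >].
have P0 : exists k, P k.
  exists #|{: void}|; apply/asboolP; exists void, (fun v : void => match v with end).
  by split=> // -[].
have Pb k : P k -> (k <= Num.bound `|X|)%N.
  move=> /asboolP[I [y [<- yi _ ys]]]; rewrite -(ler_nat R); apply: le_trans (hX I y yi ys) _.
  by apply: le_trans (ler_norm _) _; apply: ltW; exact: archi_boundP (normr_ge0 X).
case: (ex_maxnP P0 Pb) => k /asboolP[I [y [Ik yi y01 ys]]] kmax.
have span x : (forall g, 0 <= x g <= 1) -> lop_int a x ->
    exists i, forall g, g \in W -> exists m : int, `|y i g - x g - m%:~R| < eps.
  move=> x01 xi; apply: contrapT => no.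
  have : P k.+1.
    apply/asboolP; exists (option I), (fun i => if i is Some i' then y i' else x).
    split; [by rewrite card_option Ik|by case|by case|].
    apply: sepW => // i; apply: contrapT => ni; apply: no; exists i => g gW.
    apply: contrapT => nm; apply: ni; exists g => // m; rewrite leNgt; apply/negP => h.
    by apply: nm; exists m.
  by move=> /kmax; rewrite ltnn.
have [U hU] : exists U : I * G -> set TG, forall p, V (U p) /\ forall z, lop_int a z ->
      (forall g, g \in K -> exists m : int, `|y p.1 (p.2^-1 * g)%g - z g - m%:~R| < eps) -> U p (qG z).
  suff h (p : I * G) : exists U, V U /\ forall z, lop_int a z ->
      (forall g, g \in K -> exists m : int, `|y p.1 (p.2^-1 * g)%g - z g - m%:~R| < eps) -> U (qG z).
    by have [U hU] := choice h; exists U.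
  have [||U VU h] := leb (fun g => y p.1 (p.2^-1 * g)%g).
  - by move=> g; exact: y01.
  - by move=> g; rewrite lop_shift; exact: yi.
  - by exists U.
pose J i : set TG := \bigcap_(g in [set` A]) (Defs.act g^-1%g @` U (i, g)).
pose C : set (set TG) := J @` [set: I].
have Cfin : (C #<= `I_k)%card.
  apply: card_le_trans (card_image_le _ _) _; rewrite -Ik.
  by have := fin_card I; rewrite card_eq_le => /andP[].
have [n Cn] : finite_set C by apply: card_le_finite Cfin _; exact: finite_II.
have nk : (n <= k)%N.
  rewrite -card_le_II; apply: card_le_trans Cfin.
  by move: Cn; rewrite card_eq_le => /andP[].
exists n; split.
  by apply: (@le_trans _ _ (#|I|%:R)); [rewrite ler_nat Ik|exact: hX yi ys].
exists C; split=> //.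
- move=> _ [i _ <-]; exists (fun g => U (i, g)); split=> // g _.
  by have [] := hU (i, g).
- apply/seteqP; split=> [x [_ [i _ <-] hx]|x hx].
    have /fset0Pn[g gA] := A0.
    have /act_image := hx g gA; have [VU _] := hU (i, g).
    have [Os _ ->] := Vo _ VU => -[hXf _].
    have := Xf_act g^-1%g hXf; rewrite (_ : Defs.act _ (Defs.act g x) = x)//.
    by apply/funext => h; rewrite /Defs.act invgK mulKg.
  have [z [zx z01]] := lift_ex x.
  have zi : lop_int a z by apply/Xf_lift; rewrite zx.
  have [|i hi] := span z _ zi; first by move=> g; have /andP[-> /ltW ->] := z01 g.
  exists (J i); first by exists i.
  move=> g gA; apply/act_image; rewrite -zx.
  rewrite (_ : Defs.act g (qG z) = qG (fun h => z (g^-1 * h)%g))//.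
  have [_ h] := hU (i, g); apply: h => [h|h hK]; first by rewrite lop_shift; exact: zi.
  apply: hi; apply/windowP; have : g^-1%g \in codom (@inv_enum G A).
    by rewrite codom_inv_enum invgK.
  by move=> /codomP[j ->]; exists j, h.
Qed.

Definition nice_set (K : seq G) (eps : R) (y : G -> R) : set TG :=
  [set x | Xf f x /\ forall k, k \in K -> cball (qc (y k)) eps (x k)].

Definition nice_cover (K : seq G) (eps : R) : set (set TG) :=
  [set nice_set K eps y | y in [set: G -> R]].

Lemma nice_cover_open K eps : 0 < eps -> open_cover f (nice_cover K eps).
Proof.
move=> eps0; split.
  move=> _ [y _ <-]; exists [set x | forall k, k \in K -> cball (qc (y k)) eps (x k)] => //.
  elim: K => [|k K IH].
    rewrite (_ : [set x | _] = setT); first exact: openT.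
    by apply/seteqP; split.
  rewrite (_ : [set x | _] = [set x : TG | cball (qc (y k)) eps (x k)] `&`
     [set x : TG | forall k, k \in K -> cball (qc (y k)) eps (x k)]).
    by apply: openI => //; apply: ev_open; exact: cball_open.
  apply/seteqP; split=> x /=.
    move=> h; split; first by apply: h; rewrite inE eqxx.
    by move=> k' kK; apply: h; rewrite inE kK orbT.
  by move=> [h1 h2] k'; rewrite inE => /orP[/eqP ->|]; [|exact: h2].
apply/seteqP; split=> [x [_ [y _ <-]] []//|x hx].
have [y [yx _]] := lift_ex x; exists (nice_set K eps y); first by exists y.
split=> // k _; rewrite -yx; apply/cball_qc; exists 0.
by rewrite subr0 subrr normr0.
Qed.

(** A member of the join contains at most one point of the family: two such points would lie within
    eps / 2 of common centres at every place of the window. *)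
Lemma subcover_lower A K (eps : R) n (I : finType) (y : I -> G -> R) :
  has_subcover f (cover_join A (nice_cover K (eps / 2))) n ->
  (forall i, lop_int a (y i)) -> sep (window (@inv_enum G A) K) eps y -> (#|I| <= n)%N.
Proof.
move=> [C [CV UC Cn]] yi ys.
have hW i : exists W : set TG, C W /\ W (qG (y i)).
  have : Xf f (qG (y i)) by apply/Xf_lift; exact: yi.
  by rewrite -UC => -[W CW Wy]; exists W.
have [W hW'] := choice hW.
have Winj : injective W.
  move=> i j ij; apply: contrapT => /(ys i j)[g /windowP[l [k [kK gE]]] hg].
  have [CWi Wi] := hW' i; have [_ Wj] := hW' j; rewrite -ij in Wj.
  have [c [hc WE]] := CV _ CWi.
  set h := (inv_enum l)^-1%g; have hA : h \in A by rewrite -codom_inv_enum codom_f.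
  have := hc h hA; move=> [t _ tE].
  rewrite WE in Wi Wj; have /act_image := Wi h hA; have /act_image := Wj h hA.
  rewrite -tE => -[_ /(_ k kK) hj] [_ /(_ k kK) hi]; move: hi hj.
  rewrite /Defs.act /qG invgK -gE => /cball_qc[m1 h1] /cball_qc[m2 h2].
  have := hg (m2 - m1); rewrite leNgt => /negP; apply.
  rewrite (_ : _ - _ = (t k - y j g - m2%:~R) - (t k - y i g - m1%:~R)); last by rewrite intrB; ring.
  by apply: le_lt_trans (ler_normB _ _) _; rewrite (splitr eps); apply: ltrD.
have : (`I_#|I| #<= `I_n)%card.
  apply: card_le_trans (_ : (C #<= `I_n)%card); last by move: Cn; rewrite card_eq_le => /andP[].
  apply: card_le_trans (_ : (W @` [set: I] #<= C)%card); last first.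
    by apply: subset_card_le => _ [i _ <-]; have [] := hW' i.
  have : (W @` [set: I] #= `I_#|I|)%card.
    by apply: card_eq_trans (inj_card_eq _) (fin_card I) => i j _ _; exact: Winj.
  by rewrite card_eq_le => /andP[].
by rewrite card_le_II.
Qed.

End Subcovers.

Section Entropy.
Variables (R : realType) (G : groupType) (f : group_ring G).
Variables (w : G -> R) (C : R).
Hypothesis ha : l1inv (ar R f) w C.
Variables (L : R) (F : nat -> {fset G}).
Hypothesis hL : gram_rate (ar R f) L.
Hypothesis hL' : gram_rate (adj (ar R f)) L.
Hypothesis hF : folner R F.
Local Notation TG := {ptws G -> circle R}.
Local Notation N V n := (subcover_number f (cover_join (F n) V)).
Local Notation s V := (fun n => ln (N V n)%:R / #|` F n|%:R : R).

Lemma card_F_gt0 n : 0 < (#|` F n|%:R : R).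
Proof. by rewrite ltr0n lt0n cardfs_eq0; exact: hF.1. Qed.

Lemma boundary_small (K : seq G) (D eta : R) : 0 <= D -> 0 < eta ->
  exists M, forall n, (M <= n)%N -> D * (bd (@inv_enum G (F n)) K)%:R <= #|` F n|%:R * eta.
Proof.
move=> D0 eta0; have D1 : 0 < D + 1 by rewrite ltr_wpDl.
have [M hM] := folner_bd K hF (divr_gt0 eta0 D1); exists M => n /hM h.
apply: le_trans (ler_wpM2l D0 h) _; rewrite mulrA mulrC ler_wpM2l//.
by rewrite mulrCA ger_pMr// ler_pdivrMr// mul1r lerDl.
Qed.

Lemma entropy_upper (V : set (set TG)) (del : R) : open_cover f V -> 0 < del ->
  exists M, forall n, (M <= n)%N -> 0 <= s V n <= L + del.
Proof.
move=> oV del0; have [K [eps [eps0 leb]]] := lebesgue_number oV.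
have d2 : 0 < del / 2 by rewrite divr_gt0.
have [K' [D [D0 up]]] := sep_upper_exp ha K hL hL' eps0 d2.
have [M hM] := boundary_small K' D0 d2; exists M => n /hM hb.
have := @subcover_upper R G f V (F n) K eps _ oV (hF.1 n) leb
  (fun I y yi ys => up _ _ (@inv_enum_inj G (F n)) I y yi ys).
move=> [k [kX hk]]; have [hN Nk] := subcover_numberP hk.
have N0 := subcover_gt0 hN.
have c0 := card_F_gt0 n.
rewrite divr_ge0 ?ln_ge0 ?ler1n//= ler_pdivrMr//.
rewrite -ler_expR lnK ?posrE ?ltr0n//.
apply: (@le_trans _ _ k%:R); first by rewrite ler_nat.
apply: le_trans kX _; rewrite ler_expR mulrDl (splitr del).
move: hb; set b := D * _; set c := #|`_|%:R; move=> hb.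
by rewrite [L * c]mulrC; lra.
Qed.

(* For a cover whose sequence diverges, [lim] is the junk value 0; it does not
   exceed the supremum since the rate is nonnegative. *)
Lemma rate_ge0 : 0 <= L.
Proof.
have oV : open_cover f (@nice_cover R G f [::] 1) by exact: nice_cover_open.
apply/ler_addgt0Pr => e e0; have [M hM] := entropy_upper oV e0.
by have /andP[h1 h2] := hM M (leqnn _); exact: le_trans h1 h2.
Qed.

(** No cover exceeds L. For the cover at the scale K, eps / 2 with K and eps from [sep_lower_exp],
    the sequence is squeezed to L, so its [lim] is a true limit and the supremum is attained. *)
Lemma entropyE : entropy R F f = L%:E.
Proof.
have [K [eps [eps0 low]]] := sep_lower_exp (ai := ai f) ha hL.
have eps2 : 0 < eps / 2 by rewrite divr_gt0.
have oV0 : open_cover f (nice_cover f K (eps / 2)) by exact: nice_cover_open.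
apply/eqP; rewrite eq_le; apply/andP; split.
  apply: ge_ereal_sup => _ [V oV <-]; rewrite lee_fin.
  have [cv|dv] := pselect (cvg (s V @ \oo)); last by rewrite dvgP//; exact: rate_ge0.
  apply/ler_addgt0Pr => e e0; have [M hM] := entropy_upper oV e0.
  by apply: limr_le => //; exists M => // n /hM /andP[].
apply: ereal_sup_ubound; exists (nice_cover f K (eps / 2)) => //.
congr EFin; apply: cvg_lim => //.
apply/cvgrPdist_le => e e0.
have e2 : 0 < e / 2 by rewrite divr_gt0.
have [M1 hM1] := entropy_upper oV0 e0.
have [K' [D [D0 hlow]]] := low _ e2.
have [M2 hM2] := boundary_small K' D0 e2.
exists (maxn M1 M2) => // n /=; rewrite geq_max => /andP[/hM1/andP[N0 hu] /hM2 hb].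
have c0 := card_F_gt0 n.
have [I [y [yi ys yN]]] := hlow _ _ (@inv_enum_inj G (F n)).
(* The upper count provides some finite subcover, so that [subcover_number] is a true minimum and
   not its default value. *)
have [K1 [eps1 [eps10 leb]]] := lebesgue_number oV0.
have [K2 [D2 [D20 up]]] := sep_upper_exp ha K1 hL hL' eps10 e2.
have := @subcover_upper R G f _ (F n) K1 eps1 _ oV0 (hF.1 n) leb
  (fun I y yi ys => up _ _ (@inv_enum_inj G (F n)) I y yi ys).
move=> [k [_ hk]]; have [hN _] := subcover_numberP hk.
have IN := subcover_lower hN yi ys.
have Np := subcover_gt0 hN.
have : L - e <= s (nice_cover f K (eps / 2)) n.
  rewrite ler_pdivlMr// -ler_expR lnK ?posrE ?ltr0n//.
  apply: (@le_trans _ _ #|I|%:R); last by rewrite ler_nat.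
  apply: le_trans yN; rewrite ler_expR mulrBl (mulrC L) (mulrC e) {1}(splitr e).
  by move: hb; set b := D * _; set c := #|`_|%:R; lra.
move: hu; set t := _ / _ => hu hl; apply/ler_normlP; split; lra.
Qed.

End Entropy.

Theorem theorem1p1 (R : realType) (G : groupType) (f : group_ring G)
    (G_countable : countable [set: G]) (G_amenable : amenable R G)
    (G_rf : residually_finite G) :
  (expansive R f <-> L1_unit (ZG_L1 R f)) /\
  (expansive R f ->
     forall F : nat -> {fset G}, folner R F ->
       entropy R F f = (ln (FK_det (rho (ZG_L1 R f))))%:E).
Proof.
split.
  split=> [h|/unit_l1inv[w [C ha]]]; last exact: unit_expansive ha.
  by apply/unit_l1inv; exact: expansive_l1inv G_rf h.
move=> /(expansive_l1inv G_rf)[w [C ha]] F hF.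
rewrite (rho_Tl2 (ar_coef R f)).
have hL : gram_rate (ar R f) (ln (FK_det (Tl2 (ar R f)))) by exact: det_asymp ha.
(* The rate of f^* is computed with its own determinant and identified with that of f. *)
have hL' : gram_rate (adj (ar R f)) (ln (FK_det (Tl2 (ar R f)))).
  by rewrite -(lnFK_adj ha); exact: det_asymp (l1inv_adj ha).
have -> := entropyE ha hL hL' hF.
by [].
Qed.
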